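(* Let $C$ be an irreducible plane curve germ in $(\mathbb{C}^2,\mathbf{0})$ with only one Puiseux pair $(n,m)$, let $\Lambda$ be its semimodule of differential values, let $(\lambda_{-1},\lambda_0,\lambda_1,\ldots,\lambda_s)$ be the basis of $\Lambda$, and let $t_{s+1}$ and $\tilde t_{s+1}$ be the last critical values of $\Lambda$. Then there exist two $1$-forms $\omega_{s+1},\tilde\omega_{s+1}\in\Omega^1_{\mathbb C^2,\mathbf 0}$ having $C$ as an invariant curve and such that $$\nu_{D_C}(\omega_{s+1})=t_{s+1},\qquad \nu_{D_C}(\tilde\omega_{s+1})=\tilde t_{s+1}.$$ Moreover, for any pair of $1$-forms $\omega_{s+1},\tilde\omega_{s+1}$ having $C$ as an invariant curve and with these divisorial orders, the set $\{\omega_{s+1},\tilde\omega_{s+1}\}$ is a Saito basis for $C$.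
   Context: Cusps. An irreducible plane curve germ $C$ in $(\mathbb C^2,\mathbf 0)$ with a single Puiseux pair $(n,m)$ ($2\le n<m$ coprime) is called a cusp; there are coordinates $(x,y)$, called adapted coordinates, in which $C$ has a primitive parametrization $\phi(t)=(t^n,b(t))$ with $\operatorname{ord}_t b(t)=m$. For $h\in\mathcal O_{\mathbb C^2,\mathbf 0}=\mathbb C\{x,y\}$ put $\nu_C(h)=\operatorname{ord}_t(h(\phi(t)))$; for a germ of holomorphic $1$-form $\omega\in\Omega^1_{\mathbb C^2,\mathbf 0}$ with $\phi^*\omega=\alpha(t)dt$ put $\nu_C(\omega)=\operatorname{ord}_t(\alpha)+1$ ($=\infty$ if $\phi^*\omega=0$). The curve $C$ is invariant for $\omega$ if $\nu_C(\omega)=\infty$. The set of such forms is denoted $\Omega^1_{\mathbb C^2,\mathbf 0}[C]$; it is a free $\mathcal O_{\mathbb C^2,\mathbf 0}$-module of rank two, and a basis of it is called a Saito basis for $C$. The semigroup of $C$ is $\Gamma=n\mathbb Z_{\ge0}+m\mathbb Z_{\ge0}$, and the semimodule of differential values is $\Lambda=\{\nu_C(\omega):\omega\in\Omega^1_{\mathbb C^2,\mathbf 0}\}\setminus\{\infty\}$, which satisfies $\Lambda+\Gamma\subset\Lambda$. Divisorial order. $D_C$ is the unique irreducible component of the exceptional divisor of the minimal reduction of singularities of $C$ that meets the strict transform of $C$. In adapted coordinates $(x,y)$ the divisorial order with respect to $D_C$ is the monomial order: for $h=\sum h_{ij}x^iy^j$, $\nu_{D_C}(h)=\min\{ni+mj: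 h_{ij}\ne0\}$, and for $\omega=a\,dx+b\,dy$, $\nu_{D_C}(\omega)=\min\{\nu_{D_C}(xa),\nu_{D_C}(yb)\}$. It does not depend on the choice of adapted coordinates. Basis and critical values. The basis of $\Lambda$ is the unique strictly increasing sequence $(\lambda_{-1},\lambda_0,\ldots,\lambda_s)$ with $\Lambda=\bigcup_{i=-1}^s(\lambda_i+\Gamma)$ and $\lambda_j\notin\Lambda_{j-1}$ for $0\le j\le s$, where $\Lambda_i=\bigcup_{k=-1}^i(\lambda_k+\Gamma)$; one has $\lambda_{-1}=n$, $\lambda_0=m$. For $1\le i\le s+1$ let $\ell_i^n$ (resp. $\ell_i^m$) be the least integer $\ell\ge1$ with $\lambda_{i-1}+n\ell\in\Lambda_{i-2}$ (resp. $\lambda_{i-1}+m\ell\in\Lambda_{i-2}$). The critical values are defined by $t_{-1}=\lambda_{-1}$, $t_0=\lambda_0$ and, for $1\le i\le s+1$, $t_i^n=t_{i-1}+n\ell_i^n$, $t_i^m=t_{i-1}+m\ell_i^m$, $t_i=\min\{t_i^n,t_i^m\}$, $\tilde t_i=\max\{t_i^n,t_i^m\}$. *)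

(* Defs.v *)
From HB Require Import structures.
From mathcomp Require Import all_boot all_order all_algebra.
From mathcomp Require Import boolp classical_sets functions reals.
From mathcomp Require Import complex.

Set Implicit Arguments.
Unset Strict Implicit.
Unset Printing Implicit Defensive.

Import Order.TTheory GRing.Theory Num.Theory.
Local Open Scope ring_scope.
Local Open Scope complex_scope.
Local Open Scope classical_set_scope.

(** * Formal power series, as coefficient sequences with the Cauchy product *)

Definition fps (A : comNzRingType) := nat -> A.

Section FpsRing.
Variable A : comNzRingType.
Implicit Types f g h : fps A.

HB.instance Definition _ := GRing.Zmodule.copy (fps A) (nat -> A).

Definition fps_one : fps A := fun k => (k == 0%N)%:R.
Definition fps_mul f g : fps A := fun k => \sum_(i < k.+1) f i * g (k - i)%N.

Let trunc N f : {poly A} := \poly_(i < N) f i.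

Let truncM N f g k : (k < N)%N -> (trunc N f * trunc N g)`_k = fps_mul f g k.
Proof.
move=> kN; rewrite coefM; apply: eq_bigr => i _; rewrite !coef_poly.
have iN : (i < N)%N by apply: leq_trans kN; rewrite ltn_ord.
by rewrite iN (leq_ltn_trans (leq_subr _ _) kN).
Qed.

Let fps_mulC : commutative fps_mul.
Proof.
move=> f g; apply/funext => k.
by rewrite -!(@truncM k.+1) ?ltnSn // mulrC.
Qed.

Let fps_mulA : associative fps_mul.
Proof.
move=> f g h; apply/funext => k.
rewrite -!(@truncM k.+1) ?ltnSn //.
transitivity (trunc k.+1 f * (trunc k.+1 g * trunc k.+1 h))`_k.
  rewrite !coefM; apply: eq_bigr => i _; congr (_ * _).
  have ik : (k - i < k.+1)%N by rewrite ltnS leq_subr.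
  by rewrite coef_poly ik truncM.
rewrite mulrA !coefM; apply: eq_bigr => i _; congr (_ * _).
by rewrite coef_poly ltn_ord truncM ?ltn_ord.
Qed.

Let fps_mul1 : left_id fps_one fps_mul.
Proof.
move=> f; apply/funext => k.
rewrite /fps_mul big_ord_recl /= /fps_one eqxx mul1r subn0 big1 ?addr0 // => i _.
by rewrite mul0r.
Qed.

Let fps_mulDl : left_distributive fps_mul +%R.
Proof.
move=> f g h; apply/funext => k.
rewrite [RHS](_ : _ = fps_mul f h k + fps_mul g h k) // /fps_mul -big_split /=.
by apply: eq_bigr => i _; rewrite -mulrDl.
Qed.

Let fps_one_neq0 : fps_one != 0.
Proof.
by apply/eqP => /(congr1 (fun f : fps A => f 0%N)) /eqP; rewrite oner_eq0.
Qed.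

HB.instance Definition _ := GRing.Zmodule_isComNzRing.Build (fps A)
  fps_mulA fps_mulC fps_mul1 fps_mulDl fps_one_neq0.

Lemma fpsME f g k : (f * g) k = \sum_(i < k.+1) f i * g (k - i)%N.
Proof. by []. Qed.

Lemma fps1E k : (1 : fps A) k = (k == 0%N)%:R.
Proof. by []. Qed.

Lemma fpsDE f g k : (f + g) k = f k + g k.
Proof. by []. Qed.

Lemma fpsNE f k : (- f) k = - f k.
Proof. by []. Qed.

Lemma fps_sumE (I : Type) (r : seq I) (P : pred I) (F : I -> fps A) k :
  (\sum_(i <- r | P i) F i) k = \sum_(i <- r | P i) F i k.
Proof. by elim/big_rec2: _ => // i x y _ <-. Qed.

End FpsRing.

(* The coefficient of x^i y^j in h : fps2 R is h i j. *)
Definition fps1 (R : realType) := fps R[i].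
Definition fps2 (R : realType) := fps (fps R[i]).

(** * Convergent power series *)

Section Convergence.
Variable R : realType.
Implicit Types (a b : fps1 R) (f g h : fps2 R).

(* Absolute convergence on a disc (resp. polydisc) of positive radius: the
   partial sums of the nonnegative series are bounded. *)
Definition convergent1 a := exists2 r : R, 0 < r & exists M : R, forall N : nat,
  \sum_(k < N) `|a k| * r%:C ^+ k <= M%:C.

Definition convergent2 h := exists2 r : R, 0 < r & exists M : R, forall N : nat,
  \sum_(i < N) \sum_(j < N) `|h i j| * r%:C ^+ (i + j) <= M%:C.

Definition conv2 : {pred fps2 R} := fun h => `[< convergent2 h >].

Let wnorm (r : R) N a : R[i] := \sum_(k < N) `|a k| * r%:C ^+ k.
Let wnorm2 r N h : R[i] := \sum_(i < N) wnorm r N (h i) * r%:C ^+ i.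

Let wnorm2E r N h :
  \sum_(i < N) \sum_(j < N) `|h i j| * r%:C ^+ (i + j) = wnorm2 r N h.
Proof.
apply: eq_bigr => i _; rewrite mulr_suml; apply: eq_bigr => j _.
by rewrite addnC exprD mulrA.
Qed.

Let rXge0 (r : R) k : 0 < r -> 0 <= r%:C ^+ k.
Proof. by move=> r0; rewrite exprn_ge0 // lecR ltW. Qed.

Let wnorm_ge0 r N a : 0 < r -> 0 <= wnorm r N a.
Proof. by move=> r0; apply: sumr_ge0 => i _; rewrite mulr_ge0 ?rXge0. Qed.

Let wnorm2_ge0 r N h : 0 < r -> 0 <= wnorm2 r N h.
Proof.
by move=> r0; apply: sumr_ge0 => i _; rewrite mulr_ge0 ?wnorm_ge0 ?rXge0.
Qed.

Let cauchy_le (u v : nat -> R[i]) N :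
  (forall k, 0 <= u k) -> (forall k, 0 <= v k) ->
  \sum_(k < N) \sum_(i < k.+1) u i * v (k - i)%N
    <= (\sum_(i < N) u i) * (\sum_(j < N) v j).
Proof.
move=> u0 v0; under eq_bigr => k _ do
  rewrite (big_ord_widen N (fun i => u i * v (k - i)%N)) ?ltn_ord //.
rewrite (exchange_big_dep xpredT) //= mulr_suml.
apply: ler_sum => i _; rewrite -mulr_sumr ler_wpM2l //.
rewrite [leLHS](eq_bigl (fun k : 'I_N => (i <= k)%N)) //.
rewrite -(big_geq_mkord i N xpredT (fun k => v (k - i)%N)).
rewrite -{1}[i : nat]add0n big_addn.
under eq_bigr => k _ do rewrite addnK.
rewrite -(big_mkord xpredT v) [leRHS](@big_cat_nat _ _ _ (N - i)) ?leq_subr //=.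
by rewrite lerDl sumr_ge0.
Qed.

Let wnorm_mul r N a b : 0 < r -> wnorm r N (a * b) <= wnorm r N a * wnorm r N b.
Proof.
move=> r0; pose u (c : fps1 R) k := `|c k| * r%:C ^+ k.
have u0 c k : 0 <= u c k by rewrite mulr_ge0 ?rXge0.
apply: le_trans (cauchy_le N (u0 a) (u0 b)).
apply: ler_sum => k _; rewrite fpsME.
apply: le_trans (ler_wpM2r (rXge0 k r0) (ler_norm_sum _ _ _)) _.
rewrite mulr_suml; apply: ler_sum => i _.
by rewrite normrM /u mulrACA -exprD subnKC // -ltnS.
Qed.

Let wnorm_sum r N (I : Type) (s : seq I) (F : I -> fps1 R) : 0 < r ->
  wnorm r N (\sum_(i <- s) F i) <= \sum_(i <- s) wnorm r N (F i).
Proof.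
move=> r0; rewrite exchange_big /=; apply: ler_sum => k _.
by rewrite -mulr_suml ler_wpM2r ?rXge0 // fps_sumE ler_norm_sum.
Qed.

Let wnorm2_mul r N f g : 0 < r ->
  wnorm2 r N (f * g) <= wnorm2 r N f * wnorm2 r N g.
Proof.
move=> r0; pose u (c : fps2 R) k := wnorm r N (c k) * r%:C ^+ k.
have u0 c k : 0 <= u c k by rewrite mulr_ge0 ?rXge0 ?wnorm_ge0.
apply: le_trans (cauchy_le N (u0 f) (u0 g)).
apply: ler_sum => k _; rewrite fpsME.
apply: le_trans (ler_wpM2r (rXge0 k r0) (wnorm_sum _ _ _ r0)) _.
rewrite mulr_suml; apply: ler_sum => i _.
rewrite /u mulrACA -exprD subnKC; last by rewrite -ltnS.
by rewrite ler_wpM2r ?rXge0 // wnorm_mul.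
Qed.

Let wnorm2_sub r N f g : 0 < r ->
  wnorm2 r N (f - g) <= wnorm2 r N f + wnorm2 r N g.
Proof.
move=> r0; rewrite -big_split /=; apply: ler_sum => i _.
rewrite -mulrDl ler_wpM2r ?rXge0 // -big_split /=; apply: ler_sum => j _.
by rewrite -mulrDl ler_wpM2r ?rXge0 // -(normrN (g i j)) ler_normD.
Qed.

Let wnorm2_mono r r' N h : 0 < r -> r <= r' -> wnorm2 r N h <= wnorm2 r' N h.
Proof.
move=> r0 rr'; rewrite -!wnorm2E.
apply: ler_sum => i _; apply: ler_sum => j _.
by rewrite ler_wpM2l // lerXn2r ?nnegrE ?lecR // ?ltW // (lt_le_trans r0).
Qed.

Let conv2_common f g : convergent2 f -> convergent2 g ->
  exists2 r : R, 0 < r & exists M : R, forall N,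
    wnorm2 r N f <= M%:C /\ wnorm2 r N g <= M%:C.
Proof.
move=> [r r0 [M rM]] [q q0 [L qL]].
exists (Num.min r q); first by rewrite lt_min r0.
have m0 : 0 < Num.min r q by rewrite lt_min r0.
exists (Num.max M L) => N; split.
  apply: le_trans (@wnorm2_mono _ r _ _ m0 _) _; first by rewrite ge_min lexx.
  by rewrite -wnorm2E (le_trans (rM N)) // lecR le_max lexx.
apply: le_trans (@wnorm2_mono _ q _ _ m0 _) _; first by rewrite ge_min lexx orbT.
by rewrite -wnorm2E (le_trans (qL N)) // lecR le_max lexx orbT.
Qed.

Let one2E i j : (1 : fps2 R) i j = ((i == 0%N) && (j == 0%N))%:R.
Proof. by rewrite [_ i]fps1E; case: i. Qed.

Let conv2_1 : 1 \in conv2.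
Proof.
apply/asboolP; exists 1 => //; exists 1 => N.
case: N => [|N]; first by rewrite big_ord0 lecR ler01.
rewrite big_ord_recl big_ord_recl /= one2E normr1 mulr1 big1 => [|j _]; last first.
  by rewrite one2E normr0 mul0r.
rewrite big1 => [|i _]; first by rewrite !addr0.
by rewrite big1 // => j _; rewrite one2E normr0 mul0r.
Qed.

Let conv2_sub : {in conv2 &, forall f g, f - g \in conv2}.
Proof.
move=> f g /asboolP cf /asboolP cg; apply/asboolP.
have [r r0 [M bM]] := conv2_common cf cg.
exists r => //; exists (M + M) => N; have [fM gM] := bM N.
by rewrite wnorm2E (le_trans (wnorm2_sub _ _ _ r0)) // rmorphD /= lerD.
Qed.

Let conv2_mul : {in conv2 &, forall f g, f * g \in conv2}.
Proof.
move=> f g /asboolP cf /asboolP cg; apply/asboolP.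
have [r r0 [M bM]] := conv2_common cf cg.
exists r => //; exists (M * M) => N; have [fM gM] := bM N.
rewrite wnorm2E (le_trans (wnorm2_mul _ _ _ r0)) // rmorphM /=.
by rewrite ler_pM ?wnorm2_ge0.
Qed.

Let conv2_subring : subring_closed conv2.
Proof. by split; [exact: conv2_1|exact: conv2_sub|exact: conv2_mul]. Qed.

HB.instance Definition _ :=
  GRing.isSubringClosed.Build (fps2 R) conv2 conv2_subring.

(* The local ring C{x,y} of germs of holomorphic functions at the origin. *)
Record germ := Germ { germ_val :> fps2 R; germP : germ_val \in conv2 }.

HB.instance Definition _ := [isSub for germ_val].
HB.instance Definition _ := [Choice of germ by <:].
HB.instance Definition _ := [SubChoice_isSubComNzRing of germ by <:].

End Convergence.

(** * Orders, substitution and derivation of formal series *)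

(* Orders take values in option nat, None standing for +oo. *)
Definition min_opt (P : set nat) : option nat :=
  match pselect (exists k, `[< P k >]) with
  | left exP => Some (ex_minn exP)
  | right _ => None
  end.

Definition omin (u v : option nat) : option nat :=
  match u, v with
  | Some a, Some b => Some (minn a b)
  | None, w | w, None => w
  end.

Section Formal.
Variable R : realType.

Definition ser_ord (a : fps1 R) : option nat := min_opt [set k | a k != 0].

Definition tpow (n : nat) : fps1 R := fun k => (k == n)%:R.
Definition ser_x : fps2 R := fun i j => ((i == 1%N) && (j == 0%N))%:R.
Definition ser_y : fps2 R := fun i j => ((i == 0%N) && (j == 1%N))%:R.

(* Substitution of series without constant term: only finitely many terms
   contribute to a given coefficient, and the sums below contain them all. The
   definitions are meaningless when a constant term is nonzero. *)
Definition comp11 (a s : fps1 R) : fps1 R :=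
  fun k => \sum_(i < k.+1) a i * (s ^+ i) k.

Definition comp21 (h : fps2 R) (u v : fps1 R) : fps1 R :=
  fun k => \sum_(i < k.+1) \sum_(j < k.+1) h i j * (u ^+ i * v ^+ j) k.

Definition comp22 (h u v : fps2 R) : fps2 R :=
  fun k l => \sum_(i < (k + l).+1) \sum_(j < (k + l).+1)
               h i j * (u ^+ i * v ^+ j) k l.

Definition ddt (a : fps1 R) : fps1 R := fun k => a k.+1 *+ k.+1.
Definition ddx (h : fps2 R) : fps2 R := fun i j => h i.+1 j *+ i.+1.
Definition ddy (h : fps2 R) : fps2 R := fun i j => h i j.+1 *+ j.+1.

(* Order for the weights n of x and m of y. *)
Definition mono_ord (n m : nat) (h : fps2 R) : option nat :=
  min_opt [set k | exists i j : nat, h i j != 0 /\ k = (n * i + m * j)%N].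

(* The same for the 1-form a dx + b dy. *)
Definition mono_ord_form (n m : nat) (a b : fps2 R) : option nat :=
  omin (mono_ord n m (ser_x * a)) (mono_ord n m (ser_y * b)).

End Formal.

(** * Plane branches and their parametrizations *)

Section Curves.
Variable R : realType.
Implicit Types (f g h : germ R) (c : fps1 R * fps1 R).

Definition germ_is_unit f := exists g, f * g = 1.

(* An irreducible plane curve germ is f = 0 for an irreducible f. *)
Definition germ_irreducible f :=
  ~ germ_is_unit f /\
  forall g h, f = g * h -> germ_is_unit g \/ germ_is_unit h.

Definition is_arc c :=
  [/\ convergent1 c.1, convergent1 c.2, c.1 0%N = 0 & c.2 0%N = 0].

(* c factors through another arc only by a change of parameter s of order 1; in
   particular c is not constant. *)
Definition primitive_arc c := forall d (s : fps1 R),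
  is_arc d -> convergent1 s -> s 0%N = 0 ->
  c = (comp11 d.1 s, comp11 d.2 s) -> ser_ord s = Some 1%N.

Definition primitive_parametrization f c :=
  [/\ is_arc c, primitive_arc c & comp21 f c.1 c.2 = 0].

(* A germ of biholomorphism of (C^2,0), given together with its inverse. *)
Record coords := Coords {
  co_x : germ R;
  co_y : germ R;
  inv_x : germ R;
  inv_y : germ R;
  co_x0 : germ_val co_x 0%N 0%N = 0;
  co_y0 : germ_val co_y 0%N 0%N = 0;
  inv_x0 : germ_val inv_x 0%N 0%N = 0;
  inv_y0 : germ_val inv_y 0%N 0%N = 0;
  co_xK : comp22 co_x inv_x inv_y = ser_x R;
  co_yK : comp22 co_y inv_x inv_y = ser_y R;
  inv_xK : comp22 inv_x co_x co_y = ser_x R;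
  inv_yK : comp22 inv_y co_x co_y = ser_y R }.

(* Read in the coordinates Psi, the arc c is (t^n, b(t)) with ord b = m. *)
Definition adapted (n m : nat) c (Psi : coords) :=
  comp21 (co_x Psi) c.1 c.2 = tpow R n /\
  ser_ord (comp21 (co_y Psi) c.1 c.2) = Some m.

End Curves.

(** * Differential forms *)

Section Forms.
Variable R : realType.

(* w stands for w 0 0 dx + w 0 1 dy. *)
Definition form1 := 'rV[germ R]_2.
Implicit Types (w : form1) (c : fps1 R * fps1 R).

(* The series alpha with phi^* w = alpha(t) dt, where phi = c. *)
Definition pullback_arc c w : fps1 R :=
  comp21 (w 0 0) c.1 c.2 * ddt c.1 + comp21 (w 0 1) c.1 c.2 * ddt c.2.

Definition nuC c w : option nat := omap S (ser_ord (pullback_arc c w)).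

Definition invariant_curve c w := nuC c w = None.

(* The divisorial order is the monomial order of the expression of w in the
   coordinates Psi, that is, of the pullback of w by the inverse of Psi. *)
Definition nuD (n m : nat) (Psi : coords R) w : option nat :=
  let u : fps2 R := inv_x Psi in let v : fps2 R := inv_y Psi in
  let a := comp22 (w 0 0) u v in let b := comp22 (w 0 1) u v in
  mono_ord_form n m (a * ddx u + b * ddx v) (a * ddy u + b * ddy v).

Definition diff_values c : set nat :=
  [set k | exists w : form1, nuC c w = Some k].

(* A basis of the module of the forms for which c is invariant. *)
Definition saito_basis c (w1 w2 : form1) :=
  [/\ invariant_curve c w1, invariant_curve c w2,
      forall w, invariant_curve c w -> exists g h : germ R, w = g *: w1 + h *: w2
    & forall g h : germ R, g *: w1 + h *: w2 = 0 -> g = 0 /\ h = 0].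

End Forms.

(** * Basis and critical values of a semimodule *)

(* The basis (lambda_{-1}, ..., lambda_s) is stored as a sequence lam of size
   s + 2, whose item of index i is lambda_{i-1}. *)
Section Semimodule.
Variables n m : nat.
Implicit Types (lam : seq nat).

Definition Gamma : set nat := [set k | exists p q : nat, k = (n * p + m * q)%N].

(* The set Lambda_{k-1}. *)
Definition Lambda_upto lam (k : nat) : set nat :=
  [set v | exists2 i : nat, (i <= k)%N &
           exists2 g, Gamma g & v = (nth 0%N lam i + g)%N].

Definition semimodule_basis (Lam : set nat) (s : nat) lam :=
  [/\ size lam = s.+2, sorted ltn lam, Lam = Lambda_upto lam s.+1
    & forall j : nat, (j <= s)%N -> ~ Lambda_upto lam j (nth 0%N lam j.+1)].

(* For i >= 1 and d = n (resp. d = m) this is ell_i^n (resp. ell_i^m). The set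
   is nonempty, as Gamma contains all large integers, so the default value 0 is
   never used when n and m are coprime. *)
Definition ell lam (d i : nat) : nat :=
  odflt 0%N (min_opt [set l | (1 <= l)%N /\
                              Lambda_upto lam i.-1 (nth 0%N lam i + d * l)%N]).

(* The critical value t_i for i >= 0; t_{-1} plays no role in the recursion. *)
Fixpoint crit lam (i : nat) : nat :=
  if i is j.+1 then
    minn (crit lam j + n * ell lam n i) (crit lam j + m * ell lam m i)
  else nth 0%N lam 1%N.

(* The value tilde t_i for i >= 1. *)
Definition crit_tilde lam (i : nat) : nat :=
  maxn (crit lam i.-1 + n * ell lam n i) (crit lam i.-1 + m * ell lam m i).

End Semimodule.

(* Main.v *)
From HB Require Import structures.
From mathcomp Require Import all_boot all_order all_algebra.
From mathcomp Require Import boolp classical_sets reals.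
From mathcomp Require Import complex.
From mathcomp Require Import zify ring lra.
Require Import Defs.

Set Implicit Arguments.
Unset Strict Implicit.
Unset Printing Implicit Defensive.

Import Order.TTheory GRing.Theory Num.Theory.
Local Open Scope ring_scope.
Local Open Scope complex_scope.

(** Only the parametrization matters. A change of coordinates turns it into
    [(t^n, b t)] with [b] of order [m], where the divisorial order is the weighted
    order; the chain rule shows that values, Saito bases and divisorial orders
    are transported ([pullK], [pullback_arc_pull]).

    Forms [om i] with value [lambda_i] and divisorial order [t_i] are built one
    after the other ([standard_step]). Call [x^p y^q om_i] a monomial, of weight
    [lambda_i + np + mq], the order of its pullback. The last generator of
    [Lambda_a] meets its two neighbours on the staircase of [Lambda_a] in two
    corners, one in direction [x] and one in direction [y], and each of them is
    a pair of monomials of equal weight. Scaled so that its leading term cancels,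
    the difference of such a pair is reduced by subtracting heavier monomials:
    the result either lies in the kernel of the pullback or has a value outside
    [Lambda_a] ([reduction]). The next generator of the semimodule lies below
    the larger corner only, and replaces it by the two corners of the next stage
    ([corner_split]). Together with the relations used before, the two corners
    identify all the monomials of a given weight ([connected_step]); hence no
    value outside [Lambda_a] is smaller than what the reduced corners give
    ([small_values]). So the smaller corner produces the next form, and the
    larger one a form for which the curve is invariant. When the semimodule is
    exhausted, both corners give invariant forms, whose divisorial orders are
    the two last critical values.

    These two forms are a Saito basis by Saito's criterion. Weights are followed
    through wedge products, and at every stage exactly one pure power of [y]
    survives in the initial part; at the end its exponent is [n]
    ([wedge_corners]). The product of the two forms vanishes along the curve and
    has order at most [n] on the line [x = 0], so by Weierstrass division it
    divides every function that vanishes along the curve ([ideal_principal]),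
    and Cramer's rule gives the coefficients of any invariant form
    ([saito_criterion]).

    Finally the difference of the two last critical values does not lie in the
    semigroup. So the matrix which expresses two invariant forms with these
    orders in that basis is triangular modulo the maximal ideal, with a unit
    determinant ([saito_basis_of_orders]). *)

(** * Formal power series *)

(** Series that solve a triangular system (quotients, expansions along a
    sequence of monomials) are all obtained from this recursion. *)
Lemma strong_recursion (A : Type) (a0 : A) (F : (nat -> A) -> nat -> A) :
  (forall f g k, (forall i, (i < k)%N -> f i = g i) -> F f k = F g k) ->
  exists f, forall k, f k = F f k.
Proof.
move=> Fdep; pose s N := iter N F (fun _ => a0).
have stable k : forall N, (k < N)%N -> s N k = s k.+1 k.
  elim/ltn_ind: k => k IH [//|N] kN; apply: Fdep => i ik.
  by rewrite [LHS]IH ?[RHS]IH //; apply: leq_trans ik _.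
exists (fun k => s k.+1 k) => k; rewrite [LHS]/=; apply: Fdep => i ik.
exact: stable.
Qed.

Section Series.
Variable A : comNzRingType.
Implicit Types f g : fps A.

Definition fps_const (c : A) : fps A := fun k => if k == 0%N then c else 0.

Lemma fps_const_is_zmod : zmod_morphism fps_const.
Proof.
by move=> c d; apply/funext => -[|k]; rewrite fpsDE fpsNE /fps_const //= subr0.
Qed.

Lemma fps_constME c f k : (fps_const c * f) k = c * f k.
Proof.
rewrite fpsME big_ord_recl subn0 big1 ?addr0 // => i _.
by rewrite /fps_const /= mul0r.
Qed.

Lemma fps_const_is_monoid : monoid_morphism fps_const.
Proof.
split=> [|c d]; first by apply/funext => -[].
by apply/funext => k; rewrite fps_constME /fps_const; case: k => //= k; rewrite mulr0.
Qed.

HB.instance Definition _ :=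
  GRing.isZmodMorphism.Build A (fps A) fps_const fps_const_is_zmod.
HB.instance Definition _ :=
  GRing.isMonoidMorphism.Build A (fps A) fps_const fps_const_is_monoid.

Lemma fps0E k : (0 : fps A) k = 0.
Proof. by []. Qed.

Lemma fpsMnE f p k : (f *+ p) k = f k *+ p.
Proof. by elim: p => [|p IH]; rewrite ?mulr0n // !mulrS fpsDE IH. Qed.

Definition vanish N f := forall k, (k < N)%N -> f k = 0.

Lemma vanishD N f g : vanish N f -> vanish N g -> vanish N (f + g).
Proof. by move=> vf vg k kN; rewrite fpsDE vf ?vg ?addr0. Qed.

Lemma vanishN N f : vanish N f -> vanish N (- f).
Proof. by move=> vf k kN; rewrite fpsNE vf ?oppr0. Qed.

Lemma vanishM M N f g : vanish M f -> vanish N g -> vanish (M + N) (f * g).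
Proof.
move=> vf vg k kMN; rewrite fpsME big1 // => i _.
have [iM|Mi] := ltnP i M; first by rewrite vf ?mul0r.
by rewrite vg ?mulr0 //; have := ltn_ord i; lia.
Qed.

Lemma vanish_le M N f : (M <= N)%N -> vanish N f -> vanish M f.
Proof. by move=> MN vf k kM; apply: vf; apply: leq_trans MN. Qed.

Lemma vanish_all f : (forall N, vanish N f) -> f = 0.
Proof. by move=> vf; apply/funext => k; apply: (vf k.+1). Qed.

(** The coefficient of index [M + N] of a product only sees the two lowest
    coefficients of the factors. *)
Lemma lead_mul M N f g : vanish M f -> vanish N g ->
  (f * g) (M + N)%N = f M * g N.
Proof.
move=> vf vg; have MMN : (M < (M + N).+1)%N by rewrite ltnS leq_addr.
rewrite fpsME (bigD1 (Ordinal MMN)) //= addKn big1 ?addr0 // => i iM.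
have {}iM : (i : nat) != M by apply: contra_neq iM => iM; apply: val_inj.
have [/vf->|Mi] := ltnP i M; first by rewrite mul0r.
by rewrite vg ?mulr0 //; have := ltn_ord i; lia.
Qed.

Lemma vanish_lead f : f <> 0 -> exists2 N, vanish N f & f N != 0.
Proof.
move=> f0; have exf : exists N, f N != 0.
  apply/not_existsP => H; apply: f0; apply/funext => k.
  by apply/eqP/negbNE/negP; apply: H.
exists (ex_minn exf); case: ex_minnP => // N fN minN k kN.
by apply/eqP/negbNE/negP => /minN; rewrite leqNgt kN.
Qed.

Lemma fps_integral : (forall a b : A, a * b = 0 -> a = 0 \/ b = 0) ->
  forall f g, f * g = 0 -> f = 0 \/ g = 0.
Proof.
move=> dom f g fg.
have [|f0] := pselect (f = 0); first by left.
have [|g0] := pselect (g = 0); first by right.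
have [M vf fM] := vanish_lead f0; have [N vg gN] := vanish_lead g0.
have /dom[/eqP|/eqP] : f M * g N = 0 by rewrite -lead_mul // fg.
  by rewrite (negbTE fM).
by rewrite (negbTE gN).
Qed.

Definition trunc N f : {poly A} := \poly_(i < N) f i.

Lemma coef_truncM N f g k : (k < N)%N -> (trunc N f * trunc N g)`_k = (f * g) k.
Proof.
move=> kN; rewrite coefM; apply: eq_bigr => i _; rewrite !coef_poly.
have iN : (i < N)%N by apply: leq_trans kN; rewrite ltn_ord.
by rewrite iN (leq_ltn_trans (leq_subr _ _) kN).
Qed.

Definition fderiv f : fps A := fun k => f k.+1 *+ k.+1.

Lemma fderivD f g : fderiv (f + g) = fderiv f + fderiv g.
Proof. by apply/funext => k; rewrite /fderiv !fpsDE mulrnDl. Qed.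

Lemma fderivM f g : fderiv (f * g) = fderiv f * g + f * fderiv g.
Proof.
have derivE N h k : (k.+1 < N)%N -> (trunc N h)^`()`_k = fderiv h k.
  by move=> kN; rewrite coef_deriv coef_poly kN.
apply/funext => k; rewrite /fderiv -(@coef_truncM k.+2) // -coef_deriv derivM.
rewrite coefD fpsDE !fpsME; congr (_ + _); rewrite coefM; apply: eq_bigr => i _.
  have ik : (i < k.+1)%N by [].
  by rewrite derivE // coef_poly ifT //; lia.
have ik : (i < k.+1)%N by [].
by rewrite derivE ?coef_poly ?ifT //; lia.
Qed.

Lemma fderiv_vanish N f : vanish N.+1 f -> vanish N (fderiv f).
Proof. by move=> vf k kN; rewrite /fderiv vf ?mul0rn. Qed.

Lemma fderiv_const c : fderiv (fps_const c) = 0.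
Proof. by apply/funext => k; rewrite /fderiv /fps_const mul0rn. Qed.

End Series.

Section Bivariate.
Variable A : comNzRingType.
Implicit Types f g h : fps (fps A).

Definition const2 (c : A) : fps (fps A) := fps_const (fps_const c).
HB.instance Definition _ := GRing.RMorphism.copy const2 (fps_const (A := fps A) \o @fps_const A).

Lemma const2E c i j : const2 c i j = if (i == 0%N) && (j == 0%N) then c else 0.
Proof. by rewrite /const2 /fps_const; case: i. Qed.

Lemma fps2ME f g i j :
  (f * g) i j = \sum_(k < i.+1) \sum_(l < j.+1) f k l * g (i - k)%N (j - l)%N.
Proof. by rewrite fpsME fps_sumE; apply: eq_bigr => k _; rewrite fpsME. Qed.

Lemma fps2DE f g i j : (f + g) i j = f i j + g i j. Proof. by []. Qed.

Lemma fps2NE f i j : (- f) i j = - f i j. Proof. by []. Qed.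

Lemma const2ME c f i j : (const2 c * f) i j = c * f i j.
Proof. by rewrite /const2 !fps_constME. Qed.

Lemma fps2_sumE (I : Type) (r : seq I) (P : pred I) (F : I -> fps (fps A)) i j :
  (\sum_(a <- r | P a) F a) i j = \sum_(a <- r | P a) F a i j.
Proof. by rewrite !fps_sumE. Qed.

(** Weighted order at least [d], phrased with coefficients so that the zero
    series needs no special case. *)
Definition wt (n m d : nat) h := forall i j, (n * i + m * j < d)%N -> h i j = 0.

End Bivariate.

Section Weights.
Variables (A : comNzRingType) (n m : nat).
Implicit Types f g h : fps (fps A).
Local Notation wt := (wt n m).

Lemma wtD d f g : wt d f -> wt d g -> wt d (f + g).
Proof. by move=> wf wg i j ij; rewrite fps2DE wf ?wg ?addr0. Qed.

Lemma wtN d f : wt d f -> wt d (- f).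
Proof. by move=> wf i j ij; rewrite fps2NE wf ?oppr0. Qed.

Lemma wt_sum d (I : Type) (r : seq I) (P : pred I) (F : I -> fps (fps A)) :
  (forall i, P i -> wt d (F i)) -> wt d (\sum_(i <- r | P i) F i).
Proof.
move=> wF; elim/big_rec: _ => [i j //|a f Pa wf]; exact: wtD (wF _ Pa) wf.
Qed.

Lemma wtM d e f g : wt d f -> wt e g -> wt (d + e) (f * g).
Proof.
move=> wf wg i j ij; rewrite fps2ME big1 // => k _; rewrite big1 // => l _.
have [kl|kl] := ltnP (n * k + m * l) d; first by rewrite wf ?mul0r.
rewrite wg ?mulr0 //; have := ltn_ord k; have := ltn_ord l; rewrite !ltnS => lj ki.
rewrite !mulnBr; have := leq_mul (leqnn n) ki; have := leq_mul (leqnn m) lj; lia.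
Qed.

Lemma wt_le d e f : (d <= e)%N -> wt e f -> wt d f.
Proof. by move=> de wf i j ij; apply: wf; apply: leq_trans de. Qed.

Lemma wt0 f : wt 0 f. Proof. by []. Qed.

Lemma wtMr d f g : wt d g -> wt d (f * g).
Proof. by move=> /(wtM (wt0 f)). Qed.

End Weights.

(** * Substitution into double series *)

(** What is needed to substitute series without constant term: one instance is
    the order in one variable, another one the total degree in two variables. *)
Record filtration (B : comNzRingType) (I : nat -> B -> Prop) : Prop := Filtration {
  filt_all : forall a, I 0%N a;
  filt0 : forall N, I N 0;
  filtD : forall N a b, I N a -> I N b -> I N (a + b);
  filtN : forall N a, I N a -> I N (- a);
  filtM : forall M N a b, I M a -> I N b -> I (M + N)%N (a * b);
  filt_le : forall M N a, (M <= N)%N -> I N a -> I M a;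
  filt_sep : forall a, (forall N, I N a) -> a = 0 }.

Lemma vanish_filtration (A : comNzRingType) : filtration (@vanish A).
Proof.
split=> //; [exact: vanishD|exact: vanishN|exact: vanishM|exact: vanish_le|].
exact: vanish_all.
Qed.

Lemma wt_filtration (A : comNzRingType) : filtration (@wt A 1 1).
Proof.
split=> [//|//|||||a wa]; [exact: wtD|exact: wtN|exact: wtM|exact: wt_le|].
by apply/funext => i; apply/funext => j; apply: (wa (i + j).+1); lia.
Qed.

Section Subst.
Variables (K B : comNzRingType) (cst : {rmorphism K -> B}) (I : nat -> B -> Prop).
Hypothesis fI : filtration I.
Implicit Types h g : fps (fps K).

Lemma filtB N a b : I N a -> I N b -> I N (a - b).
Proof. by move=> Ia Ib; apply: (filtD fI) => //; apply: (filtN fI). Qed.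

Lemma filt_sum N (T : Type) (r : seq T) (P : pred T) (F : T -> B) :
  (forall i, P i -> I N (F i)) -> I N (\sum_(i <- r | P i) F i).
Proof.
move=> IF; elim/big_rec: _ => [|i a Pi]; first exact: (filt0 fI).
by apply: (filtD fI); apply: IF.
Qed.

Lemma filtMl N a b : I N b -> I N (a * b).
Proof. exact: (@filtM _ _ fI 0 N a b (filt_all fI a)). Qed.

Lemma filtX u i : I 1%N u -> I i (u ^+ i).
Proof.
by move=> Iu; elim: i => [|i IH]; [exact: (filt_all fI)|rewrite exprS; apply: (filtM fI Iu IH)].
Qed.

Lemma filt_monomial N u v c i j : I 1%N u -> I 1%N v -> (N <= i + j)%N ->
  I N (c * (u ^+ i * v ^+ j)).
Proof.
move=> Iu Iv Nij; apply: filtMl; apply: (filt_le fI Nij).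
exact: (filtM fI (filtX _ Iu) (filtX _ Iv)).
Qed.

Definition psum N h (u v : B) : B :=
  \sum_(i < N) \sum_(j < N) cst (h i j) * (u ^+ i * v ^+ j).

(** The partial sums of [h] at [(u, v)] converge to [c] for the filtration. *)
Definition is_subst u v h c := forall N, I N (c - psum N h u v).

Variables u v : B.
Hypotheses (Iu : I 1%N u) (Iv : I 1%N v).
Local Notation value := (is_subst u v).

Lemma is_subst_uniq h c c' : value h c -> value h c' -> c = c'.
Proof.
move=> hc hc'; apply: subr0_eq; apply: (filt_sep fI) => N.
have -> : c - c' = (c - psum N h u v) - (c' - psum N h u v) by ring.
exact: filtB.
Qed.

Lemma is_substD h g c d : value h c -> value g d -> value (h + g) (c + d).
Proof.
move=> hc gd N; rewrite (_ : psum N (h + g) u v = psum N h u v + psum N g u v).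
  by rewrite opprD addrACA; apply: (filtD fI).
rewrite /psum -big_split; apply: eq_bigr => i _; rewrite -big_split.
by apply: eq_bigr => j _; rewrite fps2DE rmorphD mulrDl.
Qed.

Lemma is_substN h c : value h c -> value (- h) (- c).
Proof.
move=> hc N; rewrite (_ : psum N (- h) u v = - psum N h u v).
  by rewrite -opprD; apply: (filtN fI).
rewrite /psum -sumrN; apply: eq_bigr => i _; rewrite -sumrN.
by apply: eq_bigr => j _; rewrite fps2NE rmorphN mulNr.
Qed.

(* Evaluation of bivariate polynomials, of which the partial sums are values. *)
Let ev : {rmorphism {poly {poly K}} -> B} := horner_eval u \o map_poly (horner_eval v \o map_poly cst).
Let trunc2 N h : {poly {poly K}} := \poly_(i < N) \poly_(j < N) h i j.

Let evE N (P : {poly {poly K}}) :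
  (size P <= N)%N -> (forall i, (size (P`_i)%R <= N)%N) ->
  ev P = \sum_(i < N) \sum_(j < N) cst P`_i`_j * (u ^+ i * v ^+ j).
Proof.
move=> sP sPi; transitivity ((map_poly (horner_eval v \o map_poly cst) P).[u]) => //.
rewrite (@horner_coef_wide _ N); last first.
  by rewrite (leq_trans (size_poly _ _)).
apply: eq_bigr => i _; rewrite coef_map /= /horner_eval (@horner_coef_wide _ N).
  rewrite mulr_suml; apply: eq_bigr => j _; rewrite coef_map /=; ring.
by rewrite (leq_trans (size_poly _ _)).
Qed.

Let coef_trunc2 N h i j : (i < N)%N -> (j < N)%N -> (trunc2 N h)`_i`_j = h i j.
Proof. by move=> iN jN; rewrite !coef_poly iN coef_poly jN. Qed.

Let size_trunc2 N h : (size (trunc2 N h) <= N)%N /\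
  (forall i, (size ((trunc2 N h)`_i)%R <= N)%N).
Proof.
split=> [|i]; first exact: size_poly.
by rewrite coef_poly; case: ifP => _; rewrite ?size_poly // size_poly0.
Qed.

Let psumE N h : psum N h u v = ev (trunc2 N h).
Proof.
have [s1 s2] := size_trunc2 N h; rewrite (evE s1 s2).
by apply: eq_bigr => i _; apply: eq_bigr => j _; rewrite coef_trunc2.
Qed.

Let ev_small N (P : {poly {poly K}}) :
  (forall i j, (i < N)%N -> (j < N)%N -> P`_i`_j = 0) -> I N (ev P).
Proof.
move=> P0; pose M := maxn (size P) (\max_(i < size P) size (P`_i)%R).
rewrite (@evE M).
- apply: filt_sum => i _; apply: filt_sum => j _.
  have [iN|Ni] := ltnP i N; last by apply: filt_monomial => //; lia.
  have [jN|Nj] := ltnP j N; last by apply: filt_monomial => //; lia.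
  by rewrite P0 // rmorph0 mul0r; apply: (filt0 fI).
- exact: leq_maxl.
move=> i; have [iP|Pi] := ltnP i (size P); last first.
  by rewrite nth_default // size_poly0.
apply: leq_trans (leq_maxr _ _).
exact: (@leq_bigmax _ (fun i : 'I_(size P) => size P`_i) (Ordinal iP)).
Qed.

Lemma psum_cauchy M N h : (M <= N)%N -> I M (psum N h u v - psum M h u v).
Proof.
move=> MN; rewrite !psumE -rmorphB; apply: ev_small => i j iM jM.
by rewrite !coefB !coef_trunc2 ?subrr //; exact: leq_trans MN.
Qed.

(** The product of two partial sums differs from the partial sum of the product
    by monomials one of whose exponents is large. *)
Lemma is_substM h g c d : value h c -> value g d -> value (h * g) (c * d).
Proof.
move=> hc gd N.
have -> : c * d - psum N (h * g) u v =
    (c - psum N h u v) * d + psum N h u v * (d - psum N g u v)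
    + ev (trunc2 N h * trunc2 N g - trunc2 N (h * g)).
  by rewrite rmorphB rmorphM -!psumE; ring.
apply: (filtD fI); last first.
  apply: ev_small => i j iN jN; rewrite coefB coefB coef_trunc2 //.
  rewrite coefM coef_sum fps2ME [X in X - _](eq_bigr
    (fun k : 'I_i.+1 => \sum_(l < j.+1) h k l * g (i - k)%N (j - l)%N)) ?subrr //.
  move=> k _; rewrite coefM; apply: eq_bigr => l _.
  rewrite !coef_trunc2 //; have := ltn_ord k; have := ltn_ord l; lia.
by apply: (filtD fI); [rewrite mulrC|]; apply: filtMl.
Qed.

Lemma is_subst_const (a : K) : value (const2 a) (cst a).
Proof.
move=> [|N]; first exact: (filt_all fI).
suff -> : psum N.+1 (const2 a) u v = cst a by rewrite subrr; apply: (filt0 fI).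
rewrite /psum !big_ord_recl [X in _ + X]big1 => [|i _]; last first.
  by rewrite big1 // => j _; rewrite const2E rmorph0 mul0r.
rewrite big1 => [|i _]; last by rewrite const2E rmorph0 mul0r.
by rewrite const2E !expr0 !mulr1 !addr0.
Qed.

End Subst.

Section SubstMore.
Variables (K B : comNzRingType) (cst : {rmorphism K -> B}) (I : nat -> B -> Prop).
Hypothesis fI : filtration I.
Variables u v : B.
Hypotheses (Iu : I 1%N u) (Iv : I 1%N v).
Implicit Types h g : fps (fps K).

(** Partial sums are mapped to partial sums; with substitution itself as the
    morphism, this is the associativity of composition. *)
Lemma is_subst_morph (B' : comNzRingType) (cst' : {rmorphism K -> B'})
    (I' : nat -> B' -> Prop) (th : B -> B') h c :
  {morph th : a b / a + b} -> {morph th : a b / a * b} -> th 1 = 1 ->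
  (forall a, th (cst a) = cst' a) -> (forall N a, I N a -> I' N (th a)) ->
  is_subst cst I u v h c -> is_subst cst' I' (th u) (th v) h (th c).
Proof.
move=> thD thM th1 thc thI hc N.
have th0 : th 0 = 0 by apply: (addIr (th 0)); rewrite -thD !add0r.
have thX a i : th (a ^+ i) = th a ^+ i.
  by elim: i => [|i IH]; rewrite ?expr0 // !exprS thM IH.
have thS (F : 'I_N -> B) : th (\sum_(i < N) F i) = \sum_(i < N) th (F i).
  exact: (big_morph th thD th0).
have <- : th (psum cst N h u v) = psum cst' N h (th u) (th v).
  rewrite thS; apply: eq_bigr => i _; rewrite thS; apply: eq_bigr => j _.
  by rewrite !thM thc !thX.
suff <- : th (c - psum cst N h u v) = th c - th (psum cst N h u v) by apply: thI.
by apply: (addIr (th (psum cst N h u v))); rewrite -thD !subrK.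
Qed.

(** The chain rule holds termwise on partial sums, and a derivation lowers the
    filtration by one only. *)
Lemma is_subst_deriv (d : B -> B) h c c1 c2 :
  {morph d : a b / a + b} -> (forall a b, d (a * b) = d a * b + a * d b) ->
  (forall a, d (cst a) = 0) -> (forall N a, I N.+1 a -> I N (d a)) ->
  is_subst cst I u v h c ->
  is_subst cst I u v (fun i j => h i.+1 j *+ i.+1) c1 ->
  is_subst cst I u v (fun i j => h i j.+1 *+ j.+1) c2 ->
  d c = c1 * d u + c2 * d v.
Proof.
move=> dD dM dc dI hc hc1 hc2; apply: subr0_eq; apply: (filt_sep fI) => N.
have d0 : d 0 = 0 by apply: (addIr (d 0)); rewrite -dD !add0r.
have dX a i : d (a ^+ i.+1) = (a ^+ i * d a) *+ i.+1.
  elim: i => [|i IH]; first by rewrite mulr1n mul1r.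
  by rewrite exprS dM IH mulrnAr mulrA -exprS mulrC -mulrS mulrC.
have dS M (F : 'I_M -> B) : d (\sum_(i < M) F i) = \sum_(i < M) d (F i).
  exact: (big_morph d dD d0).
pose hx : fps (fps K) := fun i j => h i.+1 j *+ i.+1.
pose hy : fps (fps K) := fun i j => h i j.+1 *+ j.+1.
have dB a b : d (a - b) = d a - d b.
  by apply: (addIr (d b)); rewrite -dD !subrK.
have -> : d c - (c1 * d u + c2 * d v) = d (c - psum cst N.+1 h u v)
   - ((c1 - psum cst N hx u v) * d u + (c2 - psum cst N hy u v) * d v)
   + (d (psum cst N.+1 h u v)
      - (psum cst N hx u v * d u + psum cst N hy u v * d v)).
  by rewrite dB; ring.
apply: (filtD fI).
  apply: (filtB fI); first exact: dI.
  by apply: (filtD fI); rewrite mulrC; apply: (filtMl fI).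
have -> : d (psum cst N.+1 h u v) =
  \sum_(i < N.+1) \sum_(j < N.+1) cst (h i j) * (d (u ^+ i) * v ^+ j)
  + \sum_(i < N.+1) \sum_(j < N.+1) cst (h i j) * (u ^+ i * d (v ^+ j)).
  rewrite /psum dS -big_split; apply: eq_bigr => i _; rewrite dS -big_split.
  by apply: eq_bigr => j _; rewrite dM dM dc mul0r add0r mulrDr.
have d1 : d 1 = 0 by rewrite -(rmorph1 cst) dc.
rewrite opprD addrACA; apply: (filtD fI).
  rewrite big_ord_recl big1 => [|j _]; last by rewrite expr0 d1 mul0r mulr0.
  rewrite add0r /psum mulr_suml -sumrB; apply: (filt_sum fI) => i _.
  rewrite big_ord_recr mulr_suml /= addrAC -sumrB; apply: (filtD fI).
    apply: (filt_sum fI) => j _; rewrite -[bump 0 i]/(i.+1) dX /hx rmorphMn /=.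
    set e := (_ - _); suff -> : e = 0 by apply: (filt0 fI).
    by rewrite /e; ring.
  by do 2!apply: (filtMl fI); apply: (filtX fI).
rewrite big_ord_recr /= /psum mulr_suml addrAC -sumrB; apply: (filtD fI).
  apply: (filt_sum fI) => i _; rewrite big_ord_recl expr0 d1 !mulr0 add0r.
  rewrite mulr_suml -sumrB; apply: (filt_sum fI) => j _; rewrite lift0 dX /hy rmorphMn /=.
  set e := (_ - _); suff -> : e = 0 by apply: (filt0 fI).
  by rewrite /e; ring.
apply: (filt_sum fI) => j _; rewrite mulrCA mulrC; apply: (filtMl fI).
exact: (filtX fI).
Qed.

Lemma is_subst_x :
  is_subst cst I u v (fun i j => ((i == 1%N) && (j == 0%N))%:R) u.
Proof.
move=> [|[|N]]; first exact: (filt_all fI).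
  by rewrite /psum !big_ord1 rmorph0 mul0r subr0.
suff -> : psum cst N.+2 (fun i j => ((i == 1%N) && (j == 0%N))%:R) u v = u.
  by rewrite subrr; apply: (filt0 fI).
rewrite /psum 2!big_ord_recl [X in _ + (_ + X)]big1 => [|i _]; last first.
  by rewrite big1 // => j _; rewrite rmorph0 mul0r.
rewrite big1 => [|j _]; last by rewrite rmorph0 mul0r.
rewrite big_ord_recl big1 => [|j _]; last by rewrite rmorph0 mul0r.
by rewrite /= rmorph1 mul1r expr1 expr0 mulr1 add0r !addr0.
Qed.

Lemma is_subst_y :
  is_subst cst I u v (fun i j => ((i == 0%N) && (j == 1%N))%:R) v.
Proof.
move=> [|[|N]]; first exact: (filt_all fI).
  by rewrite /psum !big_ord1 rmorph0 mul0r subr0.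
suff -> : psum cst N.+2 (fun i j => ((i == 0%N) && (j == 1%N))%:R) u v = v.
  by rewrite subrr; apply: (filt0 fI).
rewrite /psum big_ord_recl [X in _ + X]big1 => [|i _]; last first.
  by rewrite big1 // => j _; rewrite rmorph0 mul0r.
rewrite 2!big_ord_recl [X in _ + (_ + X)]big1 => [|j _]; last by rewrite rmorph0 mul0r.
by rewrite /= rmorph0 mul0r rmorph1 mul1r expr1 expr0 mul1r add0r !addr0.
Qed.

End SubstMore.

(** * Convergence *)

Section Cnorm.
Variable R : realType.
Implicit Types z w : R[i].

Definition cnorm z : R := complex.Re `|z|.

Lemma cnormE z : (cnorm z)%:C = `|z|.
Proof. by rewrite /cnorm RRe_real ?normr_real. Qed.

Lemma cnorm_ge0 z : 0 <= cnorm z.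
Proof. by rewrite -ler0c cnormE. Qed.

Lemma cnorm0 : cnorm 0 = 0.
Proof. by apply: complexI; rewrite cnormE normr0. Qed.

Lemma cnorm1 : cnorm 1 = 1.
Proof. by apply: complexI; rewrite cnormE normr1. Qed.

Lemma cnormM z w : cnorm (z * w) = cnorm z * cnorm w.
Proof. by apply: complexI; rewrite rmorphM /= !cnormE normrM. Qed.

Lemma cnormN z : cnorm (- z) = cnorm z.
Proof. by apply: complexI; rewrite !cnormE normrN. Qed.

Lemma cnormD z w : cnorm (z + w) <= cnorm z + cnorm w.
Proof. by rewrite -lecR rmorphD /= !cnormE ler_normD. Qed.

Lemma cnorm_sum (I : Type) (r : seq I) (P : pred I) (F : I -> R[i]) :
  cnorm (\sum_(i <- r | P i) F i) <= \sum_(i <- r | P i) cnorm (F i).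
Proof.
elim/big_rec2: _ => [|i a b _ ab]; first by rewrite cnorm0.
by apply: le_trans (cnormD _ _) _; rewrite lerD2l.
Qed.

Lemma cnormMn z p : cnorm (z *+ p) = cnorm z *+ p.
Proof. by apply: complexI; rewrite rmorphMn /= !cnormE normrMn. Qed.

End Cnorm.

Record seminorm (R : realType) (A : comNzRingType) (p : A -> R) : Prop := Seminorm {
  semi_ge0 : forall a, 0 <= p a;
  semi0 : p 0 = 0;
  semi1 : p 1 <= 1;
  semiD : forall a b, p (a + b) <= p a + p b;
  semiM : forall a b, p (a * b) <= p a * p b }.

Section Seminorm.
Variables (R : realType) (A : comNzRingType) (p : A -> R).
Hypothesis sp : seminorm p.

Lemma semi_sum (I : Type) (r : seq I) (P : pred I) (F : I -> A) :
  p (\sum_(i <- r | P i) F i) <= \sum_(i <- r | P i) p (F i).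
Proof.
elim/big_rec2: _ => [|i a b _ ab]; first by rewrite (semi0 sp).
by apply: le_trans (semiD sp _ _) _; rewrite lerD2l.
Qed.

Lemma semiX_le a rho i : p a <= rho -> p (a ^+ i) <= rho ^+ i.
Proof.
move=> arho; elim: i => [|i IH]; first by rewrite !expr0 (semi1 sp).
by rewrite !exprS (le_trans (semiM sp _ _)) // ler_pM ?(semi_ge0 sp).
Qed.

(** Truncating a weighted l^1 norm keeps it submultiplicative, so no infinite
    sum is needed to control products and substitutions. *)
Definition fnorm (r : R) N (f : fps A) : R := \sum_(k < N) p (f k) * r ^+ k.

Lemma cauchy_le (a b : nat -> R) N :
  (forall k, 0 <= a k) -> (forall k, 0 <= b k) ->
  \sum_(k < N) \sum_(i < k.+1) a i * b (k - i)%N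
    <= (\sum_(i < N) a i) * (\sum_(j < N) b j).
Proof.
move=> a0 b0.
have coefE (c : nat -> R) k : (k < N)%N -> (\poly_(i < N) c i)`_k = c k.
  by move=> kN; rewrite coef_poly kN.
have -> : (\sum_(i < N) a i) * (\sum_(j < N) b j)
    = \sum_(i < N) \sum_(j < N) a i * b j.
  by rewrite mulr_suml; apply: eq_bigr => i _; rewrite mulr_sumr.
have -> : \sum_(k < N) \sum_(i < k.+1) a i * b (k - i)%N
    = \sum_(i < N) \sum_(k < N | (i <= k)%N) a i * b (k - i)%N.
  under eq_bigr => k _ do
    rewrite (big_ord_widen N (fun i => a i * b (k - i)%N)) ?ltn_ord //.
  by rewrite (exchange_big_dep xpredT).
apply: ler_sum => i _.
rewrite -(big_geq_mkord i N xpredT (fun k => a i * b (k - i)%N)).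
rewrite -{1}[i : nat]add0n big_addn.
under eq_bigr => k _ do rewrite addnK.
rewrite -(big_mkord xpredT (fun j => a i * b j)).
rewrite [leRHS](@big_cat_nat _ _ _ (N - i)) ?leq_subr //=.
by rewrite lerDl sumr_ge0 // => j _; rewrite mulr_ge0.
Qed.

Lemma fnorm_seminorm r N : 0 <= r -> seminorm (fnorm r N).
Proof.
move=> r0; have rX k : 0 <= r ^+ k by rewrite exprn_ge0.
have pr a k : 0 <= p a * r ^+ k by rewrite mulr_ge0 ?(semi_ge0 sp).
split.
- by move=> f; apply: sumr_ge0.
- by rewrite /fnorm big1 // => k _; rewrite fps0E (semi0 sp) mul0r.
- case: N => [|N]; first by rewrite /fnorm big_ord0.
  rewrite /fnorm big_ord_recl big1 => [|k _]; last by rewrite fps1E (semi0 sp) mul0r.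
  by rewrite fps1E expr0 mulr1 addr0 (semi1 sp).
- move=> f g; rewrite /fnorm -big_split; apply: ler_sum => k _ /=.
  by rewrite -mulrDl ler_wpM2r // fpsDE (semiD sp).
move=> f g; rewrite /fnorm.
apply: le_trans (cauchy_le N (fun k => pr (f k) k) (fun k => pr (g k) k)).
apply: ler_sum => k _; rewrite fpsME.
apply: le_trans (ler_wpM2r (rX k) (semi_sum _ _ _)) _.
rewrite mulr_suml; apply: ler_sum => i _.
rewrite mulrACA -exprD subnKC; last by rewrite -ltnS.
by rewrite ler_wpM2r // (semiM sp).
Qed.

End Seminorm.

Section Bounds.
Variable R : realType.
Implicit Types (h u v : fps2 R) (a : fps1 R) (M S r : R).

Lemma cnorm_seminorm : seminorm (@cnorm R).
Proof.
split; [exact: cnorm_ge0|exact: cnorm0|by rewrite cnorm1|exact: cnormD|].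
by move=> z w; rewrite cnormM.
Qed.

Definition l1norm r N h : R := fnorm (fnorm (@cnorm R) r N) r N h.

Lemma l1norm_seminorm r N : 0 <= r -> seminorm (l1norm r N).
Proof. by move=> r0; do 2!apply: fnorm_seminorm => //; exact: cnorm_seminorm. Qed.

Lemma l1normE r N h :
  l1norm r N h = \sum_(i < N) \sum_(j < N) cnorm (h i j) * r ^+ (i + j).
Proof.
apply: eq_bigr => i _; rewrite mulr_suml; apply: eq_bigr => j _.
by rewrite -mulrA -exprD addnC.
Qed.

Lemma geometric_le2 (x : R) N : 0 <= x <= 2^-1 -> \sum_(i < N) x ^+ i <= 2.
Proof.
move=> /andP[x0 x1]; have := subrX1 x N => e.
have xN : 0 <= x ^+ N by rewrite exprn_ge0.
have s0 : 0 <= \sum_(i < N) x ^+ i by apply: sumr_ge0 => i _; rewrite exprn_ge0.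
nra.
Qed.

Definition expbound M S h := forall i j, cnorm (h i j) <= M * S ^+ (i + j).

Lemma expbound_le M M' S S' h : 0 <= M -> 0 <= S -> M <= M' -> S <= S' ->
  expbound M S h -> expbound M' S' h.
Proof.
move=> M0 S0 MM' SS' bh i j; apply: le_trans (bh i j) _.
by apply: ler_pM => //; rewrite ?exprn_ge0 // lerXn2r // nnegrE // (le_trans S0).
Qed.

Lemma expbound_sum M S h r N : 0 <= M -> 0 <= r -> 0 <= S -> S * r <= 2^-1 ->
  expbound M S h -> l1norm r N h <= M * 4.
Proof.
move=> M0 r0 S0 Sr bh; rewrite l1normE.
have Sr0 : 0 <= S * r by rewrite mulr_ge0.
have geo : \sum_(i < N) (S * r) ^+ i <= 2 by apply: geometric_le2; rewrite Sr0.
have geo0 : 0 <= \sum_(i < N) (S * r) ^+ i.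
  by apply: sumr_ge0 => i _; rewrite exprn_ge0.
apply: (@le_trans _ _ (M * ((\sum_(i < N) (S * r) ^+ i) * \sum_(i < N) (S * r) ^+ i))).
  rewrite mulr_suml mulr_sumr; apply: ler_sum => i _.
  rewrite mulr_sumr mulr_sumr; apply: ler_sum => j _.
  by rewrite -exprD exprMn mulrA ler_wpM2r ?exprn_ge0.
by rewrite ler_wpM2l //; nra.
Qed.

(** Cauchy's estimates: such a bound costs only a smaller polydisc, and it is
    easier to check by recursion on the coefficients. *)
Lemma conv2P h : reflect (exists M S, [/\ 0 <= M, 1 <= S & expbound M S h])
  (h \in @conv2 R).
Proof.
apply: (iffP (asboolP _)) => [[r r0 [M bM]]|[M [S [M0 S1 bh]]]].
  exists (Num.max 0 M), (Num.max 1 r^-1); split; rewrite ?le_max ?lexx // => i j.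
  apply: (@le_trans _ _ (Num.max 0 M * r^-1 ^+ (i + j))); last first.
    have ri : 0 <= r^-1 by rewrite invr_ge0 ltW.
    have rm : r^-1 <= Num.max 1 r^-1 by rewrite le_max lexx orbT.
    by rewrite ler_wpM2l ?le_max ?lexx // lerXn2r // nnegrE (le_trans ri).
  rewrite [_ ^+ (i + j)]exprVn ler_pdivlMr ?exprn_gt0 // le_max; apply/orP; right.
  have iN : (i < (i + j).+1)%N by lia.
  have jN : (j < (i + j).+1)%N by lia.
  rewrite -lecR; apply: le_trans (bM (i + j).+1).
  have term k l : 0 <= `|h k l| * r%:C ^+ (k + l).
    by rewrite mulr_ge0 // exprn_ge0 // ler0c ltW.
  rewrite (bigD1 (Ordinal iN)) //= (bigD1 (Ordinal jN)) //=.
  rewrite rmorphM rmorphXn /= cnormE -addrA lerDl addr_ge0 //.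
    by apply: sumr_ge0.
  by apply: sumr_ge0 => k _; apply: sumr_ge0.
have S0 : 0 < S by apply: lt_le_trans S1.
exists (S^-1 / 2); first by rewrite divr_gt0 ?invr_gt0.
exists (M * 4) => N.
have r0 : 0 <= S^-1 / 2 by rewrite divr_ge0 // invr_ge0 ltW.
have Sr : S * (S^-1 / 2) <= 2^-1 by rewrite mulrA divff ?gt_eqF // mul1r.
have := expbound_sum N M0 r0 (ltW S0) Sr bh; rewrite l1normE -lecR.
apply: le_trans.
rewrite rmorph_sum; apply: ler_sum => i _; rewrite rmorph_sum; apply: ler_sum => j _.
by rewrite -cnormE -rmorphXn -rmorphM.
Qed.

(** Without a constant term the norm tends to 0 with the radius. *)
Lemma conv2_small u (rho : R) : u \in @conv2 R -> u 0%N 0%N = 0 -> 0 < rho ->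
  exists2 r, 0 < r & forall r', 0 <= r' <= r -> forall N, l1norm r' N u <= rho.
Proof.
move=> /conv2P[M [S [M0 S1 bu]]] u0 rho0.
have S0 : 0 < S by apply: lt_le_trans S1.
pose delta := rho / (4 * M + rho).
have den0 : 0 < 4 * M + rho by lra.
have delta0 : 0 < delta by rewrite divr_gt0.
have delta1 : delta <= 1 by rewrite ler_pdivrMr // mul1r; lra.
exists (delta * (S^-1 / 2)) => [|r' /andP[r'0 r'r] N].
  by rewrite mulr_gt0 // divr_gt0 ?invr_gt0.
(* Lowering the radius by delta gains a factor delta on every term. *)
have bu' : expbound (delta * M) (S / delta) u.
  move=> i j; case: (posnP (i + j)) => [/eqP|ij].
    rewrite addn_eq0 => /andP[/eqP-> /eqP->].
    by rewrite u0 cnorm0 expr0 mulr1 mulr_ge0 // ltW.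
  apply: le_trans (bu i j) _.
  have dk : delta ^+ (i + j) <= delta.
    by rewrite -(prednK ij) exprS ler_piMr ?(ltW delta0) // exprn_ile1 // ltW.
  rewrite expr_div_n.
  have -> : delta * M * (S ^+ (i + j) / delta ^+ (i + j))
      = M * (S ^+ (i + j) * delta / delta ^+ (i + j)) by ring.
  rewrite ler_wpM2l // ler_pdivlMr ?exprn_gt0 //.
  by rewrite ler_wpM2l ?exprn_ge0 ?(ltW S0).
have dM : 0 <= delta * M by rewrite mulr_ge0 // ltW.
apply: (@le_trans _ _ (delta * M * 4)).
  apply: (@expbound_sum _ (S / delta)) => //; first by rewrite divr_ge0 ?ltW.
  apply: (@le_trans _ _ (S / delta * (delta * (S^-1 / 2)))).
    by rewrite ler_wpM2l // divr_ge0 ?ltW.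
  have -> : S / delta * (delta * (S^-1 / 2)) = 2^-1 by field; rewrite !gt_eqF.
  by [].
rewrite /delta -mulrA mulrAC ler_pdivrMr // ler_wpM2l ?(ltW rho0) //; lra.
Qed.

End Bounds.

(** * Composition of convergent series *)

Section Composition.
Variable R : realType.
Implicit Types (h g u v : fps2 R) (a b : fps1 R).

Local Notation value1 := (is_subst (@fps_const R[i]) (@vanish R[i])).
Local Notation value2 := (is_subst (@const2 R[i]) (@wt R[i] 1 1)).

Lemma vanish1 a : a 0%N = 0 -> vanish 1 a.
Proof. by move=> a0 [|k]. Qed.

Lemma wt1 u : u 0%N 0%N = 0 -> wt 1 1 1 u.
Proof. by move=> u0 [|i] [|j] //; lia. Qed.

(** Monomials of larger degree do not reach a given coefficient, so the truncated
    sums that define the composites are coefficients of partial sums. *)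
Lemma comp21P h a b : a 0%N = 0 -> b 0%N = 0 -> value1 a b h (comp21 h a b).
Proof.
move=> /vanish1 a0 /vanish1 b0 N k kN.
have := psum_cauchy (@fps_const R[i]) (@vanish_filtration _) a0 b0 h kN.
move=> /(_ k (ltnSn k)); rewrite !fpsDE !fpsNE => /subr0_eq ->.
apply/eqP; rewrite subr_eq0; apply/eqP; rewrite /psum fps_sumE.
apply: eq_bigr => i _; rewrite fps_sumE; apply: eq_bigr => j _.
by rewrite fps_constME.
Qed.

Lemma comp22P h u v : u 0%N 0%N = 0 -> v 0%N 0%N = 0 -> value2 u v h (comp22 h u v).
Proof.
move=> /wt1 u0 /wt1 v0 N k l kN; have kN' : (k + l < N)%N by lia.
have := psum_cauchy (@const2 R[i]) (@wt_filtration _) u0 v0 h kN'.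
have kl : (1 * k + 1 * l < (k + l).+1)%N by lia.
move=> /(_ k l kl); rewrite !fps2DE !fps2NE => /subr0_eq ->.
apply/eqP; rewrite subr_eq0; apply/eqP; rewrite /psum fps2_sumE.
apply: eq_bigr => i _; rewrite fps2_sumE; apply: eq_bigr => j _.
by rewrite const2ME.
Qed.

Section RingMorphism1.
Variables a b : fps1 R.
Hypotheses (a0 : a 0%N = 0) (b0 : b 0%N = 0).

Let uniq1 h c : value1 a b h c -> comp21 h a b = c.
Proof.
exact: (is_subst_uniq (@vanish_filtration _) (comp21P h a0 b0)).
Qed.

Lemma comp21D h g : comp21 (h + g) a b = comp21 h a b + comp21 g a b.
Proof. by apply: uniq1; apply: (is_substD (@vanish_filtration _)); apply: comp21P. Qed.

Lemma comp21N h : comp21 (- h) a b = - comp21 h a b.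
Proof. by apply: uniq1; apply: (is_substN (@vanish_filtration _)); apply: comp21P. Qed.

Lemma comp21M h g : comp21 (h * g) a b = comp21 h a b * comp21 g a b.
Proof.
apply: uniq1; apply: (is_substM (@vanish_filtration _)); try exact: vanish1.
  exact: comp21P.
exact: comp21P.
Qed.

Lemma comp21_const c : comp21 (const2 c) a b = fps_const c.
Proof. by apply: uniq1; apply: (is_subst_const _ (@vanish_filtration _)). Qed.

End RingMorphism1.

Section RingMorphism2.
Variables u v : fps2 R.
Hypotheses (u0 : u 0%N 0%N = 0) (v0 : v 0%N 0%N = 0).

Let uniq2 h c : value2 u v h c -> comp22 h u v = c.
Proof.
exact: (is_subst_uniq (@wt_filtration _) (comp22P h u0 v0)).
Qed.

Lemma comp22D h g : comp22 (h + g) u v = comp22 h u v + comp22 g u v.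
Proof. by apply: uniq2; apply: (is_substD (@wt_filtration _)); apply: comp22P. Qed.

Lemma comp22M h g : comp22 (h * g) u v = comp22 h u v * comp22 g u v.
Proof.
apply: uniq2; apply: (is_substM (@wt_filtration _)); try exact: wt1.
  exact: comp22P.
exact: comp22P.
Qed.

Lemma comp22_const c : comp22 (const2 c) u v = const2 c.
Proof. by apply: uniq2; apply: (is_subst_const _ (@wt_filtration _)). Qed.

Lemma comp22_0 h : h 0%N 0%N = 0 -> comp22 h u v 0%N 0%N = 0.
Proof. by move=> h0; rewrite /comp22 !big_ord1 h0 mul0r. Qed.

Lemma comp22_1 : comp22 1 u v = 1.
Proof. by have := comp22_const 1; rewrite rmorph1. Qed.

Lemma comp22_wt N h : wt 1 1 N h -> wt 1 1 N (comp22 h u v).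
Proof.
move=> wh k l kl; rewrite /comp22 big1 // => i _; rewrite big1 // => j _.
have [ij|ij] := ltnP (i + j) N; first by rewrite wh ?mul0r //; lia.
have f2 := @wt_filtration R[i].
rewrite [X in _ * X](_ : _ = 0) ?mulr0 //.
have : wt 1 1 (i + j) (1 * (u ^+ i * v ^+ j)).
  by apply: (filt_monomial f2) => //; apply: wt1.
by rewrite mul1r => /(_ k l); apply; lia.
Qed.

Lemma comp22_comp22 h g g' : g 0%N 0%N = 0 -> g' 0%N 0%N = 0 ->
  comp22 (comp22 h g g') u v = comp22 h (comp22 g u v) (comp22 g' u v).
Proof.
move=> g0 g'0; have f2 := @wt_filtration R[i].
have H : value2 (comp22 g u v) (comp22 g' u v) h (comp22 (comp22 h g g') u v).
  apply: (is_subst_morph comp22D comp22M comp22_1 comp22_const comp22_wt).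
  exact: comp22P.
apply: esym; apply: (is_subst_uniq f2 _ H).
by apply: comp22P; apply: comp22_0.
Qed.

End RingMorphism2.

Lemma comp21_vanish a b N h : a 0%N = 0 -> b 0%N = 0 ->
  wt 1 1 N h -> vanish N (comp21 h a b).
Proof.
move=> a0 b0 wh k kN; rewrite /comp21 big1 // => i _; rewrite big1 // => j _.
have [ij|ij] := ltnP (i + j) N; first by rewrite wh ?mul0r //; lia.
rewrite [X in _ * X](_ : _ = 0) ?mulr0 //.
have : vanish (i + j) (1 * (a ^+ i * b ^+ j)).
  by apply: (filt_monomial (@vanish_filtration _)) => //; apply: vanish1.
by rewrite mul1r => /(_ k); apply; lia.
Qed.

Lemma comp21_0 a b h : h 0%N 0%N = 0 -> comp21 h a b 0%N = 0.
Proof. by move=> h0; rewrite /comp21 !big_ord1 h0 mul0r. Qed.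

Lemma comp21_1 a b : a 0%N = 0 -> b 0%N = 0 -> comp21 1 a b = 1.
Proof. by move=> a0 b0; have := comp21_const a0 b0 1; rewrite !rmorph1. Qed.

Lemma comp21_comp22 h g g' a b : a 0%N = 0 -> b 0%N = 0 ->
  g 0%N 0%N = 0 -> g' 0%N 0%N = 0 ->
  comp21 (comp22 h g g') a b = comp21 h (comp21 g a b) (comp21 g' a b).
Proof.
move=> a0 b0 g0 g'0; have f1 := @vanish_filtration R[i].
have H : value1 (comp21 g a b) (comp21 g' a b) h (comp21 (comp22 h g g') a b).
  apply: (is_subst_morph (comp21D a0 b0) (comp21M a0 b0) (comp21_1 a0 b0)
    (comp21_const a0 b0) _ (comp22P h g0 g'0)) => N f.
  exact: comp21_vanish.
apply: esym; apply: (is_subst_uniq f1 _ H).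
by apply: comp21P; apply: comp21_0.
Qed.

Lemma ser_xME h i j : (ser_x R * h) i j = if i is i'.+1 then h i' j else 0.
Proof.
rewrite fps2ME; case: i => [|i].
  by rewrite big_ord1 big1 // => l _; rewrite mul0r.
rewrite 2!big_ord_recl /= [X in X + _]big1 => [|l _]; last by rewrite mul0r.
rewrite big_ord_recl big1 => [|l _]; last by rewrite /ser_x /= mul0r.
rewrite big1 => [|k _]; last by rewrite big1 // => l _; rewrite /ser_x /= mul0r.
by rewrite /ser_x /= mul1r addr0 add0r addr0 subn0 subSS subn0.
Qed.

Lemma ser_yME h i j : (ser_y R * h) i j = if j is j'.+1 then h i j' else 0.
Proof.
rewrite fps2ME big_ord_recl [X in _ + X]big1 => [|k _]; last first.
  by rewrite big1 // => l _; rewrite mul0r.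
rewrite addr0 subn0; case: j => [|j]; first by rewrite big_ord1 mul0r.
rewrite 2!big_ord_recl big1 => [|l _]; last by rewrite /ser_y /= mul0r.
by rewrite /ser_y /= mul0r mul1r add0r addr0 subSS subn0.
Qed.

Lemma ser_xyE i j k l :
  (ser_x R ^+ i * ser_y R ^+ j) k l = ((k == i) && (l == j))%:R.
Proof.
elim: i k => [|i IH] k; last first.
  by rewrite exprS -mulrA ser_xME; case: k => [|k]; rewrite ?IH.
rewrite expr0 mul1r; elim: j l => [|j IH] l; last first.
  by rewrite exprS ser_yME; case: l => [|l]; rewrite ?andbF ?IH.
have -> : ser_y R ^+ 0 = const2 1 by rewrite rmorph1.
by rewrite const2E; case: andb.
Qed.

Lemma comp22_xy h : comp22 h (ser_x R) (ser_y R) = h.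
Proof.
have f2 := @wt_filtration R[i].
have x0 : ser_x R 0%N 0%N = 0 by [].
have y0 : ser_y R 0%N 0%N = 0 by [].
apply: (is_subst_uniq f2 (comp22P h x0 y0)) => N k l kl.
have kN : (k < N)%N by lia.
have lN : (l < N)%N by lia.
rewrite fps2DE fps2NE /psum fps2_sumE (bigD1 (Ordinal kN)) //= fps2_sumE.
rewrite (bigD1 (Ordinal lN)) //= const2ME ser_xyE !eqxx mulr1.
rewrite big1 => [|j jl]; last first.
  rewrite const2ME ser_xyE eqxx /=; case: eqP => [lj|]; rewrite ?mulr0 //.
  by case/eqP: jl; apply: val_inj.
rewrite big1 => [|i ik]; last first.
  rewrite fps2_sumE big1 // => j _; rewrite const2ME ser_xyE.
  case: eqP => [ki|]; rewrite ?mulr0 //.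
  by case/eqP: ik; apply: val_inj.
by rewrite !addr0 subrr.
Qed.

Lemma comp22_x u v : u 0%N 0%N = 0 -> v 0%N 0%N = 0 -> comp22 (ser_x R) u v = u.
Proof.
move=> u0 v0; apply: (is_subst_uniq (@wt_filtration _) (comp22P _ u0 v0)).
by apply: (is_subst_x _ (@wt_filtration _)); apply: wt1.
Qed.

Lemma comp21_x a b : a 0%N = 0 -> b 0%N = 0 -> comp21 (ser_x R) a b = a.
Proof.
move=> a0 b0; apply: (is_subst_uniq (@vanish_filtration _) (comp21P _ a0 b0)).
by apply: (is_subst_x _ (@vanish_filtration _)); apply: vanish1.
Qed.

Lemma comp21_y a b : a 0%N = 0 -> b 0%N = 0 -> comp21 (ser_y R) a b = b.
Proof.
move=> a0 b0; apply: (is_subst_uniq (@vanish_filtration _) (comp21P _ a0 b0)).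
by apply: (is_subst_y _ (@vanish_filtration _)); apply: vanish1.
Qed.

(** ** The chain rules *)

Lemma ddyE h i : ddy h i = fderiv (h i).
Proof. by []. Qed.

Lemma ddxE h : ddx h = fderiv h.
Proof. by apply/funext => i; apply/funext => j; rewrite /fderiv fpsMnE. Qed.

Lemma ddxD h g : ddx (h + g) = ddx h + ddx g.
Proof. by rewrite !ddxE fderivD. Qed.

Lemma ddxM h g : ddx (h * g) = ddx h * g + h * ddx g.
Proof. by rewrite !ddxE fderivM. Qed.

Lemma ddx_const (c : R[i]) : @ddx R (const2 c) = 0.
Proof. by rewrite ddxE fderiv_const. Qed.

Lemma ddyD h g : ddy (h + g) = ddy h + ddy g.
Proof. by apply/funext => i; rewrite fpsDE !ddyE fderivD. Qed.

Lemma ddyM h g : ddy (h * g) = ddy h * g + h * ddy g.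
Proof.
have ddy_sum (N : nat) (F : 'I_N -> fps1 R) :
    fderiv (\sum_(i < N) F i) = \sum_(i < N) fderiv (F i).
  apply: (big_morph _ (@fderivD _)); apply/funext => k.
  by rewrite /fderiv mul0rn.
apply/funext => i; rewrite ddyE !fpsDE !fpsME ddy_sum -big_split.
by apply: eq_bigr => k _; rewrite fderivM.
Qed.

Lemma ddy_const (c : R[i]) : @ddy R (const2 c) = 0.
Proof.
apply/funext => i; rewrite ddyE /const2 /fps_const; case: i => [|i] /=.
  by apply/funext => j; rewrite /fderiv mul0rn.
by apply/funext => j; rewrite /fderiv mul0rn.
Qed.

Lemma ddx_wt N h : wt 1 1 N.+1 h -> wt 1 1 N (ddx h).
Proof. by move=> wh i j ij; rewrite /ddx wh ?mul0rn //; lia. Qed.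

Lemma ddy_wt N h : wt 1 1 N.+1 h -> wt 1 1 N (ddy h).
Proof. by move=> wh i j ij; rewrite /ddy wh ?mul0rn //; lia. Qed.

Lemma ddx_comp22 h u v : u 0%N 0%N = 0 -> v 0%N 0%N = 0 ->
  ddx (comp22 h u v) = comp22 (ddx h) u v * ddx u + comp22 (ddy h) u v * ddx v.
Proof.
move=> u0 v0; apply: (is_subst_deriv (@wt_filtration _) (wt1 u0) (wt1 v0)
  ddxD ddxM ddx_const ddx_wt (comp22P h u0 v0)); exact: comp22P.
Qed.

Lemma ddy_comp22 h u v : u 0%N 0%N = 0 -> v 0%N 0%N = 0 ->
  ddy (comp22 h u v) = comp22 (ddx h) u v * ddy u + comp22 (ddy h) u v * ddy v.
Proof.
move=> u0 v0; apply: (is_subst_deriv (@wt_filtration _) (wt1 u0) (wt1 v0)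
  ddyD ddyM ddy_const ddy_wt (comp22P h u0 v0)); exact: comp22P.
Qed.

Lemma ddt_comp21 h a b : a 0%N = 0 -> b 0%N = 0 ->
  ddt (comp21 h a b) = comp21 (ddx h) a b * ddt a + comp21 (ddy h) a b * ddt b.
Proof.
move=> a0 b0; apply: (is_subst_deriv (@vanish_filtration _) (vanish1 a0)
  (vanish1 b0) (@fderivD _) (@fderivM _) (@fderiv_const _) (@fderiv_vanish _)
  (comp21P h a0 b0)); exact: comp21P.
Qed.

(** ** Convergence of composites, derivatives and inverses *)

(** On a small polydisc the norms of [u] and [v] are below the radius of
    convergence of [h]. *)
Lemma conv2_comp22 h u v : h \in @conv2 R -> u \in @conv2 R -> v \in @conv2 R ->
  u 0%N 0%N = 0 -> v 0%N 0%N = 0 -> comp22 h u v \in @conv2 R.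
Proof.
move=> /conv2P[M [S [M0 S1 bh]]] cu cv u0 v0.
have S0 : 0 < S by apply: lt_le_trans S1.
have rho0 : 0 < S^-1 / 2 by rewrite divr_gt0 ?invr_gt0.
have [ru ru0 ur] := conv2_small cu u0 rho0.
have [rv rv0 vr] := conv2_small cv v0 rho0.
pose r := Num.min ru rv.
have r0 : 0 < r by rewrite lt_min ru0.
have {}ur N : l1norm r N u <= S^-1 / 2 by apply: ur; rewrite (ltW r0) ge_min lexx.
have {}vr N : l1norm r N v <= S^-1 / 2.
  by apply: vr; rewrite (ltW r0) ge_min lexx orbT.
apply/conv2P; exists (M * 4), (Num.max 1 r^-1); split.
- by rewrite mulr_ge0.
- by rewrite le_max lexx.
apply: (@expbound_le _ (M * 4) _ r^-1); rewrite ?mulr_ge0 ?invr_ge0 ?(ltW r0) //.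
  by rewrite le_max lexx orbT.
move=> k l; pose N := (k + l).+1.
have kN : (k < N)%N by rewrite /N; lia.
have lN : (l < N)%N by rewrite /N; lia.
have sN := l1norm_seminorm N (ltW r0).
have -> : comp22 h u v k l = psum (@const2 R[i]) N h u v k l.
  rewrite /psum fps2_sumE; apply: eq_bigr => i _; rewrite fps2_sumE.
  by apply: eq_bigr => j _; rewrite const2ME.
rewrite exprVn ler_pdivlMr ?exprn_gt0 //.
apply: (@le_trans _ _ (l1norm r N (psum (@const2 R[i]) N h u v))).
  rewrite l1normE (bigD1 (Ordinal kN)) //= (bigD1 (Ordinal lN)) //= -addrA lerDl.
  have term (f : fps2 R) i j : 0 <= cnorm (f i j) * r ^+ (i + j).
    by rewrite mulr_ge0 ?cnorm_ge0 // exprn_ge0 // ltW.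
  by rewrite addr_ge0 ?sumr_ge0 // => i _; rewrite sumr_ge0.
apply: (@le_trans _ _ (l1norm (S^-1 / 2) N h)); last first.
  apply: (expbound_sum N M0 (ltW rho0) (ltW S0)) => //.
  by rewrite mulrA divff ?gt_eqF // mul1r.
rewrite [leRHS]l1normE; apply: le_trans (semi_sum sN _ _ _) _.
apply: ler_sum => i _; apply: le_trans (semi_sum sN _ _ _) _.
apply: ler_sum => j _; apply: le_trans (semiM sN _ _) _.
apply: ler_pM; rewrite ?(semi_ge0 sN) //.
  rewrite l1normE (bigD1 (Ordinal (ltn0Sn (k + l)))) //=.
  rewrite (bigD1 (Ordinal (ltn0Sn (k + l)))) //= const2E mulr1.
  rewrite big1 => [|p p0]; last first.
    by rewrite const2E /= ifF ?cnorm0 ?mul0r //; apply: negbTE.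
  rewrite big1 ?addr0 // => q q0; rewrite big1 // => p _.
  by rewrite const2E /= ifF ?cnorm0 ?mul0r //; apply/negbTE; rewrite negb_and q0.
rewrite exprD; apply: le_trans (semiM sN _ _) _.
by apply: ler_pM; rewrite ?(semi_ge0 sN) ?semiX_le.
Qed.

Lemma conv2_ddx h : h \in @conv2 R -> ddx h \in @conv2 R.
Proof.
move=> /conv2P[M [S [M0 S1 bh]]]; have S0 : 0 < S by apply: lt_le_trans S1.
apply/conv2P; exists (M * S), (S * 2); split; [by rewrite mulr_ge0 // ltW|lra|].
move=> i j; rewrite cnormMn.
apply: (@le_trans _ _ ((M * S ^+ (i.+1 + j)) *+ i.+1)); first by rewrite lerMn2r bh.
have i2 : (i.+1)%:R <= 2 ^+ (i + j) :> R.
  rewrite -natrX ler_nat; apply: leq_trans (ltn_expl i (ltnSn 1)) _.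
  by rewrite leq_exp2l ?leq_addr.
have -> : (M * S ^+ (i.+1 + j)) *+ i.+1 = M * S * S ^+ (i + j) * (i.+1)%:R.
  by rewrite addSn exprS -mulr_natr !mulrA.
by rewrite exprMn mulrA ler_wpM2l // !mulr_ge0 ?exprn_ge0 ?(ltW S0).
Qed.

Lemma conv2_ddy h : h \in @conv2 R -> ddy h \in @conv2 R.
Proof.
move=> /conv2P[M [S [M0 S1 bh]]]; have S0 : 0 < S by apply: lt_le_trans S1.
apply/conv2P; exists (M * S), (S * 2); split; [by rewrite mulr_ge0 // ltW|lra|].
move=> i j; rewrite cnormMn.
apply: (@le_trans _ _ ((M * S ^+ (i + j.+1)) *+ j.+1)); first by rewrite lerMn2r bh.
have j2 : (j.+1)%:R <= 2 ^+ (i + j) :> R.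
  rewrite -natrX ler_nat; apply: leq_trans (ltn_expl j (ltnSn 1)) _.
  by rewrite leq_exp2l ?leq_addl.
have -> : (M * S ^+ (i + j.+1)) *+ j.+1 = M * S * S ^+ (i + j) * (j.+1)%:R.
  by rewrite addnS exprS -mulr_natr !mulrA.
by rewrite exprMn mulrA ler_wpM2l // !mulr_ge0 ?exprn_ge0 ?(ltW S0).
Qed.

Lemma conv2_const (c : R[i]) : const2 c \in @conv2 R.
Proof.
apply/conv2P; exists (cnorm c), 1; split=> [||i j]; rewrite ?cnorm_ge0 //.
by rewrite const2E expr1n mulr1; case: andb; rewrite ?cnorm0 ?cnorm_ge0.
Qed.

(** The inverse is the value of the geometric series at a series without
    constant term, and composition preserves convergence. *)
Lemma conv2_inv g : g \in @conv2 R -> g 0%N 0%N != 0 ->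
  exists2 g' : fps2 R, g' \in @conv2 R & g * g' = 1.
Proof.
move=> cg g0; pose c := g 0%N 0%N; pose e : fps2 R := 1 - const2 c^-1 * g.
have e0 : e 0%N 0%N = 0.
  rewrite /e fps2DE fps2NE const2ME mulVf //.
  have -> : (1 : fps2 R) = const2 1 by rewrite rmorph1.
  by rewrite const2E subrr.
have ce : e \in @conv2 R by rewrite rpredB ?rpred1 // rpredM ?conv2_const.
pose geo : fps2 R := fun i j => (j == 0%N)%:R.
have cgeo : geo \in @conv2 R.
  apply/conv2P; exists 1, 1; split=> // i j; rewrite expr1n mulr1 /geo.
  by case: eqP => _; rewrite ?cnorm1 ?cnorm0.
have c0 : (0 : fps2 R) \in @conv2 R by rewrite rpred0.
have geoE : geo * (1 - ser_x R) = 1.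
  apply/funext => i; apply/funext => j.
  rewrite mulrBr mulr1 [geo * _]mulrC fps2DE fps2NE ser_xME /geo.
  have -> : (1 : fps2 R) = const2 1 by rewrite rmorph1.
  by rewrite const2E; case: i => [|i]; [rewrite subr0; case: j|rewrite subrr].
have zz : (0 : fps2 R) 0%N 0%N = 0 by [].
exists (const2 c^-1 * comp22 geo e 0).
  by rewrite rpredM ?conv2_const // conv2_comp22.
rewrite mulrA [g * _]mulrC.
have -> : const2 c^-1 * g = comp22 (1 - ser_x R) e 0.
  rewrite comp22D // comp22_1 // -[- _]mulN1r.
  have -> : (-1 : fps2 R) = const2 (-1) by rewrite rmorphN1.
  by rewrite comp22M // comp22_const // comp22_x // rmorphN1 mulN1r /e subKr.
by rewrite mulrC -comp22M // geoE comp22_1.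
Qed.

(** ** One variable *)

(** A series in one variable seen in two: convergence in one variable is deduced
    from convergence in two. *)
Definition lift1 a : fps2 R := fun i => fps_const (a i).

Lemma lift1E a i j : lift1 a i j = if j == 0%N then a i else 0.
Proof. by []. Qed.

Lemma lift1D a b : lift1 (a + b) = lift1 a + lift1 b.
Proof. by apply/funext => i; rewrite fpsDE /lift1 rmorphD. Qed.

Lemma lift1M a b : lift1 (a * b) = lift1 a * lift1 b.
Proof.
apply/funext => i; rewrite /lift1 !fpsME rmorph_sum.
by apply: eq_bigr => k _; rewrite rmorphM.
Qed.

Lemma lift1_const c : lift1 (fps_const c) = const2 c.
Proof. by apply/funext => -[|i]; apply/funext => -[|j]. Qed.

Lemma lift1_1 : lift1 1 = 1.
Proof. by rewrite -(rmorph1 (@fps_const R[i])) lift1_const rmorph1. Qed.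

Lemma lift1_wt N a : vanish N a -> wt 1 1 N (lift1 a).
Proof. by move=> va i j ij; rewrite lift1E; case: eqP => // _; apply: va; lia. Qed.

Lemma lift1_conv a : convergent1 a <-> lift1 a \in @conv2 R.
Proof.
have E (r : R) N : \sum_(i < N) \sum_(j < N) `|lift1 a i j| * r%:C ^+ (i + j)
    = \sum_(k < N) `|a k| * r%:C ^+ k.
  apply: eq_bigr => i _; case: N i => [|N] i; first by case: i.
  rewrite big_ord_recl big1 => [|j _]; last by rewrite lift1E normr0 mul0r.
  by rewrite lift1E addn0 addr0.
split=> [[r r0 [M bM]]|/asboolP[r r0 [M bM]]].
  by apply/asboolP; exists r => //; exists M => N; rewrite E.
by exists r => //; exists M => N; rewrite -E.
Qed.

Lemma lift1_comp21 h a b : a 0%N = 0 -> b 0%N = 0 ->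
  lift1 (comp21 h a b) = comp22 h (lift1 a) (lift1 b).
Proof.
move=> a0 b0; have f2 := @wt_filtration R[i].
have := is_subst_morph lift1D lift1M lift1_1 lift1_const lift1_wt (comp21P h a0 b0).
by move=> /(is_subst_uniq f2); apply; apply: comp22P.
Qed.

Lemma convergent1_comp21 h a b : h \in @conv2 R -> convergent1 a -> convergent1 b ->
  a 0%N = 0 -> b 0%N = 0 -> convergent1 (comp21 h a b).
Proof.
move=> ch /lift1_conv ca /lift1_conv cb a0 b0; apply/lift1_conv.
by rewrite lift1_comp21 // conv2_comp22.
Qed.

Lemma convergent1M a b : convergent1 a -> convergent1 b -> convergent1 (a * b).
Proof.
by move=> /lift1_conv ca /lift1_conv cb; apply/lift1_conv; rewrite lift1M rpredM.
Qed.

Lemma convergent1D a b : convergent1 a -> convergent1 b -> convergent1 (a + b).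
Proof.
by move=> /lift1_conv ca /lift1_conv cb; apply/lift1_conv; rewrite lift1D rpredD.
Qed.

Lemma convergent1_ddt a : convergent1 a -> convergent1 (ddt a).
Proof.
move=> /lift1_conv /conv2_ddx ca; apply/lift1_conv.
suff <- : ddx (lift1 a) = lift1 (ddt a) by [].
apply/funext => i; apply/funext => j; rewrite /ddx !lift1E /ddt.
by case: eqP; rewrite ?mul0rn.
Qed.

Lemma convergent1P a : convergent1 a <->
  exists M S : R, [/\ 0 <= M, 1 <= S & forall k, cnorm (a k) <= M * S ^+ k].
Proof.
rewrite lift1_conv; split=> [/conv2P|] [M [S [M0 S1 ba]]].
  by exists M, S; split=> // k; have := ba k 0%N; rewrite addn0.
apply/conv2P; exists M, S; split=> // i j; rewrite lift1E.
have S0 : 0 <= S by lra.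
case: eqP => [->|_]; rewrite ?addn0 //.
by rewrite cnorm0 mulr_ge0 ?exprn_ge0.
Qed.

Lemma convergent1_tpow n : convergent1 (tpow R n).
Proof.
apply/convergent1P; exists 1, 1; split=> // k; rewrite expr1n mulr1 /tpow.
by case: eqP; rewrite ?cnorm1 ?cnorm0.
Qed.

End Composition.

(** * Weierstrass division *)

Section Weierstrass.
Variable R : realType.
Implicit Types (f g h q : fps2 R).

Lemma geometric_sum_le (K : R) w : 1 <= K -> (K - 1) * (\sum_(v < w) K ^+ v) <= K ^+ w.
Proof. by move=> K1; rewrite -subrX1; lra. Qed.

Lemma ser_yXME r f i j :
  (ser_y R ^+ r * f) i j = if (r <= j)%N then f i (j - r)%N else 0.
Proof.
elim: r j => [|r IH] j; first by rewrite expr0 mul1r subn0.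
by rewrite exprS -mulrA ser_yME; case: j => [|j] //; rewrite IH ltnS subSS.
Qed.

Lemma expbound_common f g : f \in @conv2 R -> g \in @conv2 R ->
  exists M S : R, [/\ 1 <= M, 1 <= S, expbound M S f & expbound M S g].
Proof.
move=> /conv2P[M [S [M0 S1 bf]]] /conv2P[N [T [N0 T1 bg]]].
have S0 : 0 <= S by lra.
have T0 : 0 <= T by lra.
exists (1 + M + N), (S + T); split; [lra|lra| |].
  by apply: (expbound_le _ _ _ _ bf) => //; lra.
by apply: (expbound_le _ _ _ _ bg) => //; lra.
Qed.

(** The quotient solves a recursion on the power of [x]: as the lower
    coefficients of the divisor in [y] vanish at [x = 0], they only bring in
    quotient coefficients with a smaller power of [x]. *)
Lemma weierstrass_division g h r : g \in @conv2 R -> h \in @conv2 R ->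
  (forall j, (j < r)%N -> g 0%N j = 0) -> g 0%N r != 0 ->
  exists2 q, q \in @conv2 R & forall i j, (r <= j)%N -> (h - q * g) i j = 0.
Proof.
move=> cg ch g0 gr; pose U : fps2 R := fun i j => g i (j + r)%N.
have cU : U \in @conv2 R.
  have [M [S [M0 S1 bg]]] := conv2P _ cg; apply/conv2P; exists (M * S ^+ r), S.
  have S0 : 0 <= S by lra.
  split=> // [|i j]; first by rewrite mulr_ge0 ?exprn_ge0.
  by apply: le_trans (bg _ _) _; rewrite addnA exprD mulrAC mulrA.
have [|U' cU' UU'] := conv2_inv cU; first by rewrite /U add0n.
have cy : ser_y R \in @conv2 R.
  apply/conv2P; exists 1, 1; split=> // i j; rewrite expr1n mulr1 /ser_y.
  by case: andb; rewrite ?cnorm1 ?cnorm0.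
pose V := U' * (g - ser_y R ^+ r * U).
have cV : V \in @conv2 R by rewrite rpredM ?rpredB ?rpredM ?rpredX.
have V0 : V 0%N = 0.
  rewrite /V fpsME big_ord1 /=; set P := (X in _ * X); rewrite (_ : P = 0) ?mulr0 //.
  apply/funext => j; rewrite /P fps2DE fps2NE ser_yXME.
  by case: leqP => rj; rewrite /U ?subnK ?subrr ?g0 ?subr0.
have [Q QE] : exists Q : fps2 R, forall i, Q i = fun j =>
    h i (j + r)%N - (\sum_(k < i) Q k * V (i - k)%N) (j + r)%N.
  apply: (@strong_recursion (fps1 R) 0 (fun Q i j =>
    h i (j + r)%N - (\sum_(k < i) Q k * V (i - k)%N) (j + r)%N)).
  move=> f f' k ff'.
  have -> // : \sum_(i < k) f i * V (k - i)%N = \sum_(i < k) f' i * V (k - i)%N.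
  by apply: eq_bigr => i _; rewrite ff'.
have QV i j : (Q * V) i j = (\sum_(k < i) Q k * V (i - k)%N) j.
  by rewrite fpsME big_ord_recr /= subnn V0 mulr0 addr0.
exists (Q * U'); last first.
  move=> i j rj; have -> : Q * U' * g = ser_y R ^+ r * Q + Q * V.
    by rewrite /V; transitivity (Q * (U' * g)); [ring|
      rewrite -[ser_y R ^+ r * Q]mulr1 -UU'; ring].
  rewrite fps2DE fps2NE fps2DE ser_yXME rj QV QE subnK //; ring.
suff cQ : Q \in @conv2 R by rewrite rpredM.
have [M [S [M1 S1 bh bV]]] := expbound_common ch cV.
have S0 : 0 < S by lra.
have M0 : 0 <= M by lra.
pose K := 1 + 4 * M * S ^+ r * 2 ^+ r.
have Sr : 0 < S ^+ r by rewrite exprn_gt0.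
have r2 : 0 < 2 ^+ r :> R by rewrite exprn_gt0.
have K1 : 1 <= K.
  by rewrite /K lerDl !mulr_ge0 ?(ltW Sr) ?(ltW r2).
pose C := 2 * M * S ^+ r.
have C0 : 0 <= C by rewrite /C !mulr_ge0 ?(ltW Sr).
have bQ i : forall j, cnorm (Q i j) <= C * (S * K) ^+ i * (2 * S) ^+ j.
  elim/ltn_ind: i => i IH j; rewrite QE.
  apply: le_trans (cnormD _ _) _; rewrite cnormN.
  have part1 : cnorm (h i (j + r)%N) <= C / 2 * (S * K) ^+ i * (2 * S) ^+ j.
    apply: le_trans (bh _ _) _.
    have -> : C / 2 = M * S ^+ r by rewrite /C; field.
    rewrite !exprD !exprMn.
    have -> : M * (S ^+ i * (S ^+ j * S ^+ r)) = M * S ^+ r * (S ^+ i * S ^+ j) by ring.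
    rewrite -[leRHS]mulrA ler_wpM2l ?mulr_ge0 ?(ltW Sr) //.
    apply: ler_pM; rewrite ?exprn_ge0 ?(ltW S0) //.
      by rewrite ler_peMr ?exprn_ge0 ?(ltW S0) // exprn_ege1.
    by rewrite ler_peMl ?exprn_ge0 ?(ltW S0) // exprn_ege1 //; lra.
  suff part2 : cnorm ((\sum_(k < i) Q k * V (i - k)%N) (j + r)%N) <=
      C / 2 * (S * K) ^+ i * (2 * S) ^+ j.
    have -> : C * (S * K) ^+ i * (2 * S) ^+ j =
      C / 2 * (S * K) ^+ i * (2 * S) ^+ j + C / 2 * (S * K) ^+ i * (2 * S) ^+ j.
      by field.
    exact: lerD.
  rewrite fps_sumE; apply: le_trans (cnorm_sum _ _ _) _.
  pose s2 : R := \sum_(l < (j + r).+1) 2 ^+ l.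
  pose sK : R := \sum_(k < i) K ^+ k.
  apply: (@le_trans _ _ (C * M * (S ^+ i * S ^+ (j + r)) * s2 * sK)).
    rewrite /sK mulr_sumr; apply: ler_sum => k _; rewrite fpsME.
    apply: le_trans (cnorm_sum _ _ _) _.
    rewrite /s2 mulr_sumr mulr_suml; apply: ler_sum => l _.
    have ki := ltn_ord k; have lj := ltn_ord l; rewrite ltnS in lj.
    rewrite cnormM; apply: (@le_trans _ _
      (C * (S * K) ^+ k * (2 * S) ^+ l * (M * S ^+ (i - k + (j + r - l))))).
      by apply: ler_pM; rewrite ?cnorm_ge0 ?IH.
    have -> : S ^+ i = S ^+ k * S ^+ (i - k) by rewrite -exprD subnKC // ltnW.
    have -> : S ^+ (j + r) = S ^+ l * S ^+ (j + r - l) by rewrite -exprD subnKC.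
    rewrite [S ^+ (_ + (_ - _))]exprD !exprMn le_eqVlt; apply/orP; left; apply/eqP.
    by ring.
  have s2le : s2 <= 2 * (2 ^+ j * 2 ^+ r).
    rewrite -exprD -exprS /s2; have := @geometric_sum_le 2 (j + r).+1.
    by rewrite (_ : 2 - 1 = 1 :> R) ?mul1r; [apply; lra|ring].
  have sKle : 4 * M * S ^+ r * 2 ^+ r * sK <= K ^+ i.
    have := geometric_sum_le i K1; rewrite -/sK; congr (_ * _ <= _).
    by rewrite /K; ring.
  have sK0 : 0 <= sK by apply: sumr_ge0 => k _; rewrite exprn_ge0 //; lra.
  apply: (@le_trans _ _ (C * M * (S ^+ i * S ^+ (j + r)) * (2 * (2 ^+ j * 2 ^+ r)) * sK)).
    rewrite ler_wpM2r // ler_wpM2l // !mulr_ge0 ?exprn_ge0 ?(ltW S0) //; lra.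
  have -> : C * M * (S ^+ i * S ^+ (j + r)) * (2 * (2 ^+ j * 2 ^+ r)) * sK =
      C / 2 * S ^+ i * S ^+ j * 2 ^+ j * (4 * M * S ^+ r * 2 ^+ r * sK).
    by rewrite exprD; field.
  have -> : C / 2 * (S * K) ^+ i * (2 * S) ^+ j =
      C / 2 * S ^+ i * S ^+ j * 2 ^+ j * K ^+ i by rewrite !exprMn; ring.
  by rewrite ler_wpM2l // !mulr_ge0 ?exprn_ge0 ?(ltW S0) // invr_ge0.
apply/conv2P; exists C, (S * K + 2 * S).
have K0 : 0 <= K by lra.
have SK : 0 <= S * K by rewrite mulr_ge0 // ltW.
split=> // [|i j]; first lra.
apply: le_trans (bQ i j) _; rewrite -mulrA ler_wpM2l // exprD.
apply: ler_pM; rewrite ?exprn_ge0 //; first lra.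
  by rewrite lerXn2r ?nnegrE //; lra.
by rewrite lerXn2r ?nnegrE //; lra.
Qed.

End Weierstrass.

(** * Functions along a cusp in adapted coordinates *)

Lemma rep_uniq n m i j i' j' : coprime n m -> (j < n)%N -> (j' < n)%N ->
  (n * i + m * j = n * i' + m * j')%N -> i = i' /\ j = j'.
Proof.
move=> cop; wlog jj' : i j i' j' / (j <= j')%N.
  move=> H jn j'n e; case: (leqP j j') => [jj'|/ltnW j'j]; first exact: H.
  by have [-> ->] := H _ _ _ _ j'j j'n jn (esym e).
move=> jn j'n e.
have d : (n %| m * (j' - j))%N.
  have -> : (m * (j' - j) = n * i - n * i')%N by rewrite mulnBr; lia.
  by rewrite dvdn_sub // dvdn_mulr.
rewrite Gauss_dvdr // in d.
have j0 : (j' - j = 0)%N.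
  by apply/eqP; apply: contraLR d => d0; rewrite gtnNdvd //; lia.
have ej : j = j' by lia.
have : (n * i == n * i')%N by move: e; rewrite ej => /addIn ->.
by rewrite eqn_mul2l => /orP[/eqP|/eqP-> //]; lia.
Qed.

(** The bound [n * m] exceeds the conductor of the semigroup. *)
Lemma rep_exists n m v : (0 < n)%N -> coprime n m -> (n * m <= v)%N ->
  exists i j, (j < n)%N /\ v = (n * i + m * j)%N.
Proof.
move=> n0 cop vnm; pose x := chinese n m v 0.
have xn : x = v %[mod n] by rewrite chinese_modl.
have : x = 0 %[mod m] by rewrite chinese_modr.
rewrite mod0n => /eqP/dvdnP[q xE].
have jn : (q %% n < n)%N by rewrite ltn_mod.
have le : (m * (q %% n) <= v)%N.
  apply: leq_trans vnm; rewrite [(n * m)%N]mulnC leq_mul2l; apply/orP; right; exact: ltnW.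
have : (n %| v - m * (q %% n))%N.
  by rewrite -eqn_mod_dvd // modnMmr mulnC -xE xn.
by case/dvdnP => i e; exists i, (q %% n)%N; split => //; lia.
Qed.

Section Powers.
Variable R : realType.
Implicit Types a : fps1 R.

Lemma vanishX N a p : vanish N a -> vanish (N * p) (a ^+ p).
Proof.
move=> va; elim: p => [|p IH]; first by rewrite muln0.
by rewrite exprS mulnS; apply: vanishM.
Qed.

Lemma leadX N a p : vanish N a -> (a ^+ p) (N * p)%N = a N ^+ p.
Proof.
move=> va; elim: p => [|p IH]; first by rewrite muln0 expr0.
by rewrite !exprS mulnS lead_mul ?IH //; apply: vanishX.
Qed.

Lemma tpow_vanish p : vanish p (tpow R p).
Proof. by move=> k kp; rewrite /tpow ltn_eqF. Qed.

Lemma tpowME p a k : (tpow R p * a) (p + k)%N = a k.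
Proof.
have pk : (p < (p + k).+1)%N by lia.
rewrite fpsME (bigD1 (Ordinal pk)) //= addKn {1}/tpow eqxx mul1r big1 ?addr0 //.
move=> i ip; rewrite /tpow; case: eqP => [ei|_]; rewrite ?mul0r //.
by case/eqP: ip; apply: val_inj.
Qed.

Lemma tpowXME n p a k : (tpow R n ^+ p * a) (n * p + k)%N = a k.
Proof.
elim: p => [|p IH]; first by rewrite muln0 expr0 mul1r.
by rewrite exprS -mulrA mulnS -addnA tpowME.
Qed.

End Powers.

(** The curve [(t^n, b t)] with [b] of order [m]. *)
Record cusp (R : realType) (n m : nat) (b : fps1 R) : Prop := Cusp {
  cusp_n2 : (2 <= n)%N;
  cusp_nm : (n < m)%N;
  cusp_coprime : coprime n m;
  cusp_convergent : convergent1 b;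
  cusp_vanish : vanish m b;
  cusp_lead : b m != 0 }.

Section Adapted.
Variables (R : realType) (n m : nat) (b : fps1 R).
Hypothesis Cb : cusp n m b.
Let n2 := cusp_n2 Cb.
Let nm := cusp_nm Cb.
Let cop := cusp_coprime Cb.
Let cb := cusp_convergent Cb.
Let vb := cusp_vanish Cb.
Let bm := cusp_lead Cb.
Implicit Types (f g h : fps2 R) (a : fps1 R).
Local Notation wt := (@wt R[i] n m).

Let t0 : tpow R n 0%N = 0.
Proof. by rewrite /tpow; case: n n2. Qed.

Let b0 : b 0%N = 0.
Proof. by rewrite vb //; lia. Qed.

Definition along h := comp21 h (tpow R n) b.

Lemma alongD f g : along (f + g) = along f + along g. Proof. exact: comp21D. Qed.
Lemma alongN f : along (- f) = - along f. Proof. exact: comp21N. Qed.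
Lemma alongB f g : along (f - g) = along f - along g.
Proof. by rewrite alongD alongN. Qed.
Lemma alongM f g : along (f * g) = along f * along g. Proof. exact: comp21M. Qed.
Lemma along_const c : along (const2 c) = fps_const c. Proof. exact: comp21_const. Qed.
Lemma along0 : along 0 = 0.
Proof. by rewrite -(subrr 0) alongB subrr. Qed.
Lemma along1 : along 1 = 1. Proof. exact: comp21_1. Qed.
Lemma along_x : along (ser_x R) = tpow R n. Proof. exact: comp21_x. Qed.
Lemma along_y : along (ser_y R) = b. Proof. exact: comp21_y. Qed.
Lemma alongX f p : along (f ^+ p) = along f ^+ p.
Proof. by elim: p => [|p IH]; rewrite ?along1 // !exprS alongM IH. Qed.
Lemma along_sum (I : Type) (r : seq I) (P : pred I) (F : I -> fps2 R) :
  along (\sum_(i <- r | P i) F i) = \sum_(i <- r | P i) along (F i).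
Proof. exact: (big_morph _ alongD along0). Qed.

Lemma along_wt d h : wt d h -> vanish d (along h).
Proof.
move=> wh k kd; rewrite /along /comp21 big1 // => i _; rewrite big1 // => j _.
have [ij|ij] := ltnP (n * i + m * j) d; first by rewrite wh ?mul0r.
rewrite [X in _ * X](vanishM (vanishX (p := i) (@tpow_vanish R n)) (vanishX (p := j) vb)) ?mulr0 //.
exact: leq_trans ij.
Qed.

(** The monomial [x^p y^q], divided by the leading coefficient of its value
    along the curve. *)
Definition mono p q : fps2 R :=
  fun i j => if (i == p) && (j == q) then (b m)^-1 ^+ q else 0.

Lemma monoE p q : mono p q = const2 ((b m)^-1 ^+ q) * (ser_x R ^+ p * ser_y R ^+ q).
Proof.
apply/funext => i; apply/funext => j; rewrite const2ME ser_xyE /mono.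
by case: andb; rewrite ?mulr1 ?mulr0.
Qed.

Lemma monoM p q p' q' : mono p q * mono p' q' = mono (p + p')%N (q + q')%N.
Proof. by rewrite !monoE !exprD rmorphM; ring. Qed.

Lemma mono_wt p q : wt (n * p + m * q) (mono p q).
Proof.
by move=> i j; rewrite /mono; case: eqP => [->|//]; case: eqP => [->|//]; rewrite ltnn.
Qed.

Lemma conv2_mono p q : mono p q \in @conv2 R.
Proof.
rewrite monoE rpredM ?conv2_const // rpredM ?rpredX //.
  apply/conv2P; exists 1, 1; split=> // i j; rewrite expr1n mulr1 /ser_x.
  by case: andb; rewrite ?cnorm1 ?cnorm0.
apply/conv2P; exists 1, 1; split=> // i j; rewrite expr1n mulr1 /ser_y.
by case: andb; rewrite ?cnorm1 ?cnorm0.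
Qed.

Lemma along_mono p q :
  along (mono p q) = fps_const ((b m)^-1 ^+ q) * (tpow R n ^+ p * b ^+ q).
Proof. by rewrite monoE !alongM !alongX along_const along_x along_y. Qed.

Lemma along_mono_lead p q : along (mono p q) (n * p + m * q)%N = 1.
Proof.
rewrite along_mono fps_constME lead_mul; try exact: vanishX.
  rewrite !leadX //; last exact: tpow_vanish.
  by rewrite /tpow eqxx expr1n mul1r -exprMn mulVf ?expr1n.
by apply: vanishX; apply: tpow_vanish.
Qed.

(** No two monomials of degree less than [n] in [y] have the same order along
    the curve, so their leading terms cannot cancel. *)
Lemma along_eq0 f : (forall i j, (n <= j)%N -> f i j = 0) -> along f = 0 -> f = 0.
Proof.
move=> fn ef; suff wf d : wt d f.
  by apply/funext => i; apply/funext => j; apply: (wf (n * i + m * j).+1).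
elim: d => [//|d IH] i j; rewrite ltnS leq_eqVlt => /orP[/eqP ed|]; last exact: IH.
have [nj|jn] := leqP n j; first exact: fn.
have := @along_wt d.+1 (f - const2 (f i j * b m ^+ j) * mono i j) _ d (ltnSn d).
rewrite alongB ef alongM along_const fpsDE fpsNE fps_constME -ed along_mono_lead.
rewrite mulr1 fps0E add0r => H; suff /eqP : f i j * b m ^+ j = 0.
  by rewrite mulf_eq0 expf_eq0 (negbTE bm) andbF orbF => /eqP.
apply/eqP; rewrite -oppr_eq0; apply/eqP; apply: H => i' j'.
rewrite ltnS leq_eqVlt fps2DE fps2NE const2ME /mono => /orP[/eqP e'|lt'].
  have [nj'|j'n] := leqP n j'.
    by rewrite fn // [j' == j]gtn_eqF ?andbF ?mulr0 ?subrr //; apply: leq_trans nj'.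
  have [-> ->] : i' = i /\ j' = j by apply: (rep_uniq cop) => //; rewrite e'.
  by rewrite !eqxx -mulrA -exprMn mulfV // expr1n mulr1 subrr.
rewrite IH ?(leq_trans lt') ?ed //; case: andP => [[/eqP ii' /eqP jj']|_].
  by move: lt'; rewrite ii' jj' ltnn.
by rewrite mulr0 subrr.
Qed.

(** As [g] has order at most [n] on the line [x = 0], the remainder of a division
    by [g] has degree less than [n] in [y]; it also vanishes along the curve. *)
Lemma ideal_principal g h : g \in @conv2 R -> h \in @conv2 R ->
  along g = 0 -> along h = 0 -> g 0%N n != 0 ->
  exists2 q, q \in @conv2 R & h = q * g.
Proof.
move=> cg ch eg eh gn; have exg : exists r, g 0%N r != 0 by exists n.
case: (ex_minnP exg) => r gr minr.
have rn : (r <= n)%N by apply: minr.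
have [|q cq hq] := weierstrass_division cg ch _ gr.
  by move=> j jr; apply/eqP/negbNE/negP => /minr; rewrite leqNgt jr.
exists q => //; apply: subr0_eq; apply: along_eq0.
  by move=> i j nj; apply: hq; apply: leq_trans nj.
by rewrite alongB alongM eg eh mulr0 subrr.
Qed.

Lemma wt_graded d f : wt d f ->
  wt d.+1 (f - \sum_(i < d.+1) \sum_(j < d.+1 | (n * i + m * j == d)%N)
    const2 (f i j * b m ^+ j) * mono i j).
Proof.
move=> wf k l; rewrite ltnS leq_eqVlt => /orP[/eqP e|lt]; last first.
  rewrite fps2DE fps2NE wf // fps2_sumE big1 ?subrr // => i _.
  rewrite fps2_sumE big1 // => j /eqP ij; rewrite const2ME /mono.
  case: eqP => [ki|]; rewrite ?mulr0 //; case: eqP => [lj|]; rewrite ?mulr0 //.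
  by move: lt; rewrite ki lj ij ltnn.
have kd : (k < d.+1)%N by rewrite -e; nia.
have ld : (l < d.+1)%N by rewrite -e; nia.
rewrite fps2DE fps2NE fps2_sumE (bigD1 (Ordinal kd)) //= fps2_sumE.
rewrite (bigD1 (Ordinal ld)) /= ?e ?eqxx // const2ME /mono !eqxx /=.
rewrite -mulrA -exprMn mulfV // expr1n mulr1 big1 => [|j /andP[_ jl]]; last first.
  rewrite const2ME eqxx /=; case: eqP => [lj|]; rewrite ?mulr0 //.
  by case/eqP: jl; apply: val_inj.
rewrite big1 ?addr0 ?subrr // => i ik; rewrite fps2_sumE big1 // => j _.
rewrite const2ME; case: eqP => [ki|]; rewrite ?mulr0 //.
by case/eqP: ik; apply: val_inj.
Qed.

Lemma along_mono_bound N : exists C S : R, [/\ 1 <= C, 1 <= S &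
  forall p q w, (q < N)%N ->
    cnorm (along (mono p q) (n * p + m * q + w)%N) <= C * S ^+ w].
Proof.
elim: N => [|N [C [S [C1 S1 bd]]]]; first by exists 1, 1.
have cbN : convergent1 (b ^+ N).
  elim: N {bd} => [|N IH]; last by rewrite exprS; apply: convergent1M.
  apply/convergent1P; exists 1, 1; split=> // k; rewrite expr1n mulr1 expr0 fps1E.
  by case: eqP; rewrite ?cnorm1 ?cnorm0.
have /convergent1P[M [T [M0 T1 bT]]] := cbN.
have T0 : 0 <= T by lra.
have S0 : 0 <= S by lra.
pose D := cnorm ((b m)^-1 ^+ N) * (M * T ^+ (m * N)).
have D0 : 0 <= D by rewrite !mulr_ge0 ?cnorm_ge0 ?exprn_ge0.
exists (C + D), (S + T); split; [lra|lra|] => p q w.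
rewrite ltnS leq_eqVlt => /orP[/eqP->|/bd bdq]; last first.
  apply: le_trans (bdq p w) _; apply: ler_pM; rewrite ?exprn_ge0 //; try lra.
  by rewrite lerXn2r ?nnegrE //; lra.
rewrite along_mono fps_constME -addnA tpowXME cnormM.
apply: (@le_trans _ _ (D * T ^+ w)).
  by rewrite -mulrA ler_wpM2l ?cnorm_ge0 // -mulrA -exprD.
apply: ler_pM; rewrite ?exprn_ge0 //; first lra.
by rewrite lerXn2r ?nnegrE //; lra.
Qed.

(** Monomials of degree less than [n] in [y] realize every large order exactly
    once, so a series of large order is expanded along them, one coefficient at
    a time; the coefficients grow at most geometrically. *)
Lemma lift_series a N : convergent1 a -> (n * m <= N)%N -> vanish N a ->
  exists f, [/\ f \in @conv2 R, wt N f & along f = a].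
Proof.
move=> ca nmN va.
have [pq pqE] : {pq : nat -> nat * nat & forall v, (n * m <= v)%N ->
    ((pq v).2 < n)%N /\ v = (n * (pq v).1 + m * (pq v).2)%N}.
  apply: (@choice _ _ (fun v pq => (n * m <= v)%N ->
    (pq.2 < n)%N /\ v = (n * pq.1 + m * pq.2)%N)) => v.
  have [vnm|] := leqP (n * m) v; last by exists (0, 0)%N.
  have [|i [j [jn e]]] := rep_exists _ cop vnm; first lia.
  by exists (i, j).
pose E v := along (mono (pq v).1 (pq v).2).
have [c cE] : exists c : nat -> R[i], forall w, c w = a w - \sum_(v < w) c v * E v w.
  apply: (@strong_recursion _ 0 (fun c w => a w - \sum_(v < w) c v * E v w)) => f g k fg.
  by congr (_ - _); apply: eq_bigr => i _; rewrite fg.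
have c0 v : (v < N)%N -> c v = 0.
  elim/ltn_ind: v => v IH vN; rewrite cE va // big1 ?subr0 // => i _.
  by rewrite IH ?mul0r //; apply: ltn_trans vN.
pose f : fps2 R := fun i j =>
  if (j < n)%N then c (n * i + m * j)%N * (b m)^-1 ^+ j else 0.
have wf : wt N f by move=> i j ij; rewrite /f c0 // mul0r if_same.
have [C [S [C1 S1 bE]]] := along_mono_bound n.
have /convergent1P[A [T [A0 T1 ba]]] := ca.
exists f; split=> //.
  (* With ratio K the tail of the recursion costs at most half of the bound. *)
  pose S' := S + T; pose K := 1 + 2 * C.
  have S'0 : 0 < S' by rewrite /S'; lra.
  have K0 : 0 <= K by rewrite /K; lra.
  have bc w : cnorm (c w) <= 2 * A * (S' * K) ^+ w.
    elim/ltn_ind: w => w IH; rewrite cE; apply: le_trans (cnormD _ _) _.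
    have part1 : cnorm (a w) <= A * (S' * K) ^+ w.
      apply: le_trans (ba w) _; rewrite ler_wpM2l // lerXn2r ?nnegrE //; first lra.
        by rewrite mulr_ge0 // ltW.
      have : S' * 1 <= S' * K by rewrite ler_wpM2l ?(ltW S'0) // /K; lra.
      by rewrite /S'; lra.
    suff part2 : cnorm (\sum_(v < w) c v * E v w) <= A * (S' * K) ^+ w.
      by rewrite cnormN; apply: le_trans (lerD part1 part2) _; lra.
    apply: le_trans (cnorm_sum _ _ _) _.
    apply: (@le_trans _ _ (2 * A * C * S' ^+ w * \sum_(v < w) K ^+ v)).
      rewrite mulr_sumr; apply: ler_sum => v _; rewrite cnormM.
      have rhs0 : 0 <= 2 * A * C * S' ^+ w * K ^+ v.
        by rewrite !mulr_ge0 ?exprn_ge0 ?(ltW S'0) //; lra.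
      have [vN|Nv] := ltnP v N; first by rewrite c0 // cnorm0 mul0r.
      have [qv ev] := pqE v (leq_trans nmN Nv); have vw := ltn_ord v.
      have bEv : cnorm (E v w) <= C * S' ^+ (w - v).
        have := bE (pq v).1 _ (w - v)%N qv; rewrite -ev subnKC ?(ltnW vw) //.
        move/le_trans; apply.
        by rewrite ler_wpM2l ?lerXn2r ?nnegrE ?(ltW S'0) // /S'; lra.
      apply: (@le_trans _ _ (2 * A * (S' * K) ^+ v * (C * S' ^+ (w - v)))).
        by apply: ler_pM; rewrite ?cnorm_ge0 ?IH.
      have -> : S' ^+ w = S' ^+ v * S' ^+ (w - v) by rewrite -exprD subnKC // ltnW.
      by rewrite exprMn le_eqVlt; apply/orP; left; apply/eqP; ring.
    have := @geometric_sum_le _ K w; rewrite /K addrAC subrr add0r -/K.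
    have K1 : 1 <= K by rewrite /K; lra.
    move=> /(_ K1) geo; rewrite exprMn.
    have -> : 2 * A * C * S' ^+ w * \sum_(v < w) K ^+ v =
      A * S' ^+ w * (2 * C * \sum_(v < w) K ^+ v) by ring.
    by rewrite [leRHS]mulrA ler_wpM2l // mulr_ge0 // exprn_ge0 // ltW.
  pose L := S' * K; pose B := cnorm (b m)^-1.
  have L0 : 0 <= L by rewrite mulr_ge0 // ltW.
  have B0 : 0 <= B by rewrite cnorm_ge0.
  apply/conv2P; exists (2 * A), (1 + L ^+ n + L ^+ m * B).
  have Ln : 0 <= L ^+ n by rewrite exprn_ge0.
  have LB : 0 <= L ^+ m * B by rewrite mulr_ge0 ?exprn_ge0.
  split=> [||i j]; [lra|lra|rewrite /f].
  case: ifP => [jn|_]; last first.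
    by rewrite cnorm0 !mulr_ge0 ?exprn_ge0 //; lra.
  have cX z k : cnorm (z ^+ k) = cnorm z ^+ k.
    by elim: k => [|k IH]; rewrite ?cnorm1 // !exprS cnormM IH.
  rewrite cnormM cX -/B; apply: (@le_trans _ _ (2 * A * L ^+ (n * i + m * j) * B ^+ j)).
    by apply: ler_pM; rewrite ?cnorm_ge0 ?exprn_ge0.
  rewrite exprD !exprM -!mulrA !ler_wpM2l // -exprMn exprD.
  by apply: ler_pM; rewrite ?exprn_ge0 // lerXn2r ?nnegrE //; lra.
apply/funext => k.
have wrem : wt k.+1 (f - \sum_(v < k.+1) const2 (c v) * mono (pq v).1 (pq v).2).
  move=> i j ij; rewrite fps2DE fps2NE fps2_sumE (bigD1 (Ordinal ij)) //=.
  rewrite big1 => [|v vij]; last first.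
    rewrite const2ME /mono; have [vN|Nv] := ltnP v N; first by rewrite c0 ?mul0r.
    have [_ ev] := pqE v (leq_trans nmN Nv).
    case: andP => [[/eqP ei /eqP ej]|_]; last by rewrite mulr0.
    by case/eqP: vij; apply: val_inj; rewrite /= ev -ei -ej.
  rewrite addr0 const2ME /mono /f.
  have [lN|Nl] := ltnP (n * i + m * j) N; first by rewrite c0 ?mul0r ?if_same ?subrr.
  have [qn ev] := pqE _ (leq_trans nmN Nl).
  have [nj|jn] := leqP n j.
    by rewrite [j == _]gtn_eqF ?andbF ?mulr0 ?subrr //; apply: leq_trans nj.
  have [<- <-] := rep_uniq cop jn qn ev.
  by rewrite !eqxx subrr.
have H := along_wt wrem (ltnSn k).
rewrite alongB along_sum fpsDE fpsNE fps_sumE in H.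
rewrite (subr0_eq H) big_ord_recr /= alongM along_const fps_constME.
under eq_bigr => v _ do rewrite alongM along_const fps_constME.
rewrite -/(E k); have -> : c k * E k k = c k.
  have [kN|Nk] := ltnP k N; first by rewrite c0 ?mul0r.
  have [_ ek] := pqE k (leq_trans nmN Nk).
  by have := along_mono_lead (pq k).1 (pq k).2; rewrite -ek /E => ->; rewrite mulr1.
by rewrite [c k]cE addrC subrK.
Qed.

End Adapted.

(** * The staircase of a semimodule *)

Lemma min_optP (P : nat -> Prop) k : P k -> (forall i, P i -> (k <= i)%N) ->
  min_opt P = Some k.
Proof.
move=> Pk minP; rewrite /min_opt; case: pselect => [ex|[]]; last first.
  by exists k; apply/asboolP.
case: ex_minnP => i /asboolP Pi mini; congr Some; apply/eqP.
by rewrite eqn_leq minP // mini //; apply/asboolP.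
Qed.

Section Staircase.
Local Open Scope nat_scope.
Variables (n m : nat) (lam : seq nat).
Hypotheses (n2 : 2 <= n) (nm : n < m) (cop : coprime n m).

Local Notation L a := (nth 0 lam a).
Local Notation Up := (Lambda_upto n m lam).
Local Notation ln a := (ell n m lam n a).
Local Notation lm a := (ell n m lam m a).

Lemma UpP a v : Up a v <-> exists i p q, i <= a /\ v = L i + n * p + m * q.
Proof.
split=> [[i ia [g [p [q ->]] ->]]|[i [p [q [ia ->]]]]].
  by exists i, p, q; rewrite addnA.
by exists i => //; exists (n * p + m * q); [exists p, q|rewrite addnA].
Qed.

Lemma UpS a v : Up a.+1 v <-> Up a v \/ exists p q, v = L a.+1 + n * p + m * q.
Proof.
split=> [/UpP[i [p [q [ia ->]]]]|[/UpP[i [p [q [ia ->]]]]|[p [q ->]]]].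
- move: ia; rewrite leq_eqVlt => /orP[/eqP->|ia]; first by right; exists p, q.
  by left; apply/UpP; exists i, p, q.
- by apply/UpP; exists i, p, q; split=> //; apply: leqW.
- by apply/UpP; exists a.+1, p, q.
Qed.

Lemma ell_eq d a l : 1 <= l -> Up a (L a.+1 + d * l) ->
  (forall r, 1 <= r < l -> ~ Up a (L a.+1 + d * r)) -> ell n m lam d a.+1 = l.
Proof.
move=> l1 Ul minl; rewrite /ell (min_optP (k := l)) //= => r [r1 Ur].
by rewrite leqNgt; apply/negP => rl; apply: (minl r) => //; rewrite r1.
Qed.

(** The last generator [L a] has two neighbours on the staircase of [Lambda_a]:
    it meets [L k] in direction [x] and [L j] in direction [y]. All the other
    outer corners of the staircase are smaller than these two. So a point outside
    [Lambda_a] and beyond the smaller of the two lies strictly below the larger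
    one ([cor_below]); conversely nothing strictly below the larger one belongs
    to [Lambda_a] ([cor_above]). The bounds by [n] and [m] exclude the
    identification of [x^m] with [y^n]. *)
Record corner (a k A j B : nat) : Prop := Corner {
  cor_k : k < a;
  cor_j : j < a;
  cor_ln : 0 < ln a < m;
  cor_lm : 0 < lm a < n;
  cor_A : 0 < A < n;
  cor_B : 0 < B < m;
  cor_x : L a + n * ln a = L k + m * A;
  cor_y : L a + m * lm a = L j + n * B;
  cor_above : forall z p q, 0 < p -> 0 < q ->
    z + n * p + m * q = maxn (L a + n * ln a) (L a + m * lm a) -> ~ Up a z;
  cor_below : forall z, ~ Up a z ->
    minn (L a + n * ln a) (L a + m * lm a) <= z ->
    exists p q, [/\ 0 < p, 0 < q &
      z + n * p + m * q = maxn (L a + n * ln a) (L a + m * lm a)] }.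

Lemma ell_base : L 0 = n -> L 1 = m -> ln 1 = 1 /\ lm 1 = n.-1.
Proof.
move=> L0 L1; split; apply: ell_eq.
- by [].
- by apply/UpP; exists 0, 0, 1; rewrite L0 L1; split=> //; lia.
- by move=> r; lia.
- lia.
- by apply/UpP; exists 0, m.-1, 0; rewrite L0 L1; split=> //; nia.
move=> r /andP[r1 rn] /UpP[i [p [q [i0 e]]]].
move: e; rewrite (_ : i = 0) ?L0 ?L1; last by lia.
move=> e; have q_lt : q < n.
  rewrite ltnNge; apply/negP => nq; have : m * n <= m * q by rewrite leq_mul2l nq orbT.
  have : m * r.+1 < m * n by rewrite ltn_mul2l; apply/andP; split; lia.
  by rewrite mulnS; lia.
have [||] := @rep_uniq n m 0 r.+1 p.+1 q cop _ q_lt; [lia| |lia].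
by rewrite muln0 !mulnS; lia.
Qed.

Lemma corner_base : L 0 = n -> L 1 = m -> corner 1 0 1 0 m.-1.
Proof.
move=> L0 L1; have [en em] := ell_base L0 L1.
have n1 : n.-1.+1 = n by lia.
have m1 : m.-1.+1 = m by lia.
have mnE : m + m * n.-1 = n * m by rewrite -mulnS n1 mulnC.
have maxE : maxn (L 1 + n * ln 1) (L 1 + m * lm 1) = n * m.
  by rewrite en em L1 mnE muln1; apply/maxn_idPr; nia.
have minE : minn (L 1 + n * ln 1) (L 1 + m * lm 1) = m + n.
  by rewrite en em L1 mnE muln1; apply/minn_idPl; nia.
split; rewrite ?maxE ?minE ?en ?em ?L0 ?L1 ?mnE //; try lia.
- move=> z p q p0 q0 e /UpP[i [p' [q' [i1 ez]]]].
  have [P [Q zE]] : exists P Q, z = n * P + m * Q.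
    case: i i1 ez => [|[|//]] _ ->; rewrite ?L0 ?L1.
      by exists p'.+1, q'; rewrite mulnS; lia.
    by exists p', q'.+1; rewrite mulnS; lia.
  have eQ : n * (P + p) + m * (Q + q) = n * m by rewrite !mulnDr; lia.
  have [Qn|nQ] := ltnP (Q + q) n.
    have [||_] := @rep_uniq n m (P + p) (Q + q) m 0 cop Qn; [lia| |lia].
    by rewrite muln0 eQ addn0.
  have : m * n <= m * (Q + q) by rewrite leq_mul2l nQ orbT.
  have : 0 < n * (P + p) by rewrite muln_gt0; lia.
  lia.
move=> z Uz zmn; have [||i [j [jn e]]] := @rep_exists n m (z + n * m) _ cop; [lia|lia|].
have [im|mi] := ltnP i m.
  exists (m - i), (n - j); split; [lia|lia|].
  have := mulnBr n m i; have := mulnBr m n j.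
  have : n * i <= n * m by rewrite leq_mul2l (ltnW im) orbT.
  have : m * j <= m * n by rewrite leq_mul2l (ltnW jn) orbT.
  have := mulnC m n; lia.
case: Uz; apply/UpP; have : z = n * (i - m) + m * j.
  by rewrite mulnBr; have : n * m <= n * i by [rewrite leq_mul2l mi orbT]; lia.
case: (i - m) => [|p] zE; last first.
  by exists 0, p, j; rewrite L0 zE mulnS; split=> //; lia.
case: j {jn e} zE => [|q] zE; first by lia.
by exists 1, 0, q; rewrite L1 zE mulnS; split=> //; lia.
Qed.

(** Being beyond the smaller corner, a new generator lies below the larger one
    only. It meets there the two generators that met in that corner, one of which
    is [L a]: these are its neighbours, and the old smaller corner is smaller
    than the two new ones. *)
Lemma corner_split a k A j B : corner a k A j B ->
  (forall i, i <= a -> L i < L a.+1) -> ~ Up a (L a.+1) ->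
  minn (L a + n * ln a) (L a + m * lm a) < L a.+1 ->
  [/\ 0 < ln a.+1, 0 < lm a.+1,
      L a.+1 + n * ln a.+1 + m * lm a.+1 = maxn (L a + n * ln a) (L a + m * lm a)
    & if n * ln a < m * lm a
      then corner a.+1 a (lm a - lm a.+1) j (B - ln a.+1)
      else corner a.+1 k (A - lm a.+1) a (ln a - ln a.+1)].
Proof.
case=> ka ja /andP[ln0 lnm] /andP[lm0 lmn] /andP[A0 An] /andP[B0 Bm] ex ey above below.
set v := L a.+1; move=> Lv Uv minv.
have [p [q [p0 q0 e]]] := below v Uv (ltnW minv).
have split_n : n * ln a < m * lm a -> q < lm a /\ p < B.
  move=> lt; have emax : v + n * p + m * q = L a + m * lm a by rewrite e; lia.
  split; rewrite ltnNge; apply/negP => le.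
    have : m * lm a <= m * q by rewrite leq_mul2l le orbT.
    by have := Lv a (leqnn a); rewrite -/v; lia.
  have : n * B <= n * p by rewrite leq_mul2l le orbT.
  by have := Lv j (ltnW ja); rewrite -/v; lia.
have split_m : ~~ (n * ln a < m * lm a) -> q < A /\ p < ln a.
  move=> lt; have emax : v + n * p + m * q = L a + n * ln a by rewrite e; lia.
  split; rewrite ltnNge; apply/negP => le.
    have : m * A <= m * q by rewrite leq_mul2l le orbT.
    by have := Lv k (ltnW ka); rewrite -/v; lia.
  have : n * ln a <= n * p by rewrite leq_mul2l le orbT.
  by have := Lv a (leqnn a); rewrite -/v; lia.
have cop' : coprime m n by rewrite coprime_sym.
have pm : p < m by case: (boolP (n * ln a < m * lm a)) => [/split_n|/split_m]; lia.
have qn : q < n by case: (boolP (n * ln a < m * lm a)) => [/split_n|/split_m]; lia.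
have eqs : if n * ln a < m * lm a
    then v + n * p = L a + m * (lm a - q) /\ v + m * q = L j + n * (B - p)
    else v + n * p = L k + m * (A - q) /\ v + m * q = L a + n * (ln a - p).
  case: ifPn => [lt|nlt]; rewrite !mulnBr.
    have [qlt plt] := split_n lt.
    have : m * q <= m * lm a by rewrite leq_mul2l (ltnW qlt) orbT.
    have : n * p <= n * B by rewrite leq_mul2l (ltnW plt) orbT.
    by split; lia.
  have [qlt plt] := split_m nlt.
  have : m * q <= m * A by rewrite leq_mul2l (ltnW qlt) orbT.
  have : n * p <= n * ln a by rewrite leq_mul2l (ltnW plt) orbT.
  by split; lia.
have enp : ln a.+1 = p.
  apply: ell_eq => //; rewrite -/v.
    apply/UpP; case: ifP eqs => _ [-> _].
      by exists a, 0, (lm a - q); split=> //; lia.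
    by exists k, 0, (A - q); split; lia.
  move=> r /andP[r1 rp]; apply: (above _ (p - r) q); [lia|lia|].
  by rewrite -e mulnBr; have : n * r <= n * p by [rewrite leq_mul2l (ltnW rp) orbT]; lia.
have emq : lm a.+1 = q.
  apply: ell_eq => //; rewrite -/v.
    apply/UpP; case: ifP eqs => _ [_ ->].
      by exists j, (B - p), 0; split; lia.
    by exists a, (ln a - p), 0; split=> //; lia.
  move=> r /andP[r1 rq]; apply: (above _ p (q - r)); [lia|lia|].
  by rewrite -e mulnBr; have : m * r <= m * q by [rewrite leq_mul2l (ltnW rq) orbT]; lia.
have above' z p' q' : 0 < p' -> 0 < q' ->
    z + n * p' + m * q' = maxn (v + n * p) (v + m * q) -> ~ Up a.+1 z.
  move=> p'0 q'0 ez /UpS[Uz|[p1 [q1]]].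
    case: (leqP (v + n * p) (v + m * q)) => le.
      apply: (above z (p + p') q') Uz; [lia|lia|].
      by rewrite -e mulnDr; lia.
    apply: (above z p' (q + q')) Uz; [lia|lia|].
    by rewrite -e mulnDr; lia.
  rewrite -/v => ez1; case: (leqP (v + n * p) (v + m * q)) => le.
    have [||] := @rep_uniq n m 0 q (p1 + p') (q1 + q') cop qn.
    + have : m * (q1 + q') <= m * q by rewrite mulnDr; lia.
      by rewrite leq_mul2l; lia.
    + by rewrite !mulnDr; lia.
    by lia.
  have [||] := @rep_uniq m n 0 p (q1 + q') (p1 + p') cop' pm.
  + have : n * (p1 + p') <= n * p by rewrite mulnDr; lia.
    by rewrite leq_mul2l; lia.
  + by rewrite !mulnDr; lia.
  by lia.
have below' z : ~ Up a.+1 z -> minn (v + n * p) (v + m * q) <= z ->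
    exists p' q', [/\ 0 < p', 0 < q' &
      z + n * p' + m * q' = maxn (v + n * p) (v + m * q)].
  move=> Uz minz; have Uaz : ~ Up a z by move=> H; apply: Uz; apply/UpS; left.
  have vz : v < z by have : 0 < n * p /\ 0 < m * q by [rewrite !muln_gt0; lia]; lia.
  have [|p1 [q1 [p10 q10 ez]]] := below z Uaz; first lia.
  have : p < p1 \/ q < q1.
    case: (ltnP p p1) => [|pp]; first by left.
    case: (ltnP q q1) => [|qq]; first by right.
    case: Uz; apply/UpS; right; exists (p - p1), (q - q1).
    rewrite -/v !mulnBr.
    have : n * p1 <= n * p by rewrite leq_mul2l pp orbT.
    have : m * q1 <= m * q by rewrite leq_mul2l qq orbT.
    by lia.
  have zn : q < q1 -> z + n * p1 + m * (q1 - q) = v + n * p.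
    move=> lt; rewrite mulnBr; have : m * q <= m * q1 by rewrite leq_mul2l (ltnW lt) orbT.
    by lia.
  have zm : p < p1 -> z + n * (p1 - p) + m * q1 = v + m * q.
    move=> lt; rewrite mulnBr; have : n * p <= n * p1 by rewrite leq_mul2l (ltnW lt) orbT.
    by lia.
  have n0 : 0 < n * p1 by rewrite muln_gt0; lia.
  have m0 : 0 < m * q1 by rewrite muln_gt0; lia.
  case=> [lt|lt].
    exists (p1 - p), q1; split; [lia|lia|].
    by have := zm lt; move: (n * (p1 - p)) => x; lia.
  exists p1, (q1 - q); split; [lia|lia|].
  by have := zn lt; move: (m * (q1 - q)) => x; lia.
split; rewrite ?enp ?emq //.
have e0 : 0 < p < m by rewrite p0.
have e1 : 0 < q < n by rewrite q0.
case: ifPn eqs => [lt|nlt] [exn eyn].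
  have [qlt plt] := split_n lt.
  by split; rewrite ?enp ?emq //; lia.
have [qlt plt] := split_m nlt.
by split; rewrite ?enp ?emq //; lia.
Qed.

(** The triple [(i, p, q)] stands for the monomial [x^p y^q] times the [i]-th
    generator. *)
Definition weight_of (x : nat * nat * nat) := L x.1.1 + n * x.1.2 + m * x.2.

Record monomial_congr (E : nat * nat * nat -> nat * nat * nat -> Prop) : Prop :=
  MonomialCongr {
  mc_refl : forall x, E x x;
  mc_sym : forall x y, E x y -> E y x;
  mc_trans : forall x y z, E x y -> E y z -> E x z;
  mc_shift : forall i p q i' p' q' c d,
    E (i, p, q) (i', p', q') -> E (i, p + c, q + d) (i', p' + c, q' + d) }.

Implicit Types es E : nat * nat * nat -> nat * nat * nat -> Prop.

(** The relations [es] and the two corners at the last generator generate all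
    the relations between monomials of the same weight_of. *)
Definition connected a es k A j B := forall E, monomial_congr E ->
  (forall x y, es x y -> E x y) ->
  E (a, ln a, 0) (k, 0, A) -> E (a, 0, lm a) (j, B, 0) ->
  forall x y, x.1.1 <= a -> y.1.1 <= a -> weight_of x = weight_of y -> E x y.

Lemma connected_base : L 0 = n -> L 1 = m ->
  connected 1 (fun _ _ => False) 0 1 0 m.-1.
Proof.
move=> L0 L1 E [refl sym trans shift] _; have [-> ->] := ell_base L0 L1 => e1 e2.
(* Both generators are read as multiples of 1, with value 0. *)
pose rep P Q := if P is P'.+1 then (0, P', Q) else (1, 0, Q.-1).
pose cP (x : nat * nat * nat) := if x.1.1 == 0 then x.1.2.+1 else x.1.2.
pose cQ (x : nat * nat * nat) := if x.1.1 == 0 then x.2 else x.2.+1.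
have E_rep x : x.1.1 <= 1 -> E x (rep (cP x) (cQ x)).
  case: x => [[[|[|//]] p] q] _; rewrite /rep /cP /cQ /=; first exact: refl.
  case: p => [|p]; first exact: refl.
  by have := shift _ _ _ _ _ _ p q e1; rewrite !add0n !add1n.
have E_cross P Q : E (rep P (Q + n)) (rep (P + m) Q).
  have := shift _ _ _ _ _ _ P Q e2; rewrite !add0n => e2'.
  have := E_rep (1, P, n.-1 + Q) isT; rewrite /cP /cQ /=.
  have -> : (n.-1 + Q).+1 = Q + n by lia.
  have -> : rep (P + m) Q = (0, m.-1 + P, Q).
    by rewrite /rep; have -> : P + m = (m.-1 + P).+1 by lia.
  by move=> /sym r1; apply: (trans _ _ _ r1 e2').
have E_far d P Q : E (rep P (Q + d * n)) (rep (P + d * m) Q).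
  elim: d P Q => [|d IH] P Q; first by rewrite !mul0n !addn0; apply: refl.
  rewrite !mulSn addnA; apply: (trans _ _ _ (IH _ _)).
  by rewrite [m + _]addnC addnA; apply: E_cross.
have E_eq P Q P' Q' : Q <= Q' -> n * P + m * Q = n * P' + m * Q' ->
    E (rep P Q) (rep P' Q').
  move=> QQ e; have d : n %| m * (Q' - Q).
    by rewrite (_ : m * (Q' - Q) = n * P - n * P') ?dvdn_sub ?dvdn_mulr // mulnBr; lia.
  rewrite Gauss_dvdr // in d; have [c ec] := dvdnP d.
  have eP : n * P = n * (P' + c * m).
    have : m * Q' = m * Q + m * (c * n) by rewrite -ec -mulnDr subnKC.
    by rewrite mulnDr; nia.
  have {}eP : P = P' + c * m.
    by move/eqP: eP; rewrite eqn_mul2l => /orP[/eqP|/eqP//]; lia.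
  have -> : Q' = Q + c * n by lia.
  by rewrite eP; apply: sym.
move=> x y x1 y1 e; apply: (trans _ _ _ (E_rep _ x1)).
apply: (fun h => trans _ _ _ h (sym _ _ (E_rep _ y1))).
have wE z : z.1.1 <= 1 -> weight_of z = n * cP z + m * cQ z.
  by case: z => [[[|[|//]] p] q] _; rewrite /weight_of /cP /cQ /= ?L0 ?L1 !mulnS; lia.
rewrite !wE // in e; case: (leqP (cQ x) (cQ y)) => [le|/ltnW le]; first exact: E_eq.
exact/sym/E_eq.
Qed.

(** The corner that disappears is recovered from the two new ones, through the
    monomial of the new generator which has the same weight. *)
Lemma connected_step a k A j B es : corner a k A j B -> connected a es k A j B ->
  (forall i, i <= a -> L i < L a.+1) -> ~ Up a (L a.+1) ->
  minn (L a + n * ln a) (L a + m * lm a) < L a.+1 ->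
  if n * ln a < m * lm a
  then connected a.+1 (fun x y => es x y \/ x = (a, ln a, 0) /\ y = (k, 0, A))
    a (lm a - lm a.+1) j (B - ln a.+1)
  else connected a.+1 (fun x y => es x y \/ x = (a, 0, lm a) /\ y = (j, B, 0))
    k (A - lm a.+1) a (ln a - ln a.+1).
Proof.
move=> ca conn Lv Uv minv; have [p0 q0 ev split] := corner_split ca Lv Uv minv.
set p := ln a.+1 in p0 ev split *; set q := lm a.+1 in q0 ev split *.
(* In either case the old corners follow, and the new monomials with large
   exponents reduce to old ones; the others have a unique weight_of. *)
have finish E es' i1 r1 i2 r2 : monomial_congr E ->
    (forall x y, x.1.1 <= a -> y.1.1 <= a -> weight_of x = weight_of y -> E x y) ->
    i1 <= a -> i2 <= a -> q < n ->
    E (a.+1, p, 0) (i1, 0, r1) -> L a.+1 + n * p = L i1 + m * r1 ->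
    E (a.+1, 0, q) (i2, r2, 0) -> L a.+1 + m * q = L i2 + n * r2 ->
    forall x y, x.1.1 <= a.+1 -> y.1.1 <= a.+1 -> weight_of x = weight_of y -> E x y.
  case=> refl sym trans shift H i1a i2a qn e1 w1 e2 w2.
  have lower c d : p <= c \/ q <= d -> exists x,
      [/\ x.1.1 <= a, E (a.+1, c, d) x & weight_of x = weight_of (a.+1, c, d)].
    case=> le.
      exists (i1, c - p, r1 + d); split=> //.
        have := shift _ _ _ _ _ _ (c - p) d e1.
        by rewrite !add0n subnKC.
      rewrite /weight_of /= mulnDr; have -> : n * c = n * p + n * (c - p).
        by rewrite -mulnDr subnKC.
      by lia.
    exists (i2, r2 + c, d - q); split=> //.
      have := shift _ _ _ _ _ _ c (d - q) e2.
      by rewrite !add0n subnKC.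
    rewrite /weight_of /= mulnDr; have -> : m * d = m * q + m * (d - q).
      by rewrite -mulnDr subnKC.
    by lia.
  have Up_weight x : x.1.1 <= a -> Up a (weight_of x).
    by case: x => [[i c] d] ia; apply/UpP; exists i, c, d.
  have Up_large c d : Up a (weight_of (a.+1, c, d)) -> p <= c \/ q <= d.
    move=> U; case: (leqP p c) => [|cp]; first by left.
    case: (leqP q d) => [|dq]; first by right.
    case: (cor_above ca (p := p - c) (q := q - d) _ _ _ U); try lia.
    rewrite -ev /weight_of /= !mulnBr.
    have : n * c <= n * p by rewrite leq_mul2l (ltnW cp) orbT.
    have : m * d <= m * q by rewrite leq_mul2l (ltnW dq) orbT.
    by lia.
  have reduce x : x.1.1 <= a.+1 -> Up a (weight_of x) -> exists y,
      [/\ y.1.1 <= a, E x y & weight_of y = weight_of x].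
    case: x => [[i c] d] /=; rewrite leq_eqVlt => /orP[/eqP->|ia] U.
      by apply: lower; apply: Up_large.
    by exists (i, c, d); split=> //; apply: refl.
  move=> x y xa ya wxy; have [Ux|Ux] := pselect (Up a (weight_of x)).
    have [x' [x'a Exx' wx']] := reduce x xa Ux.
    have [|y' [y'a Eyy' wy']] := reduce y ya; first by rewrite -wxy.
    apply: (trans _ _ _ Exx').
    apply: (fun h => trans _ _ _ h (sym _ _ Eyy')).
    by apply: H; rewrite // wx' wy'.
  have new z : z.1.1 <= a.+1 -> weight_of z = weight_of x -> z.1.1 = a.+1 /\ z.2 < n.
    case: z => [[i c] d] /=; rewrite leq_eqVlt => /orP[/eqP-> wz|ia wz]; last first.
      by case: Ux; rewrite -wz; apply: Up_weight.
    split=> //; rewrite ltnNge; apply/negP => nd; case: Ux.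
    have [|z' [z'a _ wz']] := lower c d; first by right; lia.
    by rewrite -wz -wz'; apply: Up_weight.
  have [] := new x xa erefl; have [] := new y ya (esym wxy).
  case: x y {xa ya Ux} wxy {new} => [[i c] d] [[i' c'] d'] /= w ei' d'n ei dn.
  rewrite ei ei' in w *.
  have [-> ->] : c = c' /\ d = d'; last exact: refl.
  by apply: (rep_uniq cop) => //; move: w; rewrite /weight_of /=; lia.
case: ifPn split => [lt|nlt] c' E cE esE e1 e2; have [refl sym trans shift] := cE.
  have eB := cor_B c'; have eA := cor_A c'; have ja := cor_j ca.
  have H := conn E cE (fun x y h => esE x y (or_introl h)).
  apply: (finish E _ _ _ _ _ cE _ (leqnn a) (ltnW ja) _ e1 (cor_x c') e2 (cor_y c')).
  - exact: es.
  - apply: H; first by apply: esE; right.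
    have := shift _ _ _ _ _ _ 0 q e1; have := shift _ _ _ _ _ _ p 0 e2.
    rewrite !add0n !addn0 !subnK; [|lia|lia].
    by move=> h1 /sym h2; apply: (trans _ _ _ h2 h1).
  - by have := cor_lm c'; lia.
have eB := cor_B c'; have eA := cor_A c'; have ka := cor_k ca.
have H := conn E cE (fun x y h => esE x y (or_introl h)).
apply: (finish E _ _ _ _ _ cE _ (ltnW ka) (leqnn a) _ e1 (cor_x c') e2 (cor_y c')).
- exact: es.
- apply: H; last by apply: esE; right.
  have := shift _ _ _ _ _ _ 0 q e1; have := shift _ _ _ _ _ _ p 0 e2.
  rewrite !add0n !addn0 !subnK; [|lia|lia].
  by move=> /sym h1 h2; apply: (trans _ _ _ h1 h2).
- by have := cor_lm c'; lia.
Qed.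

End Staircase.

(** * Differential forms along a cusp *)

Lemma min_opt_None (P : nat -> Prop) : min_opt P = None <-> forall k, ~ P k.
Proof.
rewrite /min_opt; case: pselect => [ex|nex]; split=> // H.
  by exfalso; case: ex => k /asboolP /H.
by move=> k Pk; apply: nex; exists k; apply/asboolP.
Qed.

Lemma min_opt_Some (P : nat -> Prop) k :
  min_opt P = Some k <-> P k /\ forall i, P i -> (k <= i)%N.
Proof.
split=> [|[Pk minP]]; last exact: min_optP.
rewrite /min_opt; case: pselect => // ex [<-].
by case: ex_minnP => i /asboolP Pi mini; split=> // j Pj; apply: mini; apply/asboolP.
Qed.

Section Orders.
Variable R : realType.
Implicit Types (a : fps1 R) (h : fps2 R).

Lemma ser_ord_None a : ser_ord a = None <-> a = 0.
Proof.
rewrite /ser_ord min_opt_None; split=> [H|-> k /=]; last by rewrite eqxx.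
by apply/funext => k; apply/eqP/negbNE/negP; apply: H.
Qed.

Lemma ser_ord_Some a v : ser_ord a = Some v <-> vanish v a /\ a v != 0.
Proof.
rewrite /ser_ord min_opt_Some; split=> -[H1 H2]; split=> //.
  by move=> k kv; apply/eqP/negbNE/negP => /H2; rewrite leqNgt kv.
by move=> i ai; rewrite leqNgt; apply/negP => /H1 ai0; move: ai; rewrite /= ai0 eqxx.
Qed.

Variables n m : nat.

Lemma mono_ord_None h : mono_ord n m h = None <-> forall d, wt n m d h.
Proof.
rewrite /mono_ord min_opt_None; split=> [H d i j _|H k [i [j [hij _]]]].
  by apply/eqP/negbNE/negP => hij; apply: (H (n * i + m * j)%N); exists i, j.
by move/eqP: hij; apply; apply: (H (n * i + m * j).+1).
Qed.

Lemma mono_ord_Some h v :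
  mono_ord n m h = Some v <-> wt n m v h /\ ~ wt n m v.+1 h.
Proof.
rewrite /mono_ord min_opt_Some; split=> [[[i [j [hij ->]]] H]|[H1 H2]].
  split=> [k l kl|H3]; last by move: hij; rewrite H3 ?eqxx.
  by apply/eqP/negbNE/negP => hkl; move: kl; rewrite ltnNge H //; exists k, l.
split; last first.
  move=> k [i [j [hij ->]]]; rewrite leqNgt; apply/negP => /H1 h0.
  by move: hij; rewrite h0 eqxx.
apply: contrapT => nex; apply: H2 => i j; rewrite ltnS leq_eqVlt.
move=> /orP[/eqP e|]; last exact: H1.
by apply/eqP/negbNE/negP => hij; apply: nex; exists i, j; rewrite e.
Qed.

Definition wt_form d (a b : fps2 R) := wt n m d (ser_x R * a) /\ wt n m d (ser_y R * b).

Lemma mono_ord_formP (a b : fps2 R) v :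
  mono_ord_form n m a b = Some v <-> wt_form v a b /\ ~ wt_form v.+1 a b.
Proof.
rewrite /mono_ord_form /wt_form.
case ea: mono_ord => [u|]; case eb: mono_ord => [w|] /=.
- move: ea eb => /mono_ord_Some[a1 a2] /mono_ord_Some[b1 b2].
  have uP d : wt n m d (ser_x R * a) <-> (d <= u)%N.
    split=> [wd|du]; last exact: wt_le a1.
    by rewrite leqNgt; apply/negP => ud; apply: a2; apply: wt_le wd.
  have wP d : wt n m d (ser_y R * b) <-> (d <= w)%N.
    split=> [wd|du]; last exact: wt_le b1.
    by rewrite leqNgt; apply/negP => ud; apply: b2; apply: wt_le wd.
  rewrite !uP !wP; split=> [[<-]|[[vu vw] nv]]; first by split; lia.
  by congr Some; case: (leqP u w) => uw; case: (leqP v.+1 u) => h; lia.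
- move: ea eb => /mono_ord_Some[a1 a2] /mono_ord_None b0.
  split=> [[<-]|[[a3 _] a4]]; first by split=> // -[].
  congr Some; apply/eqP; rewrite eqn_leq; apply/andP; split; rewrite leqNgt.
    by apply/negP => vu; apply: a4; split=> //; apply: wt_le a1.
  by apply/negP => uv; apply: a2; apply: wt_le a3.
- move: ea eb => /mono_ord_None a0 /mono_ord_Some[b1 b2].
  split=> [[<-]|[[_ b3] b4]]; first by split=> // -[].
  congr Some; apply/eqP; rewrite eqn_leq; apply/andP; split; rewrite leqNgt.
    by apply/negP => vw; apply: b4; split=> //; apply: wt_le b1.
  by apply/negP => wv; apply: b2; apply: wt_le b3.
move: ea eb => /mono_ord_None a0 /mono_ord_None b0.
by split=> // -[_ []]; split.
Qed.

End Orders.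

Section Forms.
Variable R : realType.
Implicit Types (w : form1 R) (f g : germ R).

Lemma germD f g : germ_val (f + g) = germ_val f + germ_val g. Proof. by []. Qed.
Lemma germN f : germ_val (- f) = - germ_val f. Proof. by []. Qed.
Lemma germM f g : germ_val (f * g) = germ_val f * germ_val g. Proof. by []. Qed.
Lemma germ0 : germ_val (0 : germ R) = 0. Proof. by []. Qed.
Lemma germ1 : germ_val (1 : germ R) = 1. Proof. by []. Qed.

Lemma germ_sum (I : Type) (r : seq I) (P : pred I) (F : I -> germ R) :
  germ_val (\sum_(i <- r | P i) F i) = \sum_(i <- r | P i) germ_val (F i).
Proof. exact: (big_morph _ germD germ0). Qed.

Definition wedge w w' : germ R := w 0 0 * w' 0 1 - w 0 1 * w' 0 0.

Lemma wedgeD w w1 w2 : wedge w (w1 + w2) = wedge w w1 + wedge w w2.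
Proof. by rewrite /wedge !mxE; ring. Qed.
Lemma wedgeZ g w w' : wedge w (g *: w') = g * wedge w w'.
Proof. by rewrite /wedge !mxE; ring. Qed.
Lemma wedgeC w w' : wedge w w' = - wedge w' w.
Proof. by rewrite /wedge; ring. Qed.
Lemma wedgeww w : wedge w w = 0.
Proof. by rewrite /wedge; ring. Qed.
Lemma wedge0 w : wedge w 0 = 0.
Proof. by rewrite /wedge !mxE; ring. Qed.
Lemma wedgeN w w' : wedge w (- w') = - wedge w w'.
Proof. by rewrite -scaleN1r wedgeZ mulN1r. Qed.
Lemma wedgeB w w1 w2 : wedge w (w1 - w2) = wedge w w1 - wedge w w2.
Proof. by rewrite wedgeD wedgeN. Qed.
Lemma wedge_sum w (I : Type) (r : seq I) (P : pred I) (F : I -> form1 R) :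
  wedge w (\sum_(i <- r | P i) F i) = \sum_(i <- r | P i) wedge w (F i).
Proof.
exact: (big_morph _ (wedgeD w) (wedge0 w)).
Qed.

Lemma wedge_cramer w w1 w2 :
  wedge w1 w2 *: w = wedge w w2 *: w1 + wedge w1 w *: w2.
Proof.
apply/rowP => i; rewrite !mxE /wedge.
have [->|->] : i = 0 \/ i = 1 by case: i => [[|[|//]] p]; [left|right]; apply: val_inj.
  by ring.
by ring.
Qed.

Lemma complex_integral (z w : R[i]) : z * w = 0 -> z = 0 \/ w = 0.
Proof. by move/eqP; rewrite mulf_eq0 => /orP[/eqP->|/eqP->]; [left|right]. Qed.

Lemma fps1_integral (a b : fps1 R) : a * b = 0 -> a = 0 \/ b = 0.
Proof. exact: fps_integral complex_integral _ _. Qed.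

Lemma germ_integral f g : f * g = 0 -> f = 0 \/ g = 0.
Proof.
move=> /(congr1 (@germ_val R)); rewrite germM.
move=> /(fps_integral fps1_integral)[] e; [left|right]; exact: val_inj.
Qed.

Lemma germ_unit g : germ_val g 0%N 0%N != 0 -> exists g' : germ R, g * g' = 1.
Proof.
move=> /(conv2_inv (germP g))[g' cg' e]; exists (Germ cg').
exact: val_inj.
Qed.

End Forms.

Section AlongCusp.
Variables (R : realType) (n m : nat) (b : fps1 R).
Hypothesis Cb : cusp n m b.
Let n2 := cusp_n2 Cb.
Let nm := cusp_nm Cb.
Let cop := cusp_coprime Cb.
Let cb := cusp_convergent Cb.
Let vb := cusp_vanish Cb.
Let bm := cusp_lead Cb.
Implicit Types (w : form1 R) (f g : germ R).
Local Notation wt := (@wt R[i] n m).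
Local Notation along := (along n b).
Local Notation phi := (tpow R n, b).
Local Notation t1 := (tpow R 1).

Let t0 : tpow R n 0%N = 0.
Proof. by rewrite /tpow; case: n n2. Qed.

Let b0 : b 0%N = 0.
Proof. by rewrite vb //; lia. Qed.

(** The pullback of [w] as a multiple of [dt / t]: its order is the value of [w]
    along the curve. *)
Definition theta w : fps1 R := t1 * pullback_arc phi w.

Lemma thetaE w : theta w = along (w 0 0) * (t1 * ddt (tpow R n))
  + along (w 0 1) * (t1 * ddt b).
Proof. by rewrite /theta /pullback_arc /=; rewrite /along; ring. Qed.

Lemma thetaD w w' : theta (w + w') = theta w + theta w'.
Proof. by rewrite !thetaE !mxE !germD !(alongD Cb); ring. Qed.

Lemma thetaZ g w : theta (g *: w) = along g * theta w.
Proof. by rewrite !thetaE !mxE !germM !(alongM Cb); ring. Qed.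

Lemma theta_0 : theta 0 = 0.
Proof. by rewrite -(scale0r 0) thetaZ germ0 (along0 Cb) mul0r. Qed.

Lemma thetaN w : theta (- w) = - theta w.
Proof.
by apply/eqP; rewrite -subr_eq0 opprK -thetaD addNr theta_0.
Qed.

Lemma thetaB w w' : theta (w - w') = theta w - theta w'.
Proof. by rewrite thetaD thetaN. Qed.

Lemma theta0E w : theta w 0%N = 0.
Proof. by rewrite /theta fpsME big_ord1 /tpow mul0r. Qed.

Lemma thetaSE w k : theta w k.+1 = pullback_arc phi w k.
Proof. by rewrite -add1n /theta tpowME. Qed.

Lemma theta_eq0 w : theta w = 0 <-> invariant_curve phi w.
Proof.
rewrite /invariant_curve /nuC; case e: ser_ord => [v|] /=; split=> // H.
  have /ser_ord_Some[_] := e; rewrite -thetaSE H fps0E eqxx //.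
apply/funext => -[|k]; first exact: theta0E.
by rewrite thetaSE; have /ser_ord_None -> := e.
Qed.

Lemma theta_value w v : nuC phi w = Some v <-> vanish v (theta w) /\ theta w v != 0.
Proof.
rewrite /nuC; split=> [|[H1 H2]].
  case e: ser_ord => [u|] //= [<-]; have /ser_ord_Some[vu u0] := e.
  rewrite thetaSE; split=> // -[|k] ku; first exact: theta0E.
  by rewrite thetaSE vu.
case: v H1 H2 => [|v] H1 H2; first by move: H2; rewrite theta0E eqxx.
rewrite (_ : ser_ord _ = Some v) //; apply/ser_ord_Some; rewrite -thetaSE; split=> //.
by move=> k kv; rewrite -thetaSE H1.
Qed.

Lemma theta_convergent w : convergent1 (pullback_arc phi w).
Proof.
have ct := @convergent1_tpow R n.
by apply: convergent1D; apply: convergent1M; rewrite /=;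
  do ?[exact: convergent1_ddt | apply: convergent1_comp21; rewrite ?germP].
Qed.

(** Saito's criterion: the coefficients in Cramer's rule vanish along the curve,
    hence are multiples of [wedge w1 w2], which generates the ideal. *)
Lemma saito_criterion w1 w2 :
  invariant_curve phi w1 -> invariant_curve phi w2 ->
  germ_val (wedge w1 w2) 0%N n != 0 -> saito_basis phi w1 w2.
Proof.
move=> i1 i2 Gn; pose t' := ddt (tpow R n).
have along_wedge w w' : theta w = 0 -> theta w' = 0 -> along (wedge w w') = 0.
  rewrite !thetaE => e e'.
  have : along (wedge w w') * (t1 * t') = 0.
    rewrite /wedge germD germN !germM (alongD Cb) (alongN Cb) !(alongM Cb).
    set a0 := along (w 0 0) in e *; set a1 := along (w 0 1) in e *.
    set c0 := along (w' 0 0) in e' *; set c1 := along (w' 0 1) in e' *.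
    transitivity (c1 * (a0 * (t1 * t') + a1 * (t1 * ddt b))
      - a1 * (c0 * (t1 * t') + c1 * (t1 * ddt b))); first by ring.
    by rewrite e e' !mulr0 subrr.
  case/fps1_integral => // /fps1_integral[] e0.
    by have := congr1 (fun a : fps1 R => a 1%N) e0; rewrite fps0E /tpow eqxx => /eqP; rewrite oner_eq0.
  have := congr1 (fun a : fps1 R => a n.-1) e0; rewrite fps0E /t' /ddt /tpow.
  by rewrite prednK ?eqxx; [move/eqP; rewrite pnatr_eq0; lia|lia].
have /theta_eq0 e1 := i1; have /theta_eq0 e2 := i2.
have G0 : wedge w1 w2 <> 0 by move=> G0; move: Gn; rewrite G0 germ0 eqxx.
have eG := along_wedge _ _ e1 e2.
split=> // [w /theta_eq0 e|g h gh0].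
  have [q1 cq1 eq1] := ideal_principal Cb (germP _) (germP _) eG (along_wedge _ _ e e2) Gn.
  have [q2 cq2 eq2] := ideal_principal Cb (germP _) (germP _) eG (along_wedge _ _ e1 e) Gn.
  exists (Germ cq1), (Germ cq2).
  have E1 : wedge w w2 = wedge w1 w2 * Germ cq1 by apply: val_inj; rewrite mulrC.
  have E2 : wedge w1 w = wedge w1 w2 * Germ cq2 by apply: val_inj; rewrite mulrC.
  have := wedge_cramer w w1 w2; rewrite E1 E2 -!scalerA -scalerDr => E.
  apply/rowP => i; have := congr1 (fun v : form1 R => v 0 i) E; rewrite mxE [RHS]mxE.
  move=> /eqP; rewrite -subr_eq0 -mulrBr => /eqP /germ_integral[] // /eqP.
  by rewrite subr_eq0 => /eqP.
have Hg : g * wedge w1 w2 = 0.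
  have := congr1 (wedge w2) gh0; rewrite wedgeD !wedgeZ wedgeww mulr0 addr0 wedgeC mulrN.
  by rewrite wedge0 => /eqP; rewrite oppr_eq0 => /eqP.
have Hh : h * wedge w1 w2 = 0.
  have := congr1 (wedge w1) gh0; rewrite wedgeD !wedgeZ wedgeww mulr0 add0r.
  by rewrite wedge0.
by split; [case/germ_integral: Hg|case/germ_integral: Hh].
Qed.

End AlongCusp.

(** * Standard bases *)

Section StandardBasis.
Variables (R : realType) (n m : nat) (b : fps1 R) (lam : seq nat).
Hypothesis Cb : cusp n m b.
Let n2 := cusp_n2 Cb.
Let nm := cusp_nm Cb.
Let cop := cusp_coprime Cb.
Implicit Types (w : form1 R) (f g : nat -> germ R) (om : nat -> form1 R).
Local Notation wt d h := (@wt R[i] n m d (h : fps2 R)).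
Local Notation along := (along n b).
Local Notation theta := (theta n b).
Local Notation L a := (nth 0%N lam a).
Local Notation Up := (Lambda_upto n m lam).

Definition gmono p q : germ R := Germ (conv2_mono m b p q).
Definition gconst (c : R[i]) : germ R := Germ (conv2_const c).

Lemma gmonoM p q p' q' : gmono p q * gmono p' q' = gmono (p + p')%N (q + q')%N.
Proof. by apply: val_inj; exact: monoM. Qed.

Lemma gmono_wt p q : wt (n * p + m * q) (gmono p q).
Proof. exact: mono_wt. Qed.
Arguments gmono_wt : clear implicits.

Definition comb a om f : form1 R := \sum_(i < a.+1) f i *: om i.

Lemma combD a om f g : comb a om (fun i => f i + g i) = comb a om f + comb a om g.
Proof. by rewrite -big_split; apply: eq_bigr => i _; rewrite scalerDl. Qed.

Lemma combZ a om (h : germ R) f : comb a om (fun i => h * f i) = h *: comb a om f.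
Proof. by rewrite scaler_sumr; apply: eq_bigr => i _; rewrite scalerA. Qed.

Lemma comb0 a om : comb a om (fun=> 0) = 0.
Proof. by apply: big1 => i _; rewrite scale0r. Qed.

Lemma comb1 a om k (h : germ R) : (k <= a)%N ->
  comb a om (fun i => if i == k then h else 0) = h *: om k.
Proof.
rewrite -ltnS => ka; rewrite /comb (bigD1 (Ordinal ka)) //= eqxx big1 ?addr0 //.
move=> i ik; case: eqP => [ei|]; last by rewrite scale0r.
by case/eqP: ik; apply: val_inj.
Qed.

Lemma theta_comb a om f : theta (comb a om f) = \sum_(i < a.+1) along (f i) * theta (om i).
Proof.
rewrite /comb; apply: (etrans (big_morph _ (thetaD Cb) (theta_0 Cb) _ _ _)).
by apply: eq_bigr => i _; rewrite (thetaZ Cb).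
Qed.

Definition lead a om := forall i, (i <= a)%N ->
  vanish (L i) (theta (om i)) /\ theta (om i) (L i) = 1.

(** Coefficients of weight at least [d], the generator [om i] counting for its
    value [L i]. *)
Definition heavy d f := forall i, wt (d - L i) (f i).

Lemma heavy_le d e f : (d <= e)%N -> heavy e f -> heavy d f.
Proof. by move=> de hf i; apply: wt_le (hf i); rewrite leq_sub2r. Qed.

Lemma heavyD d f g : heavy d f -> heavy d g -> heavy d (fun i => f i + g i).
Proof. by move=> hf hg i; rewrite germD; apply: wtD. Qed.

Lemma heavyM d e (h : germ R) f : wt e h -> heavy d f -> heavy (e + d) (fun i => h * f i).
Proof. by move=> wh hf i; rewrite germM; apply: wt_le (wtM wh (hf i)); lia. Qed.

Lemma heavy1 d k (h : germ R) : wt (d - L k) h -> heavy d (fun i => if i == k then h else 0).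
Proof. by move=> wh i; case: eqP => [->|]. Qed.

Lemma comb_vanish a om d f : lead a om -> heavy d f -> vanish d (theta (comb a om f)).
Proof.
move=> le hf; rewrite theta_comb; apply: (filt_sum (vanish_filtration _)) => i _.
have [li _] := le i (ltn_ord i).
apply: vanish_le (vanishM (along_wt Cb (hf i)) li); lia.
Qed.

Lemma theta_mono a om i p q : lead a om -> (i <= a)%N ->
  vanish (L i + n * p + m * q) (theta (gmono p q *: om i)) /\
  theta (gmono p q *: om i) (L i + n * p + m * q)%N = 1.
Proof.
move=> le ia; have [li l1] := le i ia.
have vp : vanish (n * p + m * q) (along (gmono p q)).
  by apply: (along_wt Cb); apply: gmono_wt.
have -> : (L i + n * p + m * q = n * p + m * q + L i)%N by lia.
rewrite (thetaZ Cb); split; first exact: vanishM.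
by rewrite lead_mul // l1 mulr1 (along_mono_lead Cb).
Qed.

Lemma theta_const c w : theta (gconst c *: w) = fps_const c * theta w.
Proof. by rewrite (thetaZ Cb) (along_const Cb). Qed.

Lemma wt_const d c (h : germ R) : wt d h -> wt d (gconst c * h).
Proof. by move=> wh; rewrite germM; apply: wtMr. Qed.

(** ** Reduction *)

Lemma convergent1_shift (a : fps1 R) N :
  convergent1 a -> convergent1 (fun k => a (N + k)%N : R[i]).
Proof.
move=> /convergent1P[M [S [M0 S1 ba]]]; apply/convergent1P.
have S0 : 0 <= S by lra.
exists (M * S ^+ N), S; split; rewrite ?mulr_ge0 ?exprn_ge0 // => k.
by apply: le_trans (ba _) _; rewrite exprD mulrA.
Qed.

Lemma tpow_factor (a : fps1 R) N : vanish N a ->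
  tpow R N * (fun k => a (N + k)%N) = a.
Proof.
move=> va; apply/funext => k; have [kN|Nk] := ltnP k N.
  rewrite [RHS]va //; apply: (vanishM (@tpow_vanish _ N) (N := 0)) => //.
  by rewrite addn0.
by rewrite -(subnKC Nk) tpowME.
Qed.

(** Beyond the conductor every convergent series is a function along the curve,
    so a multiple of the first generator, whose pullback is [t^n dt/t], has the
    same pullback as [w]. *)
Lemma theta_lift a om w D : theta (om 0%N) = tpow R n -> L 0 = n ->
  (n * m + n <= D)%N -> vanish D (theta w) ->
  exists2 f, heavy D f & theta (w - comb a om f) = 0.
Proof.
move=> om0 L0 nmD vw; pose al : fps1 R := fun k => theta w (n + k)%N.
have eal : tpow R n * al = theta w.
  by apply: tpow_factor; apply: vanish_le vw; lia.
have cal : convergent1 al.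
  apply: convergent1_shift; apply: convergent1M; first exact: convergent1_tpow.
  exact: (theta_convergent Cb).
have [||h [ch wh eh]] := @lift_series _ _ _ _ Cb al (D - n) cal.
- lia.
- by move=> k kD; apply: vw; lia.
exists (fun i => if i == 0%N then Germ ch else 0).
  by apply: heavy1; rewrite L0.
by rewrite comb1 // (thetaB Cb) (thetaZ Cb) om0 -/along /= eh mulrC eal subrr.
Qed.

(** Subtracting multiples of the generators removes leading terms as long as
    the value lies in [Lambda_a]; beyond the conductor everything is removed at
    once. *)
Lemma reduction a om w D : lead a om -> theta (om 0%N) = tpow R n -> L 0 = n ->
  vanish D (theta w) ->
  exists2 f, heavy D f &
    let w' := w - comb a om f in
    theta w' = 0 \/
    exists v, [/\ (D <= v)%N, ~ Up a v, vanish v (theta w') & theta w' v != 0].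
Proof.
move=> le om0 L0; pose N := (D + (n * m + n))%N.
suff H k : forall D' w, (D <= D')%N -> (N <= D' + k)%N -> vanish D' (theta w) ->
    exists2 f, heavy D f & let w' := w - comb a om f in
    theta w' = 0 \/
    exists v, [/\ (D <= v)%N, ~ Up a v, vanish v (theta w') & theta w' v != 0].
  by move=> vw; apply: (H N D w) => //; apply: leq_addl.
elim: k => [|k IH] D' {}w DD' ND' vw.
  have [|f hf ef] := @theta_lift a om w D' om0 L0 _ vw.
    by rewrite addn0 in ND'; apply: leq_trans ND'; apply: leq_addl.
  by exists f; [apply: heavy_le hf|left].
have [w0|w0] := eqVneq (theta w D') 0.
  apply: (IH D'.+1); [exact: leqW|by rewrite addSnnS|].
  by move=> i; rewrite ltnS leq_eqVlt => /orP[/eqP->|/vw].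
have [/UpP[i [p [q [ia eD]]]]|nU] := pselect (Up a D'); last first.
  exists (fun=> 0); first by move=> i k' j _.
  by rewrite comb0 subr0; right; exists D'.
have [vm m1] := theta_mono p q le ia; rewrite -eD in vm m1.
pose h := gconst (theta w D') * gmono p q.
have [|||f hf Hf] := IH D'.+1 (w - h *: om i).
- exact: leqW.
- by rewrite addSnnS.
- move=> j jD; rewrite (thetaB Cb) /h -scalerA theta_const fpsDE fpsNE fps_constME.
  move: jD; rewrite ltnS leq_eqVlt => /orP[/eqP->|jD]; first by rewrite m1 mulr1 subrr.
  by rewrite vw // vm // mulr0 subrr.
exists (fun j => (if j == i then h else 0) + f j).
  apply: heavyD => //; apply: heavy1; apply: wt_const.
  by apply: (wt_le _ (gmono_wt p q)); lia.
rewrite (combD a om _ f).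
by rewrite (comb1 om h ia) opprD addrA.
Qed.

(** ** Values *)

(** Combinations of weight at least [d], up to forms of value at least [v0]; the
    latter absorb the corners that have not been given a generator. *)
Definition approx v0 a om d w :=
  exists2 f, heavy d f & vanish v0 (theta (w - comb a om f)).

Lemma approxD v0 a om d w w' :
  approx v0 a om d w -> approx v0 a om d w' -> approx v0 a om d (w + w').
Proof.
move=> [f hf vf] [g hg vg]; exists (fun i => f i + g i); first exact: heavyD.
rewrite (combD a om f g).
rewrite opprD.
rewrite addrACA.
rewrite (thetaD Cb).
exact: (vanishD vf vg).
Qed.

Lemma approxM v0 a om d e (h : germ R) w :
  wt e h -> approx v0 a om d w -> approx v0 a om (e + d) (h *: w).
Proof.
move=> wh [f hf vf]; exists (fun i => h * f i); first exact: heavyM.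
rewrite combZ -scalerBr (thetaZ Cb).
exact: (vanishM (M := 0) _ vf).
Qed.

Lemma approxN v0 a om d w : approx v0 a om d w -> approx v0 a om d (- w).
Proof. by move=> /(approxM (wt0 (germ_val (-1)))); rewrite add0n scaleN1r. Qed.

Lemma approx_le v0 a om d e w : (d <= e)%N -> approx v0 a om e w -> approx v0 a om d w.
Proof. by move=> de [f hf vf]; exists f => //; apply: heavy_le hf. Qed.

Lemma approx0 v0 a om d : approx v0 a om d 0.
Proof.
exists (fun=> 0); first by move=> i k j _.
by rewrite comb0 subrr (theta_0 Cb).
Qed.

Lemma approx_sum v0 a om d (I : Type) (r : seq I) (P : pred I) (F : I -> form1 R) :
  (forall i, P i -> approx v0 a om d (F i)) -> approx v0 a om d (\sum_(i <- r | P i) F i).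
Proof.
move=> HF; elim/big_rec: _ => [|i w Pi Hw]; first exact: approx0.
exact: (approxD (HF i Pi) Hw).
Qed.

Lemma approx1 v0 a om d i (h : germ R) : (i <= a)%N -> wt (d - L i) h ->
  approx v0 a om d (h *: om i).
Proof.
move=> ia wh; exists (fun j => if j == i then h else 0); first exact: heavy1.
by rewrite comb1 // subrr (theta_0 Cb).
Qed.

Lemma approx_vanish v0 a om d w : lead a om -> approx v0 a om d w ->
  vanish (minn d v0) (theta w).
Proof.
move=> le [f hf vf]; rewrite -(subrK (comb a om f) w) (thetaD Cb).
apply: vanishD; first by apply: vanish_le vf; apply: geq_minr.
by apply: vanish_le (comb_vanish le hf); apply: geq_minl.
Qed.

Definition monomial_form om (x : nat * nat * nat) : form1 R := gmono x.1.2 x.2 *: om x.1.1.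

(** If both corners hold up to value [v0], then all the monomials of a given
    weight agree up to heavier terms, so a combination can only have a value
    outside [Lambda_a] from [v0] on. *)
Lemma small_values a om k A j B es v0 w v :
  lead a om -> connected n m lam a es k A j B ->
  (forall x y, es x y -> weight_of n m lam x = weight_of n m lam y /\
    approx v0 a om (weight_of n m lam x).+1 (monomial_form om x - monomial_form om y)) ->
  (L a + n * ell n m lam n a = L k + m * A)%N ->
  (L a + m * ell n m lam m a = L j + n * B)%N ->
  approx v0 a om (L a + n * ell n m lam n a).+1
    (monomial_form om (a, ell n m lam n a, 0%N) - monomial_form om (k, 0%N, A)) ->
  approx v0 a om (L a + m * ell n m lam m a).+1
    (monomial_form om (a, 0%N, ell n m lam m a) - monomial_form om (j, B, 0%N)) ->
  (exists f, w = comb a om f) ->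
  vanish v (theta w) -> theta w v != 0 -> Up a v \/ (v0 <= v)%N.
Proof.
move=> le conn esP ex ey cx cy [f0 wE] vw wv.
pose wgt := weight_of n m lam.
pose E x y := wgt x = wgt y /\ approx v0 a om (wgt x).+1 (monomial_form om x - monomial_form om y).
have cE : monomial_congr E.
  split.
  - by move=> x; split; [|rewrite subrr; apply: approx0].
  - move=> x y [e H]; split; first by rewrite e.
    by rewrite -e -opprB; apply: (approxN H).
  - move=> x y z [e H] [e' H']; split; first by rewrite e.
    by rewrite -(subrKA (monomial_form om y)); rewrite -e in H'; apply: (approxD H H').
  move=> i p q i' p' q' c d [e H]; split.
    by move: e; rewrite /wgt /weight_of /= !mulnDr; lia.
  have -> : monomial_form om (i, p + c, q + d)%N - monomial_form om (i', p' + c, q' + d)%N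
      = gmono c d *: (monomial_form om (i, p, q) - monomial_form om (i', p', q')).
    rewrite /monomial_form /= scalerBr !scalerA !gmonoM.
    by rewrite [(c + p)%N]addnC [(d + q)%N]addnC [(c + p')%N]addnC [(d + q')%N]addnC.
  apply: (approx_le _ (approxM (gmono_wt c d) H)).
  by rewrite /wgt /weight_of /= !mulnDr; lia.
have EE : forall x y, (x.1.1 <= a)%N -> (y.1.1 <= a)%N -> wgt x = wgt y -> E x y.
  apply: (conn E cE).
  - by move=> x y /esP.
  - split; rewrite /wgt /weight_of /= ?muln0 ?addn0; first exact: ex.
    exact: cx.
  - split; rewrite /wgt /weight_of /= ?muln0 ?addn0; first exact: ey.
    exact: cy.
suff H d : (d <= v0)%N -> approx v0 a om d w \/ Up a v.
  have [//|Hv|] := H v0; last by left.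
  right; rewrite leqNgt; apply/negP => vv0.
  have := approx_vanish le Hv; rewrite minnn => /(_ v vv0) w0.
  by move: wv; rewrite w0 eqxx.
elim: d => [|d IH] dv0.
  left; exists f0; first by move=> i k' j'; rewrite sub0n.
  by rewrite wE subrr (theta_0 Cb).
have [[f hf vf]|] := IH (ltnW dv0); last by right.
(* The part of weight d is a combination of monomials of weight d. *)
pose c i p q := germ_val (f i) p q * b m ^+ q.
pose F i : germ R := \sum_(p < (d - L i).+1)
  \sum_(q < (d - L i).+1 | (n * p + m * q == d - L i)%N) gconst (c i p q) * gmono p q.
have FE i : germ_val (F i) = \sum_(p < (d - L i).+1)
    \sum_(q < (d - L i).+1 | (n * p + m * q == d - L i)%N) const2 (c i p q) * mono m b p q.
  by rewrite germ_sum; apply: eq_bigr => p _; rewrite germ_sum.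
pose G := \sum_(i < a.+1 | (L i <= d)%N) F i *: om i.
have rest : approx v0 a om d.+1 (w - G).
  have -> : w - G = (w - comb a om f) + (comb a om f - G) by rewrite addrA subrK.
  apply: approxD.
    exists (fun=> 0); first by move=> i k' j' _.
    by rewrite comb0 subr0; apply: vanish_le vf.
  rewrite /comb /G [X in _ - X]big_mkcond -sumrB; apply: approx_sum => i _.
  case: ifPn => Lid; last first.
    by rewrite subr0; apply: approx1; [rewrite -ltnS|move=> k' j' h; lia].
  rewrite -scalerBl; apply: approx1; first by rewrite -ltnS.
  rewrite subSn // germD germN FE; exact: (wt_graded Cb (hf i)).
have [/UpP[i0 [p0 [q0 [i0a ed]]]]|nU] := pselect (Up a d); last first.
  left; suff G0 : G = 0 by rewrite -[w]subr0 -G0.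
  rewrite /G big1 // => i Lid; rewrite /F big1 ?scale0r // => p _.
  rewrite big1 // => q /eqP epq; case: nU; apply/UpP.
  by exists i, p, q; split; [rewrite -ltnS|lia].
pose z := (i0, p0, q0); have [zv z1] := theta_mono p0 q0 le i0a; rewrite -ed in zv z1.
(* All these monomials are equivalent to a single one. *)
have [C HC] : exists C : R[i], approx v0 a om d.+1 (G - gconst C *: monomial_form om z).
  pose mult w' := exists C : R[i], approx v0 a om d.+1 (w' - gconst C *: monomial_form om z).
  have mult0 : mult 0.
    exists 0; rewrite (_ : gconst 0 = 0) ?scale0r ?subr0; first exact: approx0.
    by apply: val_inj; rewrite /= rmorph0.
  have multD w1 w2 : mult w1 -> mult w2 -> mult (w1 + w2).
    move=> [C1 H1] [C2 H2]; exists (C1 + C2).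
    have -> : gconst (C1 + C2) = gconst C1 + gconst C2.
      by apply: val_inj; rewrite /= rmorphD.
    by rewrite scalerDl opprD addrACA; apply: (approxD H1 H2).
  rewrite -/(mult G) /G; apply: (big_ind mult mult0 multD) => i Lid.
  rewrite /F scaler_suml; apply: (big_ind mult mult0 multD) => p _.
  rewrite scaler_suml; apply: (big_ind mult mult0 multD) => q /eqP epq.
  exists (c i p q); rewrite -scalerA -scalerBr.
  have ia : (i <= a)%N by rewrite -ltnS.
  have wi : wgt (i : nat, p : nat, q : nat) = d by rewrite /wgt /weight_of /=; lia.
  have [|_] := EE (i : nat, p : nat, q : nat) z ia i0a.
    by rewrite wi ed.
  by rewrite wi => /(approxM (wt0 (germ_val (gconst (c i p q))))).
have wC : approx v0 a om d.+1 (w - gconst C *: monomial_form om z).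
  by rewrite -(subrKA G); apply: (approxD rest HC).
have [C0|C0] := eqVneq C 0.
  left; move: wC; rewrite C0 (_ : gconst 0 = 0) ?scale0r ?subr0 //.
  by apply: val_inj; rewrite /= rmorph0.
right; have := approx_vanish le wC; rewrite (minn_idPl dv0) (thetaB Cb) theta_const => H1.
have wd : theta w d = C.
  have := H1 d (ltnSn d); rewrite fpsDE fpsNE fps_constME z1 mulr1.
  by move/eqP; rewrite subr_eq0 => /eqP.
have wlt i : (i < d)%N -> theta w i = 0.
  move=> id; have := H1 i (ltnW id); rewrite fpsDE fpsNE fps_constME zv // mulr0.
  by rewrite subr0.
have -> : v = d.
  apply/eqP; rewrite eqn_leq; apply/andP; split; rewrite leqNgt; apply/negP => lt.
    by move: C0; rewrite -wd vw ?eqxx.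
  by move: wv; rewrite wlt ?eqxx.
by apply/UpP; exists i0, p0, q0.
Qed.

End StandardBasis.

(** ** Divisorial orders and wedge products *)

Section Construction.
Variables (R : realType) (n m : nat) (b : fps1 R) (lam : seq nat).
Hypothesis Cb : cusp n m b.
Let n2 := cusp_n2 Cb.
Let nm := cusp_nm Cb.
Let cop := cusp_coprime Cb.
Implicit Types (w : form1 R) (f g : nat -> germ R) (om : nat -> form1 R).
Implicit Types x y : nat * nat * nat.
Local Notation wt d h := (@wt R[i] n m d (h : fps2 R)).
Local Notation theta := (theta n b).
Local Notation L a := (nth 0%N lam a).
Local Notation Up := (Lambda_upto n m lam).
Local Notation gmono := (gmono m b).
Local Notation heavy := (heavy n m lam).
Local Notation term := (monomial_form m b).
Local Notation lead := (lead n b lam).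
Local Notation weight := (weight_of n m lam).
Local Notation ln a := (ell n m lam n a).
Local Notation lm a := (ell n m lam m a).
Local Notation wtf d w := (wt_form n m d (germ_val (w 0 0)) (germ_val (w 0 1))).

Lemma gmono_shift p q (h : fps2 R) i j :
  (germ_val (gmono p q) * h) (p + i)%N (q + j)%N = (b m)^-1 ^+ q * h i j.
Proof.
rewrite /= monoE -!mulrA const2ME; congr (_ * _).
have xE (f : fps2 R) k : (ser_x R ^+ p * f) (p + i)%N k = f i k.
  elim: (p) => [|r IH]; first by rewrite expr0 mul1r.
  by rewrite exprS -mulrA ser_xME.
by rewrite xE ser_yXME leq_addr addKn.
Qed.

Lemma gmono_x_pure p (h : fps2 R) j : (0 < p)%N -> (germ_val (gmono p 0) * h) 0%N j = 0.
Proof.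
case: p => // p _; rewrite /= monoE exprS -!mulrA const2ME ser_xME.
by rewrite mulr0.
Qed.

Lemma gmono_cancel d p q (h : fps2 R) :
  wt (d + (n * p + m * q)) (germ_val (gmono p q) * h) -> wt d h.
Proof.
move=> wh i j ij; have := wh (p + i)%N (q + j)%N; rewrite gmono_shift !mulnDr.
move=> H; have /eqP := H ltac:(lia).
by rewrite mulf_eq0 expf_eq0 invr_eq0 (negbTE (cusp_lead Cb)) andbF => /eqP.
Qed.

Lemma wtfD d w w' : wtf d w -> wtf d w' -> wtf d (w + w').
Proof.
by move=> [h1 h2] [h3 h4]; rewrite /wt_form !mxE !germD !mulrDr; split; apply: wtD.
Qed.

Lemma wtfZ d e (h : germ R) w : wt e h -> wtf d w -> wtf (e + d) (h *: w).
Proof.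
move=> wh [h1 h2]; rewrite /wt_form !mxE !germM ![ser_x R * _]mulrCA ![ser_y R * _]mulrCA.
by split; apply: wtM.
Qed.

Lemma wtf_le d e w : (d <= e)%N -> wtf e w -> wtf d w.
Proof. by move=> de [h1 h2]; split; apply: (wt_le de). Qed.

Lemma wtf0 d : wtf d (0 : form1 R).
Proof. by rewrite /wt_form !mxE germ0 !mulr0; split=> i j _. Qed.

Lemma wtf_sum d (I : Type) (r : seq I) (P : pred I) (F : I -> form1 R) :
  (forall i, P i -> wtf d (F i)) -> wtf d (\sum_(i <- r | P i) F i).
Proof.
move=> HF; elim/big_rec: _ => [|i w Pi Hw]; first exact: wtf0.
exact: (wtfD (HF i Pi) Hw).
Qed.

(** The critical values with their index shifted by one, to be indexed like the
    basis; the first one is [lambda_{-1}]. *)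
Definition tcrit a := if a is a'.+1 then crit n m lam a' else L 0.

Lemma ttS a : (0 < a)%N -> tcrit a.+1 = minn (tcrit a + n * ln a) (tcrit a + m * lm a).
Proof. by case: a. Qed.

(** The induction hypothesis on the first [a + 1] elements of the basis: forms
    [om i] with value [L i] and divisorial order [tcrit i]. The relations [es] are
    those used to build the forms. The differences [L i - tcrit i] are
    nondecreasing: this makes heavy combinations of the [om i] have large
    divisorial orders. The wedge products are controlled because, at the end, the
    coefficient of [y^n] in the product of the two last forms has to be computed;
    [e] is the exponent of the pure power of [y] in the initial part of
    [wedge (om k) (om a)]. The order of [om a] is attained by its [dy] part, where
    the older forms are strictly too heavy to interfere. *)
Record standard a om k A j B es e : Prop := Standard {
  st_corner : corner n m lam a k A j B;
  st_connected : connected n m lam a es k A j B;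
  st_es : forall x y, es x y -> [/\ (x.1.1 <= a)%N, (y.1.1 <= a)%N, weight x = weight y &
    exists2 f, heavy (weight x).+1 f & term om x - term om y = comb a om f];
  st_lead : lead a om;
  st_om0 : theta (om 0%N) = tpow R n;
  st_delta : forall i i', (i <= i' <= a)%N -> (L i + tcrit i' <= tcrit i + L i')%N;
  st_wedge : forall i i', (i < i' <= a)%N ->
    wt (L i + tcrit i' - (n + m)) (wedge (om i) (om i'));
  st_pure : germ_val (wedge (om k) (om a)) 0%N e != 0;
  st_e : (A + lm a + e = n)%N;
  st_eweight : (m * e + (n + m) = L k + tcrit a)%N;
  st_wt : forall i, (i <= a)%N -> wtf (tcrit i) (om i);
  st_exact : ~ wt (tcrit a).+1 (ser_y R * germ_val (om a 0 1));
  st_exact_old : forall i, (i < a)%N ->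
    wt (L i + tcrit a + 1 - L a) (ser_y R * germ_val (om i 0 1));
  st_span : forall w, exists f, w = comb a om f }.

Section Stage.
Variables (a : nat) (om : nat -> form1 R) (k A j B : nat).
Variables (es : nat * nat * nat -> nat * nat * nat -> Prop) (e : nat).
Hypothesis st : standard a om k A j B es e.

(** The worst wedge products are those with [om a], as [L i - tcrit i] is
    largest for [i = a]. *)
Lemma wedge_bound u g i : heavy u g -> (i <= a)%N ->
  wt (u + L i + tcrit a - (L a + (n + m))) (wedge (om i) (comb a om g)).
Proof.
move=> hg ia; rewrite /comb wedge_sum germ_sum; apply: wt_sum => r _.
have ra : (r <= a)%N by rewrite -ltnS.
rewrite wedgeZ; have [ri|ir|ri] := ltngtP r i.
- rewrite wedgeC mulrN germN; apply: wtN; rewrite germM.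
  apply: (wt_le _ (wtM (hg r) (st_wedge st (i := r) (i' := i) _))); last by rewrite ri.
  by have := st_delta st (i := i) (i' := a); lia.
- rewrite germM; apply: (wt_le _ (wtM (hg r) (st_wedge st (i := i) (i' := r) _))); last by rewrite ir.
  by have := st_delta st (i := r) (i' := a); lia.
by rewrite ri wedgeww mulr0 germ0 => p q _.
Qed.

Lemma form_bound u g : heavy u g -> wtf (u + tcrit a - L a) (comb a om g).
Proof.
move=> hg; apply: wtf_sum => r _; have ra : (r <= a)%N by rewrite -ltnS.
apply: (wtf_le _ (wtfZ (hg r) (st_wt st ra))).
by have := st_delta st (i := r) (i' := a); lia.
Qed.

(** The difference of two monomials of the same weight, whose leading terms
    cancel, corrected by heavier monomials. *)
Definition syzygy x y f : form1 R := term om x - term om y - comb a om f.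

Lemma syzygy_comb x y f : (x.1.1 <= a)%N -> (y.1.1 <= a)%N -> weight x = weight y ->
  heavy (weight x).+1 f -> exists2 g, heavy (weight x) g & syzygy x y f = comb a om g.
Proof.
move=> xa ya e_xy hf.
exists (fun i => ((if i == x.1.1 then gmono x.1.2 x.2 else 0)
  + (if i == y.1.1 then - gmono y.1.2 y.2 else 0)) + - 1 * f i).
  apply: heavyD; [apply: heavyD|].
  - apply: heavy1; apply: (wt_le _ (@gmono_wt _ n m b _ _)).
    by rewrite /weight_of; lia.
  - apply: heavy1; rewrite germN; apply: wtN; apply: (wt_le _ (@gmono_wt _ n m b _ _)).
    by rewrite e_xy /weight_of; lia.
  rewrite -[weight x]add0n; apply: (heavyM Cb); first by move=> i i'; rewrite ltn0.
  exact: heavy_le hf.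
rewrite (combD a om _ (fun i => - 1 * f i)) (combD a om (fun i => if i == x.1.1 then _ else _)).
by rewrite combZ !comb1 // scaleNr scaleN1r.
Qed.

Lemma syzygy_reduced x y : (x.1.1 <= a)%N -> (y.1.1 <= a)%N -> weight x = weight y ->
  L 0 = n -> exists2 f, heavy (weight x).+1 f &
    theta (syzygy x y f) = 0 \/ exists v, [/\ (weight x < v)%N, ~ Up a v,
      vanish v (theta (syzygy x y f)) & theta (syzygy x y f) v != 0].
Proof.
move=> xa ya e_xy L0.
have [vx x1] := theta_mono Cb x.1.2 x.2 (st_lead st) xa.
have [vy y1] := theta_mono Cb y.1.2 y.2 (st_lead st) ya.
apply: (reduction Cb (st_lead st) (st_om0 st) L0 (D := (weight x).+1)).
move=> i; rewrite ltnS leq_eqVlt (thetaB Cb) fpsDE fpsNE => /orP[/eqP->|ix].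
  by rewrite x1 e_xy y1 subrr.
by rewrite vx // vy ?subrr // -/(weight y) -e_xy.
Qed.

(** In the [dy] part nothing else is as light as the monomial of [om a]. *)
Lemma syzygy_exact x y f : x.1.1 = a -> (y.1.1 < a)%N -> weight x = weight y ->
  heavy (weight x).+1 f ->
  ~ wt (tcrit a + (weight x - L a)).+1 (ser_y R * germ_val (syzygy x y f 0 1)).
Proof.
move=> xa ya e_xy hf H; apply: (st_exact st).
have wxE : weight x = (L a + n * x.1.2 + m * x.2)%N by rewrite /weight_of xa.
have wx : (weight x - L a = n * x.1.2 + m * x.2)%N by lia.
apply: (gmono_cancel (p := x.1.2) (q := x.2)); rewrite addSn -wx.
rewrite mulrCA -germM; have -> : germ_val (gmono x.1.2 x.2 * om a 0 1) = germ_val (syzygy x y f 0 1)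
    + (germ_val (gmono y.1.2 y.2 * om y.1.1 0 1) + germ_val (comb a om f 0 1)).
  by rewrite /syzygy /monomial_form xa !mxE !germD !germN; ring.
rewrite 2![ser_y R * (_ + _)]mulrDr; apply: wtD; first exact: H.
apply: wtD.
  rewrite germM mulrCA; apply: (wt_le _ (wtM (@gmono_wt _ n m b _ _) (st_exact_old st ya))).
  have wyE : weight y = (L y.1.1 + n * y.1.2 + m * y.2)%N by [].
  by rewrite -e_xy in wyE; lia.
rewrite /comb summxE germ_sum mulr_sumr; apply: wt_sum => r _; rewrite mxE germM mulrCA.
have := ltn_ord r; rewrite ltnS leq_eqVlt => /orP[/eqP ra|ra].
  have [_ h2] := st_wt st (leqnn a); rewrite ra.
  by apply: (wt_le _ (wtM (hf a) h2)); lia.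
by apply: (wt_le _ (wtM (hf r) (st_exact_old st ra))); lia.
Qed.

Lemma syzygy_wt x y f : (x.1.1 <= a)%N -> (y.1.1 <= a)%N -> weight x = weight y ->
  heavy (weight x).+1 f -> wtf (weight x + tcrit a - L a) (syzygy x y f).
Proof.
by move=> xa ya e_xy hf; have [g hg ->] := syzygy_comb xa ya e_xy hf; apply: form_bound.
Qed.

(** On [x = 0] the first monomial of the corner in direction [x] disappears, and
    the correction is too heavy to contribute. *)
Lemma wedge_x_corner f : heavy (L a + n * ln a).+1 f ->
  germ_val (wedge (om a) (syzygy (a, ln a, 0%N) (k, 0%N, A) f)) 0%N (A + e)%N
  = (b m)^-1 ^+ A * germ_val (wedge (om k) (om a)) 0%N e.
Proof.
move=> hf; rewrite /syzygy !wedgeB /monomial_form !wedgeZ wedgeww mulr0 sub0r.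
rewrite [wedge (om a) (om k)]wedgeC mulrN opprK germD germN germM fps2DE fps2NE.
have := gmono_shift 0 A (germ_val (wedge (om k) (om a))) 0 e; rewrite add0n => ->.
rewrite (wedge_bound hf (leqnn a)) ?subr0 // muln0 add0n mulnDr.
have := cor_x (st_corner st); have := st_eweight st; lia.
Qed.

(** Here it is the second monomial that disappears on [x = 0]. *)
Lemma wedge_y_corner f : heavy (L a + m * lm a).+1 f ->
  germ_val (wedge (om k) (syzygy (a, 0%N, lm a) (j, B, 0%N) f)) 0%N (lm a + e)%N
  = (b m)^-1 ^+ lm a * germ_val (wedge (om k) (om a)) 0%N e.
Proof.
move=> hf; rewrite /syzygy !wedgeB /monomial_form !wedgeZ !germD !germN !germM !fps2DE !fps2NE.
have := gmono_shift 0 (lm a) (germ_val (wedge (om k) (om a))) 0 e; rewrite add0n => ->.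
have co := st_corner st; have ka := cor_k co.
rewrite gmono_x_pure ?subr0; last by have := cor_B co; rewrite /=; lia.
rewrite (wedge_bound hf (ltnW ka)) ?subr0 // muln0 add0n mulnDr.
have := st_eweight st; lia.
Qed.

(** Expanding the second corner first leaves [y^(lm a)] times the product of the
    first corner with [om a], that is, the power [lm a + A + e = n] of [y]. *)
Lemma wedge_corners f g : heavy (L a + n * ln a).+1 f -> heavy (L a + m * lm a).+1 g ->
  germ_val (wedge (syzygy (a, ln a, 0%N) (k, 0%N, A) f)
    (syzygy (a, 0%N, lm a) (j, B, 0%N) g)) 0%N n != 0.
Proof.
move=> hf hg; set w := syzygy (a, ln a, 0%N) _ _.
have co := st_corner st; have ka := cor_k co.
have ex : weight (a, ln a, 0%N) = weight (k, 0%N, A).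
  by rewrite /weight_of /= !muln0 !addn0; exact: cor_x co.
have hf' : heavy (weight (a, ln a, 0%N)).+1 f by rewrite /weight_of /= muln0 addn0.
have [h hh wE] := @syzygy_comb (a, ln a, 0%N) (k, 0%N, A) f (leqnn a) (ltnW ka) ex hf'.
have wb i : (i <= a)%N ->
    wt (L a + n * ln a + L i + tcrit a - (L a + (n + m))) (wedge w (om i)).
  move=> ia; rewrite wedgeC germN; apply: wtN; rewrite /w wE.
  by have := wedge_bound hh ia; rewrite /weight_of /= muln0 addn0.
rewrite /syzygy !wedgeB /monomial_form !wedgeZ !germD !germN !germM !fps2DE !fps2NE.
have en : (lm a + (A + e))%N = n by have := st_e st; lia.
have := gmono_shift 0 (lm a) (germ_val (wedge w (om a))) 0 (A + e); rewrite add0n en => ->.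
rewrite gmono_x_pure ?subr0; last by have := cor_B co; rewrite /=; lia.
have -> : germ_val (wedge w (comb a om g)) 0%N n = 0.
  rewrite /comb wedge_sum germ_sum fps2_sumE big1 // => r _; rewrite wedgeZ germM.
  have ra : (r <= a)%N by rewrite -ltnS.
  apply: (wtM (hg r) (wb r ra)); rewrite muln0 add0n.
  have : (m * n = m * A + m * lm a + m * e)%N by rewrite -!mulnDr (st_e st).
  have := cor_x co; have := st_eweight st; lia.
rewrite subr0 mulf_neq0 ?expf_neq0 ?invr_eq0 ?(cusp_lead Cb) //.
rewrite wedgeC germN fps2NE oppr_eq0 wedge_x_corner //.
by rewrite mulf_neq0 ?expf_neq0 ?invr_eq0 ?(cusp_lead Cb) ?(st_pure st).
Qed.

(** ** Adding a generator *)

Definition extend (w : form1 R) i := if i == a.+1 then w else om i.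

Lemma extend_old w i : (i <= a)%N -> extend w i = om i.
Proof. by move=> ia; rewrite /extend ltn_eqF. Qed.

Lemma extend_new w : extend w a.+1 = w.
Proof. by rewrite /extend eqxx. Qed.

Lemma comb_extend w f (h : germ R) :
  comb a.+1 (extend w) (fun i => if i == a.+1 then h else f i) = comb a om f + h *: w.
Proof.
rewrite /comb big_ord_recr /= eqxx extend_new; congr (_ + _).
apply: eq_bigr => i _; have ia := ltn_ord i.
by rewrite ltn_eqF // extend_old.
Qed.

Variables (x y : nat * nat * nat) (f0 : nat -> germ R).
Hypotheses (xa : x.1.1 = a) (ya : (y.1.1 < a)%N) (e_xy : weight x = weight y).
Hypothesis hf0 : heavy (weight x).+1 f0.
Hypothesis ttS' : (tcrit a.+1 + L a = tcrit a + weight x)%N.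
Let w0 := syzygy x y f0.
Let c0 := theta w0 (L a.+1).
Hypotheses (v0 : vanish (L a.+1) (theta w0)) (c0_neq0 : c0 != 0).
Hypothesis lt_x : (weight x < L a.+1)%N.
Let w1 := gconst c0^-1 *: w0.
Let om' := extend w1.

Let w0E : w0 = gconst c0 *: w1.
Proof.
rewrite /w1 scalerA (_ : gconst c0 * gconst c0^-1 = 1) ?scale1r //.
by apply: val_inj; rewrite /= -rmorphM mulfV // rmorph1.
Qed.

Lemma extend_lead : lead a.+1 om'.
Proof.
move=> i; rewrite leq_eqVlt => /orP[/eqP->|ia]; last first.
  by rewrite /om' extend_old //; apply: (st_lead st).
rewrite /om' extend_new /w1 (theta_const Cb); split=> [j' jL|].
  by rewrite fps_constME v0 // mulr0.
by rewrite fps_constME mulVf.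
Qed.

Lemma extend_es es' : (forall x' y', es' x' y' -> es x' y' \/ x' = x /\ y' = y) ->
  forall x' y', es' x' y' -> [/\ (x'.1.1 <= a.+1)%N, (y'.1.1 <= a.+1)%N,
    weight x' = weight y' &
    exists2 f, heavy (weight x').+1 f & term om' x' - term om' y' = comb a.+1 om' f].
Proof.
move=> esP x' y' /esP[H|[-> ->]].
  have [xa' ya' exy' [f hf ef]] := st_es st H; split=> //; try exact: leqW.
  exists (fun i => if i == a.+1 then 0 else f i).
    by move=> i; case: eqP => [_ p q _|_]; [rewrite germ0|apply: hf].
  by rewrite comb_extend scale0r addr0 -ef /monomial_form /om' !extend_old.
split=> //; [by rewrite xa|by apply: ltnW; apply: leqW|].
exists (fun i => if i == a.+1 then gconst c0 else f0 i).
  move=> i; case: eqP => [->|_]; last exact: hf0.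
  by rewrite (_ : (_ - _)%N = 0%N); [move=> p q; rewrite ltn0|lia].
have xa' : (x.1.1 <= a)%N by rewrite xa.
have ya' := ltnW ya.
by rewrite comb_extend -w0E /w0 /syzygy [comb a om f0 + _]addrC subrK /monomial_form /om' !extend_old.
Qed.

Lemma extend_delta i i' : (i <= i' <= a.+1)%N -> (L i + tcrit i' <= tcrit i + L i')%N.
Proof.
move=> /andP[ii']; rewrite leq_eqVlt => /orP[/eqP ei|i'a]; last first.
  by apply: (st_delta st); rewrite ii'.
move: ii'; rewrite ei leq_eqVlt => /orP[/eqP->|ia]; first by rewrite addnC.
by have := st_delta st (i := i) (i' := a); lia.
Qed.

Lemma w0_comb : exists2 g, heavy (weight x) g & w0 = comb a om g.
Proof. by apply: syzygy_comb => //; rewrite ?xa // ltnW. Qed.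

Lemma extend_wedge i i' : (i < i' <= a.+1)%N ->
  wt (L i + tcrit i' - (n + m)) (wedge (om' i) (om' i')).
Proof.
move=> /andP[ii']; rewrite leq_eqVlt => /orP[/eqP ei|i'a]; last first.
  have ia : (i <= a)%N by lia.
  by rewrite /om' !extend_old //; apply: (st_wedge st); rewrite ii'.
have ia : (i <= a)%N by lia.
rewrite ei /om' extend_new extend_old // /w1 wedgeZ; apply: wt_const.
have [g hg ->] := w0_comb; apply: (wt_le _ (wedge_bound hg ia)).
by have := st_delta st (i := a) (i' := a); lia.
Qed.

Lemma extend_wt i : (i <= a.+1)%N -> wtf (tcrit i) (om' i).
Proof.
rewrite leq_eqVlt => /orP[/eqP->|ia]; last first.
  by rewrite /om' extend_old //; apply: (st_wt st).
rewrite /om' extend_new /w1 -[tcrit _]add0n; apply: wtfZ; first by move=> p q; rewrite ltn0.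
have [g hg ->] := w0_comb; apply: (wtf_le _ (form_bound hg)).
by lia.
Qed.

Lemma extend_exact : ~ wt (tcrit a.+1).+1 (ser_y R * germ_val (om' a.+1 0 1)).
Proof.
rewrite /om' extend_new => H.
have hf0' : heavy (weight x).+1 f0 by exact: hf0.
apply: (syzygy_exact xa ya e_xy hf0'); rewrite -/w0 w0E mxE germM mulrCA.
apply: (wt_le _ (wtMr _ H)); have wx : (L a <= weight x)%N by rewrite /weight_of xa; lia.
by lia.
Qed.

Lemma extend_exact_old i : (i < a.+1)%N ->
  wt (L i + tcrit a.+1 + 1 - L a.+1) (ser_y R * germ_val (om' i 0 1)).
Proof.
rewrite ltnS => ia; rewrite /om' extend_old //.
have [_ h2] := st_wt st ia; apply: (wt_le _ h2).
by have := st_delta st (i := i) (i' := a); lia.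
Qed.

Lemma extend_span w : exists f, w = comb a.+1 om' f.
Proof.
have [f ->] := st_span st w; exists (fun i => if i == a.+1 then 0 else f i).
by rewrite comb_extend scale0r addr0.
Qed.

Lemma extend_standard k' A' j' B' es' e' : (k' <= a)%N ->
  corner n m lam a.+1 k' A' j' B' -> connected n m lam a.+1 es' k' A' j' B' ->
  (forall x' y', es' x' y' -> es x' y' \/ x' = x /\ y' = y) ->
  germ_val (wedge (om k') w0) 0%N e' != 0 ->
  (A' + lm a.+1 + e' = n)%N -> (m * e' + (n + m) = L k' + tcrit a.+1)%N ->
  standard a.+1 om' k' A' j' B' es' e'.
Proof.
move=> k'a co' cn' esP pure' e1 e2.
split.
- exact: co'.
- exact: cn'.
- exact: (extend_es esP).
- exact: extend_lead.
- by rewrite /om' extend_old //; apply: (st_om0 st).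
- exact: extend_delta.
- exact: extend_wedge.
- rewrite /om' extend_new extend_old // /w1 wedgeZ germM const2ME.
  by rewrite mulf_neq0 // invr_eq0.
- exact: e1.
- exact: e2.
- exact: extend_wt.
- exact: extend_exact.
- exact: extend_exact_old.
exact: extend_span.
Qed.

End Stage.
End Construction.

(** ** The induction *)

Section Induction.
Variables (R : realType) (n m : nat) (b : fps1 R) (lam : seq nat).
Hypothesis Cb : cusp n m b.
Let n2 := cusp_n2 Cb.
Let nm := cusp_nm Cb.
Let cop := cusp_coprime Cb.
Implicit Types (w : form1 R) (f g : nat -> germ R) (om : nat -> form1 R).
Implicit Types x y : nat * nat * nat.
Local Notation wt d h := (@wt R[i] n m d (h : fps2 R)).
Local Notation theta := (theta n b).
Local Notation L a := (nth 0%N lam a).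
Local Notation Up := (Lambda_upto n m lam).
Local Notation heavy := (heavy n m lam).
Local Notation weight := (weight_of n m lam).
Local Notation ln a := (ell n m lam n a).
Local Notation lm a := (ell n m lam m a).
Local Notation tcrit := (tcrit n m lam).
Local Notation standard := (standard n m b lam).

Lemma t_ddt (a : fps1 R) k : (tpow R 1 * ddt a) k = a k *+ k.
Proof.
case: k => [|k]; first by rewrite fpsME big_ord1 /tpow mul0r.
by rewrite -add1n tpowME.
Qed.

Definition dx : form1 R := delta_mx 0 0.
Definition dy : form1 R := delta_mx 0 1.

Let dx00 : dx 0 0 = 1. Proof. by rewrite mxE. Qed.
Let dx01 : dx 0 1 = 0. Proof. by rewrite mxE. Qed.
Let dy00 : dy 0 0 = 0. Proof. by rewrite mxE. Qed.
Let dy01 : dy 0 1 = 1. Proof. by rewrite mxE. Qed.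

Lemma theta_dx : theta dx = tpow R 1 * ddt (tpow R n).
Proof.
by rewrite thetaE dx00 dx01 germ1 germ0 (along0 Cb) (along1 Cb) mul1r mul0r addr0.
Qed.

Lemma theta_dy : theta dy = tpow R 1 * ddt b.
Proof.
by rewrite thetaE dy00 dy01 germ1 germ0 (along0 Cb) (along1 Cb) mul1r mul0r add0r.
Qed.

Lemma dxdyE w : w = w 0 0 *: dx + w 0 1 *: dy.
Proof.
apply/rowP => i; rewrite mxE [X in _ = X + _]mxE [X in _ = _ + X]mxE.
have [->|->] : i = 0 \/ i = 1 by case: i => [[|[|//]] p]; [left|right]; apply: val_inj.
  by rewrite dx00 dy00 mulr1 mulr0 addr0.
by rewrite dx01 dy01 mulr1 mulr0 add0r.
Qed.

Lemma wedge_dxdy : wedge dx dy = 1.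
Proof. by rewrite /wedge dx00 dx01 dy00 dy01 mulr1 mulr0 subr0. Qed.

Let cx : R[i] := n%:R^-1.
Let cy : R[i] := (b m *+ m)^-1.

Let cx_neq0 : n%:R != 0 :> R[i].
Proof. by rewrite pnatr_eq0; lia. Qed.

Let cy_neq0 : b m *+ m != 0.
Proof. by rewrite mulrn_eq0 negb_or (cusp_lead Cb) andbT; lia. Qed.

Let om1 i : form1 R := if i == 0%N then gconst cx *: dx else gconst cy *: dy.

Let gconstV (c : R[i]) : c != 0 -> gconst c^-1 * gconst c = 1.
Proof. by move=> c0; apply: val_inj; rewrite /= -rmorphM mulVf // rmorph1. Qed.

Lemma standard_base : L 0 = n -> L 1 = m ->
  standard 1 om1 0 1 0 m.-1 (fun _ _ => False) 0.
Proof.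
move=> L0 L1; have [el1 el2] := ell_base n2 nm cop L0 L1.
have t0E : theta (om1 0%N) = tpow R n.
  rewrite /om1 eqxx (theta_const Cb) theta_dx; apply/funext => k.
  rewrite fps_constME t_ddt /tpow; case: eqP => [->|_]; last by rewrite mul0rn mulr0.
  by rewrite /cx mulVf.
split.
- exact: corner_base.
- exact: connected_base.
- by [].
- move=> [|[|//]] _; first by rewrite t0E L0; split; [exact: tpow_vanish|rewrite /tpow eqxx].
  rewrite /om1 /= (theta_const Cb) theta_dy L1; split=> [k km|].
    by rewrite fps_constME t_ddt (cusp_vanish Cb km) mul0rn mulr0.
  by rewrite fps_constME t_ddt mulVf.
- exact: t0E.
- have tE i : (i <= 1)%N -> tcrit i = L i by case: i => [|[|]].
  move=> i i' /andP[ii' i'1]; rewrite (tE i') // (tE i) ?leqnn //.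
  exact: leq_trans ii' i'1.
- move=> i i' /andP[ii' i'1] p q; rewrite (_ : (_ - _)%N = 0%N) ?ltn0 //.
  have [-> ->] : i = 0%N /\ i' = 1%N by lia.
  by rewrite /= L0 L1; lia.
- rewrite -[om1 0%N]/(gconst cx *: dx) -[om1 1%N]/(gconst cy *: dy).
  rewrite wedgeZ wedgeC wedgeZ -mulrN -wedgeC wedge_dxdy mulr1 germM.
  have -> : (germ_val (gconst cy) * germ_val (gconst cx)) 0%N 0%N = cy * cx.
    by rewrite const2ME.
  by rewrite mulf_neq0 // invr_eq0.
- by rewrite el2; lia.
- by rewrite muln0 add0n /= L0 L1.
- move=> [|[|//]] _ /=.
    rewrite /om1 eqxx -[L 0]add0n; apply: wtfZ; first by move=> p q; rewrite ltn0.
    rewrite /wt_form dx00 dx01 germ1 germ0 mulr1 mulr0; split; last by move=> p q _.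
    move=> p q; rewrite L0 /ser_x; case: eqP => [->|//]; case: eqP => [->|//]; lia.
  rewrite /om1 /= -[L 1]add0n; apply: wtfZ; first by move=> p q; rewrite ltn0.
  rewrite /wt_form dy00 dy01 germ1 germ0 mulr1 mulr0; split; first by move=> p q _.
  move=> p q; rewrite L1 /ser_y; case: eqP => [->|//]; case: eqP => [->|//]; lia.
- move=> H; have cy0 : cy = 0.
    have := H 0%N 1%N; rewrite -[om1 1%N]/(gconst cy *: dy) mxE dy01 mulr1 ser_yME.
    by apply; rewrite /= L1; lia.
  by have /eqP := cy0; rewrite invr_eq0 (negbTE cy_neq0).
- move=> [|//] _; rewrite /om1 eqxx mxE dx01 mulr0 germ0 mulr0 => p q _ //.
move=> w; exists (fun i => if i == 0%N then w 0 0 * gconst n%:R else w 0 1 * gconst (b m *+ m)).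
rewrite /comb big_ord_recl big_ord1 /om1 /= !scalerA -!mulrA.
have -> : gconst n%:R * gconst cx = 1 by rewrite mulrC gconstV.
have -> : gconst (b m *+ m) * gconst cy = 1 by rewrite mulrC gconstV.
by rewrite !mulr1; apply: dxdyE.
Qed.

(** The larger corner reduces to a form of infinite value: a finite value would
    lie outside [Lambda_a] and beyond both corners. Then [small_values] shows that
    the value of the smaller corner is the least one outside [Lambda_a]. *)
Lemma standard_step a om k A j B es e : standard a om k A j B es e -> (0 < a)%N ->
  L 0 = n -> (forall i, (i <= a)%N -> (L i < L a.+1)%N) -> ~ Up a (L a.+1) ->
  (exists w, vanish (L a.+1) (theta w) /\ theta w (L a.+1) != 0) ->
  (forall w v, vanish v (theta w) -> theta w v != 0 -> Up a v \/ (L a.+1 <= v)%N) ->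
  exists om' k' A' j' B' es' e', standard a.+1 om' k' A' j' B' es' e'.
Proof.
move=> st a0 L0 Lv Uv [wv [vwv wv0]] hmin.
have co := st_corner st; have ka := cor_k co; have ja := cor_j co.
pose xn := (a, ln a, 0%N); pose yn := (k, 0%N, A).
pose xm := (a, 0%N, lm a); pose ym := (j, B, 0%N).
have wxn : weight xn = (L a + n * ln a)%N by rewrite /xn /weight_of /= muln0 addn0.
have wxm : weight xm = (L a + m * lm a)%N by rewrite /xm /weight_of /= muln0 addn0.
have en : weight xn = weight yn by rewrite wxn (cor_x co) /yn /weight_of /= muln0 addn0.
have em : weight xm = weight ym by rewrite wxm (cor_y co) /ym /weight_of /= muln0 addn0.
have [fn hfn Pn] := syzygy_reduced Cb st (x := xn) (y := yn) (leqnn a) (ltnW ka) en L0.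
have [fm hfm Pm] := syzygy_reduced Cb st (x := xm) (y := ym) (leqnn a) (ltnW ja) em L0.
set wn := syzygy m b a om xn yn fn in Pn.
set wm := syzygy m b a om xm ym fm in Pm.
have small v0 : vanish v0 (theta wn) -> vanish v0 (theta wm) -> (v0 <= L a.+1)%N.
  move=> vn vm.
  have hes x y : es x y -> weight x = weight y /\
      approx n m b lam v0 a om (weight x).+1 (monomial_form m b om x - monomial_form m b om y).
    move=> /(st_es st)[_ _ exy [f hf ef]]; split; first exact: exy.
    by exists f; [exact: hf|rewrite ef subrr (theta_0 Cb)].
  have hx : approx n m b lam v0 a om (L a + n * ln a).+1 (monomial_form m b om xn - monomial_form m b om yn).
    by rewrite -wxn; exists fn; [exact: hfn|exact: vn].
  have hy : approx n m b lam v0 a om (L a + m * lm a).+1 (monomial_form m b om xm - monomial_form m b om ym).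
    by rewrite -wxm; exists fm; [exact: hfm|exact: vm].
  by have [/Uv|] := small_values Cb (st_lead st) (st_connected st) hes (cor_x co)
    (cor_y co) hx hy (st_span st wv) vwv wv0.
have large w u : (theta w = 0 \/ exists v, [/\ (u < v)%N, ~ Up a v,
      vanish v (theta w) & theta w v != 0]) ->
    u = maxn (L a + n * ln a) (L a + m * lm a) -> theta w = 0.
  case=> // -[v [uv nUv _ _]] eu.
  have [|p [q [p0 q0 e']]] := cor_below co nUv; first by lia.
  by exfalso; move: uv; rewrite eu -e'; lia.
have exact w w' u : (theta w = 0 \/ exists v, [/\ (u < v)%N, ~ Up a v,
      vanish v (theta w) & theta w v != 0]) -> theta w' = 0 ->
    (forall v0, vanish v0 (theta w) -> vanish v0 (theta w') -> (v0 <= L a.+1)%N) ->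
    [/\ vanish (L a.+1) (theta w), theta w (L a.+1) != 0 & (u < L a.+1)%N].
  move=> H w'0 sm; have v0 N : vanish N (theta w') by rewrite w'0.
  case: H => [e0|[v [uv nUv vw w_v]]].
    by have := sm (L a.+1).+1; rewrite e0 ltnn => H; have : false by apply: H.
  have le1 := sm v vw (v0 v).
  have [//|le2] := hmin w v vw w_v.
  by have <- : v = L a.+1 by lia.
have ttE : tcrit a.+1 = minn (tcrit a + n * ln a) (tcrit a + m * lm a) by apply: ttS.
have [lt|ge] := ltnP (n * ln a) (m * lm a).
  have wm0 : theta wm = 0 by apply: (large _ _ Pm); rewrite wxm; lia.
  have [v0 c0 ltx] := exact _ _ _ Pn wm0 small.
  have minlt : (minn (L a + n * ln a) (L a + m * lm a) < L a.+1)%N by rewrite wxn in ltx; lia.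
  have tteq : (tcrit a.+1 + L a = tcrit a + weight xn)%N by rewrite ttE wxn; lia.
  have [_ _ _] := corner_split n2 nm cop co Lv Uv minlt; rewrite lt => co'.
  have := connected_step n2 nm cop co (st_connected st) Lv Uv minlt; rewrite lt => cn'.
  have eB := cor_A co'.
  do 6!eexists; exists (A + e)%N; apply: (extend_standard Cb st (x := xn) (y := yn) (f0 := fn)
    erefl ka en hfn tteq v0 c0 ltx (leqnn a) co' cn').
  - by move=> x y [H|H]; [left|right].
  - rewrite (wedge_x_corner Cb st) -?wxn //.
    by rewrite mulf_neq0 ?expf_neq0 ?invr_eq0 ?(cusp_lead Cb) ?(st_pure st).
  - by have := st_e st; lia.
  - by have := st_eweight st; have := cor_x co; rewrite mulnDr; lia.
have wn0 : theta wn = 0 by apply: (large _ _ Pn); rewrite wxn; lia.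
have small' v0 : vanish v0 (theta wm) -> vanish v0 (theta wn) -> (v0 <= L a.+1)%N.
  by move=> h1 h2; apply: small.
have [v0 c0 ltx] := exact _ _ _ Pm wn0 small'.
have minlt : (minn (L a + n * ln a) (L a + m * lm a) < L a.+1)%N by rewrite wxm in ltx; lia.
have tteq : (tcrit a.+1 + L a = tcrit a + weight xm)%N by rewrite ttE wxm; lia.
have nlt : (n * ln a < m * lm a)%N = false by apply/negbTE; rewrite -leqNgt.
have [_ _ _] := corner_split n2 nm cop co Lv Uv minlt; rewrite nlt => co'.
have := connected_step n2 nm cop co (st_connected st) Lv Uv minlt; rewrite nlt => cn'.
have eB := cor_A co'.
do 6!eexists; exists (lm a + e)%N; apply: (extend_standard Cb st (x := xm) (y := ym) (f0 := fm)
  erefl ja em hfm tteq v0 c0 ltx (ltnW ka) co' cn').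
- by move=> x y [H|H]; [left|right].
- rewrite (wedge_y_corner Cb st) -?wxm //.
  by rewrite mulf_neq0 ?expf_neq0 ?invr_eq0 ?(cusp_lead Cb) ?(st_pure st).
- by have := st_e st; lia.
by have := st_eweight st; rewrite mulnDr; lia.
Qed.

End Induction.

(** * Saito bases in adapted coordinates *)

(** The lexicographically first monomials of least weight of two series have a
    product that nothing cancels. *)
Lemma wt_integral (R : realType) n m d e (f g : fps2 R) : (0 < m)%N ->
  wt n m d f -> wt n m e g -> wt n m (d + e).+1 (f * g) ->
  wt n m d.+1 f \/ wt n m e.+1 g.
Proof.
move=> m0 wf wg wfg.
have first c (h : fps2 R) : wt n m c h -> wt n m c.+1 h \/ exists i j,
    [/\ (n * i + m * j = c)%N, h i j != 0 & forall i' j', (i' < i)%N ->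
      (n * i' + m * j' <= c)%N -> h i' j' = 0].
  move=> wh; have [ex|nex] := pselect (exists i, `[< exists j,
      (n * i + m * j = c)%N /\ h i j != 0 >]).
    right; case: (ex_minnP ex) => i /asboolP[j [ij hij]] mini.
    exists i, j; split=> // i' j' i'i; rewrite leq_eqVlt => /orP[/eqP ec|]; last exact: wh.
    apply/eqP/negbNE/negP => h0; have := mini i'.
    by rewrite leqNgt i'i => /(_ _) H; have : false by apply: H; apply/asboolP; exists j'.
  left=> i j; rewrite ltnS leq_eqVlt => /orP[/eqP ec|]; last exact: wh.
  apply/eqP/negbNE/negP => h0; apply: nex; exists i; apply/asboolP.
  by exists j.
have [|[i [j [ij fij fi]]]] := first _ _ wf; first by left.
have [|[i' [j' [ij' gij gi]]]] := first _ _ wg; first by right.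
have /eqP : f i j * g i' j' = 0.
  have := wfg (i + i')%N (j + j')%N; rewrite !mulnDr => H0.
  have := H0 ltac:(lia); rewrite fps2ME => <-.
  have ii : (i < (i + i').+1)%N by lia.
  have jj : (j < (j + j').+1)%N by lia.
  rewrite (bigD1 (Ordinal ii)) //= (bigD1 (Ordinal jj)) //= !addKn.
  rewrite big1 => [|l lj]; last first.
    have {lj}lj : (l : nat) <> j by move=> e0; case/eqP: lj; apply: val_inj.
    have [lt|le] := ltnP l j.
      rewrite wf ?mul0r // -ij ltn_add2l ltn_mul2l m0; exact: lt.
    rewrite [X in _ * X]wg ?mulr0 // -ij' ltn_add2l ltn_mul2l m0 /=.
    by have := ltn_ord l; lia.
  rewrite big1 ?addr0 // => k ki; rewrite big1 // => l _.
  have {ki}ki : (k : nat) <> i by move=> e0; case/eqP: ki; apply: val_inj.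
  have kb := ltn_ord k; have lb := ltn_ord l.
  have ek : (n * k + n * (i + i' - k) = n * i + n * i')%N.
    by rewrite -!mulnDr subnKC //; lia.
  have el : (m * l + m * (j + j' - l) = m * j + m * j')%N.
    by rewrite -!mulnDr subnKC //; lia.
  have [lt|le] := ltnP k i.
    have [fl|fl] := leqP (n * k + m * l) d; first by rewrite fi ?mul0r.
    by rewrite wg ?mulr0 //; lia.
  have [gl|gl] := leqP (n * (i + i' - k) + m * (j + j' - l)) e.
    by rewrite gi ?mulr0 //; lia.
  by rewrite wf ?mul0r //; lia.
by rewrite mulf_eq0 (negbTE fij) (negbTE gij).
Qed.

Section Core.
Variables (R : realType) (n m : nat) (b : fps1 R).
Hypothesis Cb : cusp n m b.
Let n2 := cusp_n2 Cb.
Let nm := cusp_nm Cb.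
Let cop := cusp_coprime Cb.
Implicit Types (w : form1 R) (f g : germ R).
Local Notation wt d h := (@wt R[i] n m d (h : fps2 R)).
Local Notation theta := (theta n b).
Local Notation phi := (tpow R n, b).
Local Notation wtf d w := (wt_form n m d (germ_val (w 0 0)) (germ_val (w 0 1))).

Lemma wt1_00 f : germ_val f 0%N 0%N = 0 -> wt 1 f.
Proof.
move=> f0 i j; rewrite ltnS leqn0 addn_eq0 !muln_eq0.
move=> /andP[/orP[|/eqP->]]; first by lia.
by move=> /orP[|/eqP->]; first by lia.
Qed.

Lemma wtf_descend t D w g : wtf t w -> ~ wtf t.+1 w -> wtf (t + D) (g *: w) -> wt D g.
Proof.
move=> w1 w2; elim: D => [|D IH] w3; first by move=> i j; rewrite ltn0.
have wD : wt D g by apply: IH; apply: (wtf_le _ w3); lia.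
have {}w3 : wtf (D + t).+1 (g *: w) by rewrite -addnS addnC addSnnS.
move: w3; rewrite /wt_form !mxE !germM [ser_x R * _]mulrCA [ser_y R * _]mulrCA => -[hx hy].
have m0 : (0 < m)%N by lia.
have [//|hx'] := wt_integral m0 wD w1.1 hx.
have [//|hy'] := wt_integral m0 wD w1.2 hy.
by case: w2.
Qed.

(** The pair is obtained from the basis by a matrix. Its diagonal entries are
    units by the orders of the forms; the entry [g2] is not, and cannot even have
    order [d2 - d1], which is not in the semigroup. So the determinant is a unit. *)
Lemma saito_basis_of_orders w1 w2 d1 d2 w w' : saito_basis phi w1 w2 ->
  (d1 < d2)%N -> (forall p q, (d2 <> d1 + (n * p + m * q))%N) ->
  wtf d1 w1 -> ~ wtf d1.+1 w1 -> wtf d2 w2 ->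
  invariant_curve phi w -> invariant_curve phi w' ->
  wtf d1 w -> ~ wtf d1.+1 w -> wtf d2 w' -> ~ wtf d2.+1 w' ->
  saito_basis phi w w'.
Proof.
move=> [_ _ span free] d12 gap o1 n1 o2 iw iw' ow nw ow' nw'.
have [g1 [h1 e1]] := span w iw; have [g2 [h2 e2]] := span w' iw'.
have wtf0' f (v : form1 R) d : wtf d v -> wtf d (f *: v).
  by move=> wv; rewrite -[d]add0n; apply: wtfZ => // i j; rewrite ltn0.
have small f (v : form1 R) d : germ_val f 0%N 0%N = 0 -> wtf d v -> wtf d.+1 (f *: v).
  by move=> f0 wv; rewrite -[d.+1]add1n; apply: wtfZ => //; apply: wt1_00.
have g1u : germ_val g1 0%N 0%N != 0.
  apply/eqP => g0; apply: nw; rewrite e1; apply: wtfD; first exact: small.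
  by apply: wtf0'; apply: (wtf_le _ o2).
have wtfB d (v v' : form1 R) : wtf d (v + v') -> wtf d v' -> wtf d v.
  move=> H1 H2; rewrite -(addrK v' v); apply: (wtfD H1).
  by rewrite -scaleN1r; apply: wtf0'.
have og2 : wtf d2 (g2 *: w1).
  apply: (wtfB _ _ (h2 *: w2)); first by rewrite -e2.
  exact: wtf0'.
have wg2 : wt (d2 - d1) g2.
  by apply: (wtf_descend o1 n1); rewrite subnKC // ltnW.
have g20 : germ_val g2 0%N 0%N = 0 by apply: wg2; rewrite !muln0; lia.
have wg2' : wt (d2 - d1).+1 g2.
  move=> i j; rewrite ltnS leq_eqVlt => /orP[/eqP ij|]; last exact: wg2.
  by case: (gap i j); rewrite ij subnKC // ltnW.
have h2u : germ_val h2 0%N 0%N != 0.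
  apply/eqP => h0; apply: nw'; rewrite e2; apply: wtfD; last exact: small.
  by have := wtfZ wg2' o1; rewrite addSn subnK // ltnW.
pose D := g1 * h2 - g2 * h1.
have [|D' DD'] := @germ_unit _ D.
  rewrite /D germD germN fps2DE fps2NE !germM !fps2ME !big_ord1 g20 mul0r subr0.
  exact: mulf_neq0.
have E1 : D *: w1 = h2 *: w - h1 *: w'.
  rewrite e1 e2 !scalerDr !scalerA opprD addrACA -!scalerBl [h2 * h1]mulrC subrr.
  by rewrite scale0r addr0; congr (_ *: _); rewrite /D; ring.
have E2 : D *: w2 = g1 *: w' - g2 *: w.
  rewrite e1 e2 !scalerDr !scalerA opprD addrACA -!scalerBl [g2 * g1]mulrC subrr.
  by rewrite scale0r add0r; congr (_ *: _); rewrite /D; ring.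
split=> // [v iv|f g fg].
  have [f [g ev]] := span v iv.
  exists (D' * (f * h2 - g * g2)), (D' * (g * g1 - f * h1)).
  have -> : v = D' *: (f *: (D *: w1) + g *: (D *: w2)).
    rewrite !scalerA ![_ * D]mulrC -!scalerA -scalerDr -ev scalerA [D' * D]mulrC DD'.
    by rewrite scale1r.
  by rewrite E1 E2; apply/rowP => i; rewrite !mxE; ring.
move: fg; rewrite e1 e2 !scalerDr !scalerA addrACA -!scalerDl => /free[z1 z2].
have fD : f * D = 0.
  transitivity (h2 * (f * g1 + g * g2) - g2 * (f * h1 + g * h2)).
    by rewrite /D; ring.
  by rewrite z1 z2 !mulr0 subrr.
have gD : g * D = 0.
  transitivity (g1 * (f * h1 + g * h2) - h1 * (f * g1 + g * g2)).
    by rewrite /D; ring.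
  by rewrite z1 z2 !mulr0 subrr.
by split; [rewrite -[f]mulr1 -DD' mulrA fD mul0r|rewrite -[g]mulr1 -DD' mulrA gD mul0r].
Qed.

(** Below order [m] only the powers of [x] are seen; this identifies the second
    element of the basis of the semimodule. *)
Lemma along_low (h : fps2 R) d : (d < m)%N -> ~~ (n %| d)%N -> along n b h d = 0.
Proof.
move=> dm nd; have low i : (tpow R n ^+ i * b ^+ 0) d = 0.
  have [lt|le] := ltnP d (n * i).
    by apply: (vanishM (vanishX (p := i) (@tpow_vanish R n)) (N := 0)); rewrite ?addn0.
  rewrite -(subnKC le) tpowXME expr0 fps1E; case: eqP => // e0; case/negP: nd.
  by apply/dvdnP; exists i; rewrite mulnC; lia.
rewrite /along /comp21 big1 // => i _; rewrite big1 // => j _.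
case: j => [[|j] jd] /=; first by rewrite low mulr0.
rewrite [X in _ * X](vanishM (M := 0) _ (vanishX (p := j.+1) (cusp_vanish Cb))) ?mulr0 //.
by rewrite add0n mulnS; apply: (leq_trans dm); apply: leq_addr.
Qed.

Variables (s : nat) (lam : seq nat).
Hypothesis basis : semimodule_basis n m (diff_values phi) s lam.
Local Notation L a := (nth 0%N lam a).
Local Notation Up := (Lambda_upto n m lam).
Local Notation ln a := (ell n m lam n a).
Local Notation lm a := (ell n m lam m a).
Local Notation tcrit := (tcrit n m lam).

Let valueP v : Up s.+1 v <-> exists w, vanish v (theta w) /\ theta w v != 0.
Proof.
have [_ _ <- _] := basis; split=> [[w /theta_value]|[w /theta_value]]; by exists w.
Qed.

Let L_lt i j : (i < j <= s.+1)%N -> (L i < L j)%N.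
Proof.
have [sz srt _ _] := basis; move=> /andP[ij js].
by apply: (sorted_ltn_nth ltn_trans 0%N srt) => //; rewrite inE sz; lia.
Qed.

Let L_le i j : (i <= j <= s.+1)%N -> (L i <= L j)%N.
Proof.
rewrite leq_eqVlt => /andP[/orP[/eqP->//|ij] js]; apply: ltnW; apply: L_lt.
by rewrite ij.
Qed.

Let L_new a : (a <= s)%N -> ~ Up a (L a.+1).
Proof. by have [_ _ _] := basis; apply. Qed.

Let L_value a : (a <= s.+1)%N -> Up s.+1 (L a).
Proof. by move=> as1; apply/UpP; exists a, 0%N, 0%N; split=> //; lia. Qed.

Let dxE : theta (dx R) = tpow R 1 * ddt (tpow R n). Proof. exact: (theta_dx Cb). Qed.
Let dyE : theta (dy R) = tpow R 1 * ddt b. Proof. exact: (theta_dy Cb). Qed.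

Let tdxE k : theta (dx R) k = if k == n then n%:R else 0.
Proof. by rewrite dxE t_ddt /tpow; case: eqP => [->|]; rewrite ?mul0rn. Qed.

Let n_value : Up s.+1 n.
Proof.
apply/valueP; exists (dx R); split=> [k kn|]; rewrite tdxE; first by rewrite ltn_eqF.
by rewrite eqxx pnatr_eq0; lia.
Qed.

Let m_value : Up s.+1 m.
Proof.
apply/valueP; exists (dy R); split=> [k km|]; rewrite dyE t_ddt.
  by rewrite (cusp_vanish Cb km) mul0rn.
by rewrite mulrn_eq0 negb_or (cusp_lead Cb) andbT; lia.
Qed.

Let theta_split w : theta w = along n b (w 0 0) * theta (dx R) + along n b (w 0 1) * theta (dy R).
Proof. by rewrite dxE dyE thetaE. Qed.

Let dy_vanish : vanish m (theta (dy R)).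
Proof. by move=> k km; rewrite dyE t_ddt (cusp_vanish Cb km) mul0rn. Qed.

Let dx_vanish : vanish n (theta (dx R)).
Proof. by move=> k kn; rewrite tdxE ltn_eqF. Qed.

Let L0 : L 0 = n.
Proof.
apply/eqP; rewrite eqn_leq; apply/andP; split.
  have /UpP[i [p [q [is1 e]]]] := n_value.
  by have := L_le (i := 0) (j := i); lia.
have /valueP[w [vw w0]] := L_value (leq0n s.+1).
rewrite leqNgt; apply/negP => lt; move: w0; rewrite theta_split fpsDE.
rewrite (vanishM (M := 0) _ dx_vanish) ?add0n //.
rewrite (vanishM (M := 0) _ dy_vanish) ?add0n ?addr0 ?eqxx //.
exact: ltn_trans lt nm.
Qed.

Let L1 : L 1 = m.
Proof.
have nUm : ~ Up 0 m.
  move=> /UpP[i [p [q [i0 e]]]]; have {}i0 : i = 0%N by lia.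
  rewrite i0 L0 in e; case: q e => [|q]; last by rewrite mulnS; lia.
  rewrite muln0 addn0 -mulnS => e; move: cop.
  by rewrite e /coprime gcdnMr; lia.
have Lm : (L 1 <= m)%N.
  have /UpP[i [p [q [is1 e]]]] := m_value.
  case: i is1 e => [|i] is1 e; first by case: nUm; apply/UpP; exists 0%N, p, q.
  by have := L_le (i := 1) (j := i.+1); lia.
apply/eqP; rewrite eqn_leq Lm leqNgt; apply/negP => lt.
have nU1 := L_new (leq0n s).
have L01 : (n < L 1)%N by rewrite -L0; apply: L_lt.
have /valueP[w [vw w0]] := L_value (ltn0Sn s); case/eqP: w0.
rewrite theta_split fpsDE [X in _ + X](vanishM (M := 0) _ dy_vanish) ?addr0 //.
have -> : theta (dx R) = fps_const n%:R * tpow R n.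
  apply/funext => k; rewrite fps_constME tdxE /tpow.
  by case: eqP; rewrite ?mulr1 ?mulr0.
rewrite mulrCA fps_constME [along _ _ _ * _]mulrC -(subnKC (ltnW L01)) tpowME.
rewrite along_low ?mulr0 //.
  by lia.
apply/negP => /dvdnP[p ep]; apply: nU1; apply/UpP; exists 0%N, p, 0%N.
by rewrite L0; split=> //; lia.
Qed.

Lemma standard_exists a : (a <= s)%N ->
  exists om k A j B es e, standard n m b lam a.+1 om k A j B es e.
Proof.
elim: a => [|a IH] as1.
  by do 7!eexists; apply: (standard_base Cb L0 L1).
have [om [k [A [j [B [es [e st]]]]]]] := IH (ltnW as1).
apply: (standard_step Cb st) => //.
- by move=> i ia; apply: L_lt; lia.
- exact: L_new.
- by apply/valueP; apply: L_value.
move=> w v vw w0; have /UpP[i [p [q [is1 e']]]] : Up s.+1 v by apply/valueP; exists w.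
have [ia|ai] := leqP i a.+1; first by left; apply/UpP; exists i, p, q.
by right; have := L_le (i := a.+2) (j := i); lia.
Qed.

(** Once the semimodule is exhausted, a value outside [Lambda_s] is impossible, so
    both corners at the last generator reduce to invariant forms. *)
Lemma cusp_saito_basis : exists w1 w2,
  [/\ saito_basis phi w1 w2,
      wtf (tcrit s.+1 + n * ln s.+1) w1 /\ ~ wtf (tcrit s.+1 + n * ln s.+1).+1 w1,
      wtf (tcrit s.+1 + m * lm s.+1) w2 /\ ~ wtf (tcrit s.+1 + m * lm s.+1).+1 w2,
      (0 < ln s.+1 < m)%N & (0 < lm s.+1 < n)%N].
Proof.
have [om [k [A [j [B [es [e st]]]]]]] := standard_exists (leqnn s).
have co := st_corner st; have ka := cor_k co; have ja := cor_j co.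
set a := s.+1 in st co ka ja *.
pose xn := (a, ln a, 0%N); pose yn := (k, 0%N, A).
pose xm := (a, 0%N, lm a); pose ym := (j, B, 0%N).
have wxn : weight_of n m lam xn = (L a + n * ln a)%N.
  by rewrite /xn /weight_of /= muln0 addn0.
have wxm : weight_of n m lam xm = (L a + m * lm a)%N.
  by rewrite /xm /weight_of /= muln0 addn0.
have en : weight_of n m lam xn = weight_of n m lam yn.
  by rewrite wxn (cor_x co) /yn /weight_of /= muln0 addn0.
have em : weight_of n m lam xm = weight_of n m lam ym.
  by rewrite wxm (cor_y co) /ym /weight_of /= muln0 addn0.
have [fn hfn Pn] := syzygy_reduced Cb st (x := xn) (y := yn) (leqnn a) (ltnW ka) en L0.
have [fm hfm Pm] := syzygy_reduced Cb st (x := xm) (y := ym) (leqnn a) (ltnW ja) em L0.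
set wn := syzygy m b a om xn yn fn in Pn.
set wm := syzygy m b a om xm ym fm in Pm.
have inv w u : (theta w = 0 \/ exists v, [/\ (u < v)%N, ~ Up a v,
      vanish v (theta w) & theta w v != 0]) -> invariant_curve phi w.
  case=> [e0|[v [_ nU vw w0]]]; first by apply/theta_eq0.
  by case: nU; apply/valueP; exists w.
exists wn, wm; split.
- apply: (saito_criterion Cb (inv _ _ Pn) (inv _ _ Pm)).
  by apply: (wedge_corners Cb st); [rewrite -wxn|rewrite -wxm].
- split.
    apply: (wtf_le _ (syzygy_wt Cb st (x := xn) (y := yn) (leqnn a) (ltnW ka) en hfn)).
    by rewrite wxn; lia.
  move=> [_ H]; apply: (syzygy_exact Cb st (x := xn) (y := yn) erefl ka en hfn).
  by apply: (wt_le _ H); rewrite wxn; lia.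
- split.
    apply: (wtf_le _ (syzygy_wt Cb st (x := xm) (y := ym) (leqnn a) (ltnW ja) em hfm)).
    by rewrite wxm; lia.
  move=> [_ H]; apply: (syzygy_exact Cb st (x := xm) (y := ym) erefl ja em hfm).
  by apply: (wt_le _ H); rewrite wxm; lia.
- exact: cor_ln co.
exact: cor_lm co.
Qed.

End Core.

(** * Change of coordinates *)

Lemma bilinear_swap (A : comNzRingType) (p q a b c d x y : A) :
  (p * a + q * b) * x + (p * c + q * d) * y
  = p * (a * x + c * y) + q * (b * x + d * y).
Proof. ring. Qed.

Section Pull.
Variables (R : realType) (u v : germ R).
Hypotheses (u0 : germ_val u 0%N 0%N = 0) (v0 : germ_val v 0%N 0%N = 0).
Implicit Types (w : form1 R) (g h : germ R).

Definition gcomp h : germ R := Germ (conv2_comp22 (germP h) (germP u) (germP v) u0 v0).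
Definition gddx h : germ R := Germ (conv2_ddx (germP h)).
Definition gddy h : germ R := Germ (conv2_ddy (germP h)).

Lemma gcompD g h : gcomp (g + h) = gcomp g + gcomp h.
Proof.
suff e : germ_val (gcomp (g + h)) = germ_val (gcomp g + gcomp h) by exact: val_inj e.
by rewrite [RHS]germD; exact: (comp22D u0 v0 (germ_val g) (germ_val h)).
Qed.

Lemma gcompM g h : gcomp (g * h) = gcomp g * gcomp h.
Proof.
suff e : germ_val (gcomp (g * h)) = germ_val (gcomp g * gcomp h) by exact: val_inj e.
by rewrite [RHS]germM; exact: (comp22M u0 v0 (germ_val g) (germ_val h)).
Qed.

Lemma gcomp0 : gcomp 0 = 0.
Proof. by apply: (addIr (gcomp 0)); rewrite -gcompD !add0r. Qed.

Definition pull w : form1 R := \row_i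
  if i == 0 then gcomp (w 0 0) * gddx u + gcomp (w 0 1) * gddx v
  else gcomp (w 0 0) * gddy u + gcomp (w 0 1) * gddy v.

Lemma pull0E w : pull w 0 0 = gcomp (w 0 0) * gddx u + gcomp (w 0 1) * gddx v.
Proof. by rewrite mxE. Qed.

Lemma pull1E w : pull w 0 1 = gcomp (w 0 0) * gddy u + gcomp (w 0 1) * gddy v.
Proof. by rewrite mxE. Qed.

Lemma form1P w w' : w 0 0 = w' 0 0 -> w 0 1 = w' 0 1 -> w = w'.
Proof.
move=> e0 e1; apply/rowP => i.
by have [->|->] : i = 0 \/ i = 1
  by case: i => [[|[|//]] p]; [left|right]; apply: val_inj.
Qed.

Lemma pullD w w' : pull (w + w') = pull w + pull w'.
Proof.
by apply: form1P; rewrite [RHS]mxE ?pull0E ?pull1E [_ 0 0 in LHS]mxE ![(w + w') 0 1]mxE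
  !gcompD; ring.
Qed.

Lemma pullZ g w : pull (g *: w) = gcomp g *: pull w.
Proof.
by apply: form1P; rewrite [RHS]mxE ?pull0E ?pull1E ![(g *: w) _ _]mxE !gcompM; ring.
Qed.

Lemma pullback_arc_pull (a b : fps1 R) w : a 0%N = 0 -> b 0%N = 0 ->
  pullback_arc (a, b) (pull w) = pullback_arc (comp21 u a b, comp21 v a b) w.
Proof.
move=> a0 b0; rewrite /pullback_arc /= pull0E pull1E !germD !germM.
rewrite !(comp21D a0 b0) !(comp21M a0 b0) /= !(comp21_comp22 _ a0 b0 u0 v0).
rewrite (ddt_comp21 u a0 b0) (ddt_comp21 v a0 b0).
exact: bilinear_swap.
Qed.

End Pull.

Section Inverse.
Variables (R : realType) (X Y u v : germ R).
Hypotheses (X0 : germ_val X 0%N 0%N = 0) (Y0 : germ_val Y 0%N 0%N = 0).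
Hypotheses (u0 : germ_val u 0%N 0%N = 0) (v0 : germ_val v 0%N 0%N = 0).
Hypotheses (XK : comp22 X u v = ser_x R) (YK : comp22 Y u v = ser_y R).
Implicit Types (w : form1 R) (g h : germ R).

Lemma gcompK h : gcomp u0 v0 (gcomp X0 Y0 h) = h.
Proof.
apply: val_inj => /=; rewrite (comp22_comp22 u0 v0 _ X0 Y0) XK YK.
exact: comp22_xy.
Qed.

(** By the chain rule the two Jacobian matrices are inverse to each other. *)
Lemma pullK w : pull u0 v0 (pull X0 Y0 w) = w.
Proof.
have dX : ddx (ser_x R) = 1.
  apply/funext => i; apply/funext => j; rewrite /ddx /ser_x.
  have -> : (1 : fps2 R) = const2 1 by rewrite rmorph1.
  by rewrite const2E; case: i => [|i]; case: j => [|j]; rewrite ?mulr1n ?mul0rn.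
have dY : ddy (ser_y R) = 1.
  apply/funext => i; apply/funext => j; rewrite /ddy /ser_y.
  have -> : (1 : fps2 R) = const2 1 by rewrite rmorph1.
  by rewrite const2E; case: i => [|i]; case: j => [|j]; rewrite ?mulr1n ?mul0rn.
have dX' : ddy (ser_x R) = 0.
  by apply/funext => i; apply/funext => j; rewrite /ddy /ser_x andbF mul0rn.
have dY' : ddx (ser_y R) = 0.
  by apply/funext => i; apply/funext => j; rewrite /ddx /ser_y mul0rn.
have xx := ddx_comp22 X u0 v0; have xy := ddy_comp22 X u0 v0.
have yx := ddx_comp22 Y u0 v0; have yy := ddy_comp22 Y u0 v0.
rewrite XK ?dX ?dX' in xx xy; rewrite YK ?dY ?dY' in yx yy.
have cK h : comp22 (comp22 h X Y) u v = h.
  by rewrite (comp22_comp22 u0 v0 _ X0 Y0) XK YK comp22_xy.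
apply: form1P; [rewrite pull0E|rewrite pull1E].
  suff e : germ_val (gcomp u0 v0 (pull X0 Y0 w 0 0) * gddx u
      + gcomp u0 v0 (pull X0 Y0 w 0 1) * gddx v) = germ_val (w 0 0) by exact: val_inj e.
  rewrite germD !germM /= pull0E pull1E !germD !germM /=.
  rewrite !(comp22D u0 v0) !(comp22M u0 v0) !cK.
  transitivity (germ_val (w 0 0) * 1 + germ_val (w 0 1) * 0); last by rewrite mulr1 mulr0 addr0.
  by rewrite xx yx; exact: bilinear_swap.
suff e : germ_val (gcomp u0 v0 (pull X0 Y0 w 0 0) * gddy u
    + gcomp u0 v0 (pull X0 Y0 w 0 1) * gddy v) = germ_val (w 0 1) by exact: val_inj e.
rewrite germD !germM /= pull0E pull1E !germD !germM /=.
rewrite !(comp22D u0 v0) !(comp22M u0 v0) !cK.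
transitivity (germ_val (w 0 0) * 0 + germ_val (w 0 1) * 1); last by rewrite mulr1 mulr0 add0r.
by rewrite xy yy; exact: bilinear_swap.
Qed.

End Inverse.

Theorem theorem1p1 (R : realType) (n m : nat)
    (C : germ R) (phi : fps1 R * fps1 R) (Psi : coords R)
    (s : nat) (lambda : seq nat) :
  (2 <= n)%N -> (n < m)%N -> coprime n m ->
  germ_irreducible C ->
  primitive_parametrization C phi ->
  adapted n m phi Psi ->
  semimodule_basis n m (diff_values phi) s lambda ->
  (exists w w' : form1 R,
     [/\ invariant_curve phi w, invariant_curve phi w',
         nuD n m Psi w = Some (crit n m lambda s.+1)
       & nuD n m Psi w' = Some (crit_tilde n m lambda s.+1)]) /\
  (forall w w' : form1 R,
     invariant_curve phi w -> invariant_curve phi w' ->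
     nuD n m Psi w = Some (crit n m lambda s.+1) ->
     nuD n m Psi w' = Some (crit_tilde n m lambda s.+1) ->
     saito_basis phi w w').
Proof.
move=> n2 nm cop _ [[c1 c2 phi10 phi20] _ _] [xE bE] basis.
case: phi c1 c2 phi10 phi20 xE bE basis => a1 a2 c1 c2 a10 a20 xE bE basis.
rewrite /= in c1 c2 a10 a20 xE bE.
set b := comp21 (co_y Psi) a1 a2 in bE.
have [vb bm] := (ser_ord_Some _ _).1 bE.
have Cb : cusp n m b.
  split=> //; exact: (convergent1_comp21 (germP _) c1 c2 a10 a20).
pose phi' := (tpow R n, b).
pose back := pull (co_x0 Psi) (co_y0 Psi).
pose push := pull (inv_x0 Psi) (inv_y0 Psi).
have pushK w : back (push w) = w by apply: pullK; [exact: inv_xK|exact: inv_yK].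
have backK w : push (back w) = w by apply: pullK; [exact: co_xK|exact: co_yK].
have nu_back w : nuC (a1, a2) (back w) = nuC phi' w.
  by rewrite /nuC (pullback_arc_pull _ _ _ a10 a20) xE.
have nu_push w : nuC phi' (push w) = nuC (a1, a2) w by rewrite -nu_back pushK.
have basis' : semimodule_basis n m (diff_values phi') s lambda.
  suff <- : diff_values (a1, a2) = diff_values phi' by [].
  apply/funext => k; apply/propext; split=> -[w wk].
    by exists (push w); rewrite nu_push.
  by exists (back w); rewrite nu_back.
have [w1 [w2 [sb [o1 n1] [o2 n2'] l1 l2]]] := cusp_saito_basis Cb basis'.
set l := ell n m lambda n s.+1 in o1 n1 l1.
set l' := ell n m lambda m s.+1 in o2 n2' l2.
set t := tcrit n m lambda s.+1 in o1 n1 o2 n2'.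
have critE : crit n m lambda s.+1 = minn (t + n * l) (t + m * l') by [].
have crit_tildeE : crit_tilde n m lambda s.+1 = maxn (t + n * l) (t + m * l') by [].
have inv_push w : invariant_curve (a1, a2) w <-> invariant_curve phi' (push w).
  by rewrite /invariant_curve nu_push.
have nuDP w d : nuD n m Psi w = Some d <->
    wt_form n m d (germ_val (push w 0 0)) (germ_val (push w 0 1)) /\
    ~ wt_form n m d.+1 (germ_val (push w 0 0)) (germ_val (push w 0 1)).
  rewrite /push pull0E pull1E !germD !germM; exact: mono_ord_formP.
have saito_push w w' : saito_basis phi' (push w) (push w') -> saito_basis (a1, a2) w w'.
  case=> i i' span free; split; [exact/inv_push|exact/inv_push| |].
    move=> v /inv_push /span[g [h e]].
    exists (gcomp (co_x0 Psi) (co_y0 Psi) g), (gcomp (co_x0 Psi) (co_y0 Psi) h).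
    by rewrite -[LHS]pushK e /back pullD !pullZ -/back !pushK.
  move=> g h e; have e' : push (g *: w + h *: w') = 0.
    by rewrite e -(scale0r (0 : form1 R)) /push pullZ gcomp0 !scale0r.
  move: e'; rewrite /push pullD !pullZ => /free[eg eh].
  have gK f : gcomp (co_x0 Psi) (co_y0 Psi) (gcomp (inv_x0 Psi) (inv_y0 Psi) f) = f.
    by apply: gcompK; [exact: inv_xK|exact: inv_yK].
  by rewrite -[g]gK -[h]gK eg eh !gcomp0.
have gap p q : (m * l' <> n * l + (n * p + m * q))%N.
  move=> e; have ql : (q < l')%N.
    rewrite ltnNge; apply/negP => le; have : (m * l' <= m * q)%N by rewrite leq_mul2l le orbT.
    by have : (0 < n * l)%N by [rewrite muln_gt0; lia]; lia.
  have [|||] := @rep_uniq n m 0 l' (l + p) q cop; [lia|lia| |lia].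
  by rewrite muln0 mulnDr; lia.
have gap' p q : (n * l <> m * l' + (n * p + m * q))%N.
  move=> e; have pl : (p < l)%N.
    rewrite ltnNge; apply/negP => le; have : (n * l <= n * p)%N by rewrite leq_mul2l le orbT.
    by have : (0 < m * l')%N by [rewrite muln_gt0; lia]; lia.
  have cop' : coprime m n by rewrite coprime_sym.
  have [|||] := @rep_uniq m n 0 l (l' + q) p cop'; [lia|lia| |lia].
  by rewrite muln0 mulnDr; lia.
have [i1 i2 _ _] := sb.
have sb' : saito_basis phi' w2 w1.
  case: sb => _ _ span free; split=> // [w /span[g [h ->]]|g h].
    by exists h, g; rewrite addrC.
  by rewrite addrC => /free[-> ->].
have [lt|] := boolP (t + n * l < t + m * l')%N; last rewrite -leqNgt => le.
  have minE : minn (t + n * l) (t + m * l') = (t + n * l)%N by apply/minn_idPl; exact: ltnW.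
  have maxE : maxn (t + n * l) (t + m * l') = (t + m * l')%N by apply/maxn_idPr; exact: ltnW.
  rewrite critE crit_tildeE minE maxE; split.
    exists (back w1), (back w2); split.
    - by apply/inv_push; rewrite backK.
    - by apply/inv_push; rewrite backK.
    - by apply/nuDP; rewrite backK.
    - by apply/nuDP; rewrite backK.
  move=> w w' /inv_push iw /inv_push iw' /nuDP[ow nw] /nuDP[ow' nw'].
  apply/saito_push.
  apply: (saito_basis_of_orders Cb sb lt _ o1 n1 o2 iw iw' ow nw ow' nw').
  by move=> p q; have := gap p q; lia.
have lt : (t + m * l' < t + n * l)%N.
  by have := gap 0%N 0%N; rewrite !muln0 addn0; lia.
have minE : minn (t + n * l) (t + m * l') = (t + m * l')%N by apply/minn_idPr.
have maxE : maxn (t + n * l) (t + m * l') = (t + n * l)%N by apply/maxn_idPl.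
rewrite critE crit_tildeE minE maxE; split.
  exists (back w2), (back w1); split.
  - by apply/inv_push; rewrite backK.
  - by apply/inv_push; rewrite backK.
  - by apply/nuDP; rewrite backK.
  - by apply/nuDP; rewrite backK.
move=> w w' /inv_push iw /inv_push iw' /nuDP[ow nw] /nuDP[ow' nw'].
apply/saito_push.
apply: (saito_basis_of_orders Cb sb' lt _ o2 n2' o1 iw iw' ow nw ow' nw').
by move=> p q; have := gap' p q; lia.
Qed.
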